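(* The following identity holds, the sums running over all triples $\vec\mu=(\mu^1,\mu^2,\mu^3)$ of partitions (including empty ones): $$\sum_{\vec\mu}\mathcal W_{\vec\mu}(q)\prod_{i=1}^3(-1)^{|\mu^i|}e^{-|\mu^i|t_i}\,\mathcal W_{(\mu^i)^t}(q)=\sum_{\vec\mu}\widetilde{\mathcal W}_{\vec\mu}(q)\prod_{i=1}^3(-1)^{|\mu^i|}e^{-|\mu^i|t_i}\,\mathcal W_{(\mu^i)^t}(q).$$
   Context: Both sides are formal power series in $e^{-t_1},e^{-t_2},e^{-t_3}$ whose coefficients are functions of $q$ (expressions in fractional powers of $q$). For a partition $\mu=(\mu_1\ge\mu_2\ge\cdots)$, $|\mu|$ is its size, $\mu^t$ its transpose, $\kappa_\mu=\sum_i\mu_i(\mu_i-2i+1)$, $z_\mu=\prod_{i\ge1}i^{m_i}m_i!$ with $m_i$ the number of parts equal to $i$, $2\mu=(2\mu_1\ge 2\mu_2\ge\cdots)$, and $\chi_\mu(\nu)$ is the value of the irreducible character of $S_{|\mu|}$ labelled by $\mu$ on the class of cycle type $\nu$ (for $|\nu|=|\mu|$; terms with mismatched sizes are absent). $s_\mu$ are Schur functions, and $c^\rho_{\mu\nu}$ the Littlewood–Richardson coefficients, $s_\mu s_\nu=\sum_\rho c^\rho_{\mu\nu}s_\rho$. Define $$\mathcal W_\mu(q)=s_\mu(x_i=q^{-i+\frac12},\ i\ge1),\qquad \mathcal W_{\mu/\nu}(q)=\sum_\lambda c^\mu_{\nu\lambda}\mathcal W_\lambda(q),$$ $$\mathcal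 W_{\mu\nu}(q)=q^{\kappa_\mu/2+\kappa_\nu/2}\sum_\lambda\mathcal W_{\mu^t/\lambda}(q)\mathcal W_{\nu^t/\lambda}(q),$$ where $\mathcal W_\mu$ is identified with the function of $q^{1/2}$ it represents (power sums specialize to $p_n=1/(q^{n/2}-q^{-n/2})$). The physical vertex is $$\mathcal W_{\mu^1,\mu^2,\mu^3}(q)=q^{\kappa_{\mu^2}/2+\kappa_{\mu^3}/2}\sum_{\rho,\rho^1,\rho^3}c^{\mu^1}_{\rho\rho^1}c^{(\mu^3)^t}_{\rho\rho^3}\frac{\mathcal W_{(\mu^2)^t\rho^1}(q)\,\mathcal W_{\mu^2\rho^3}(q)}{\mathcal W_{\mu^2}(q)},$$ and the mathematical vertex is $$\widetilde{\mathcal W}_{\mu^1,\mu^2,\mu^3}(q)=q^{-(\kappa_{\mu^1}-2\kappa_{\mu^2}-\frac12\kappa_{\mu^3})/2}\sum_{\nu^+,\nu^1,\nu^3,\eta^1,\eta^3}c^{\nu^+}_{(\nu^1)^t\mu^2}\,c^{\mu^1}_{(\eta^1)^t\nu^1}\,c^{\mu^3}_{\eta^3(\nu^3)^t}\,q^{(-2\kappa_{\nu^+}-\frac{\kappa_{\nu^3}}2)/2}\,\mathcal W_{\nu^+\nu^3}(q)\sum_\sigma\frac{1}{z_\sigma}\chi_{\eta^1}(\sigma)\chi_{\eta^3}(2\sigma).$$ *)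

(* Defs.v *)
From Stdlib Require Import ClassicalEpsilon.
From HB Require Import structures.
From mathcomp Require Import all_boot all_order all_algebra.
From mathcomp Require Import all_fingroup all_solvable all_field all_character.
From mathcomp Require Import mpoly.

Set Implicit Arguments.
Unset Strict Implicit.
Unset Printing Implicit Defensive.

Import Order.TTheory GRing.Theory Num.Theory.

Local Open Scope ring_scope.

(* -------------------------------------------------------------------- *)
(* Partitions: weakly decreasing sequences of positive natural numbers,
   so that |mu| = sumn mu and the empty partition is [::].               *)

Definition partition_seq (n : nat) (t : n.-tuple 'I_n.+1) : seq nat :=
  [seq k <- map (@nat_of_ord n.+1) t | (0 < k)%N].

(* The partitions of n, each listed once: a partition of n is a weakly
   decreasing n-tuple of numbers <= n of sum n, stripped of its zeros.   *)
Definition parts (n : nat) : seq (seq nat) :=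
  [seq partition_seq t | t : n.-tuple 'I_n.+1 <- enum {: n.-tuple 'I_n.+1}
     & sorted geq (map (@nat_of_ord n.+1) t) &&
       (sumn (map (@nat_of_ord n.+1) t) == n)].

Definition parts_le (n : nat) : seq (seq nat) :=
  flatten [seq parts k | k <- iota 0 n.+1].

Definition conj_part (mu : seq nat) : seq nat :=
  [seq count (fun k => j < k)%N mu | j <- iota 0 (head 0%N mu)].

(* The index i below is 0-based. *)
Definition kappa (mu : seq nat) : int :=
  \sum_(i < size mu)
     (nth 0%N mu i)%:Z * ((nth 0%N mu i)%:Z - 2 * (i.+1)%:Z + 1).

Definition zee (mu : seq nat) : nat :=
  (\prod_(1 <= i < (sumn mu).+1) (i ^ count_mem i mu * (count_mem i mu)`!))%N.

Definition double_part (mu : seq nat) : seq nat := map double mu.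

(* -------------------------------------------------------------------- *)
(* Irreducible characters of the symmetric groups.                       *)

Definition cycle_type (n : nat) (s : 'S_n) : seq nat :=
  sort geq [seq #|pred_of_set A| | A <- enum (porbits s)].

(* reshape_index mu i is the block containing i when {0, .., n-1} is cut
   into consecutive blocks of sizes mu_1, mu_2, ..                       *)
Definition young_set (n : nat) (mu : seq nat) : {set 'S_n} :=
  [set s : 'S_n | [forall i, reshape_index mu (s i) == reshape_index mu i]].

Lemma young_group_set (n : nat) (mu : seq nat) : group_set (young_set n mu).
Proof.
apply/group_setP; split=> [|s t]; first by rewrite inE; apply/forallP=> i; rewrite perm1.
rewrite !inE => /forallP s_stab /forallP t_stab; apply/forallP=> i.
by rewrite permM (eqP (t_stab _)) s_stab.
Qed.
Canonical young_group (n : nat) (mu : seq nat) : {group 'S_n} :=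
  Group (young_group_set n mu).

Lemma cf_sgn_subproof (n : nat) (H : {group 'S_n}) :
  is_class_fun <<H>>%g [ffun s : 'S_n => (-1) ^+ odd_perm s *+ (s \in H)].
Proof.
rewrite genGid; apply: intro_class_fun => [s t Hs Ht | s Hs].
  by rewrite groupJr // odd_permJ.
by rewrite (negPf Hs).
Qed.
Definition cf_sgn (n : nat) (H : {group 'S_n}) : 'CF(H) :=
  Cfun 0 (cf_sgn_subproof H).

(* For a partition mu of n, the irreducible character labelled by mu is the
   unique common irreducible constituent of the character induced from the
   trivial character of the Young subgroup of mu and of the one induced from
   the sign character of the Young subgroup of the transpose of mu
   (James-Kerber, The Representation Theory of the Symmetric Group, 2.1).
   Thus [:: n] labels the trivial character.                              *)
Definition sym_irr (n : nat) (mu : seq nat) : 'CF([set: 'S_n]) :=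
  if [pick i : Iirr [set: 'S_n]
        | (i \in irr_constt ('Ind[[set: 'S_n]] (1 : 'CF(young_group n mu))))
       && (i \in irr_constt
                  ('Ind[[set: 'S_n]] (cf_sgn (young_group n (conj_part mu)))))]
  is Some i then 'chi_i else 0.

(* chi_mu(nu); it is 0 unless nu is a cycle type in the symmetric group on
   |mu| letters, i.e. unless nu is a partition with |nu| = |mu|.          *)
Definition sym_char (mu nu : seq nat) : algC :=
  if [pick s : 'S_(sumn mu) | cycle_type s == nu] is Some s
  then sym_irr (sumn mu) mu s else 0.

(* -------------------------------------------------------------------- *)
(* Schur functions and Littlewood-Richardson coefficients.               *)

(* \det (x_i ^ (mu_j + n - j)), for mu with at most n parts.             *)
Definition alternant (n : nat) (mu : seq nat) : {mpoly algC[n]} :=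
  \det (\matrix_(i < n, j < n)
          ('X_i : {mpoly algC[n]}) ^+ (nth 0%N mu j + (n - j.+1))%N).

(* The Schur polynomial s_mu(x_1, .., x_n), for mu with at most n parts, as
   a ratio of alternants; it is a polynomial, seen here inside the field of
   rational functions in x_1, .., x_n.                                    *)
Definition schur (n : nat) (mu : seq nat) : {fraction {mpoly algC[n]}} :=
  tofrac (alternant n mu) / tofrac (alternant n [::]).

Definition power_sum (n k : nat) : {mpoly algC[n]} := \sum_(i < n) 'X_i ^+ k.

(* An identity between symmetric functions of degree d is expressed as the
   identity of the corresponding polynomials in n variables for all n >= d. *)

(* s_mu * s_nu = \sum_rho c rho * s_rho; the s_rho being linearly
   independent, the c rho, for rho a partition of |mu| + |nu|, are unique. *)
Definition is_LR (mu nu : seq nat) (c : seq nat -> algC) : Prop :=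
  forall n : nat, (sumn mu + sumn nu <= n)%N ->
    schur n mu * schur n nu =
    \sum_(rho <- parts (sumn mu + sumn nu)%N)
       tofrac (mpolyC n (c rho)) * schur n rho.

(* LR rho mu nu is c^rho_{mu nu}. *)
Definition LR (rho mu nu : seq nat) : algC :=
  if rho \in parts (sumn mu + sumn nu)%N
  then epsilon (inhabits (fun=> 0)) (is_LR mu nu) rho else 0.

(* f is the expression of s_mu as a polynomial in the power sums
   p_1, .., p_|mu|; the power sums being algebraically independent, f is
   unique.                                                                *)
Definition is_power_sum_expr (mu : seq nat) (f : {mpoly algC[sumn mu]}) : Prop :=
  forall n : nat, (sumn mu <= n)%N ->
    schur n mu = tofrac (f \mPo [tuple power_sum n i.+1 | i < sumn mu]).

Definition schur_power_sum (mu : seq nat) : {mpoly algC[sumn mu]} :=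
  epsilon (inhabits 0) (@is_power_sum_expr mu).

(* -------------------------------------------------------------------- *)
(* Functions of q: the field of rational functions in q^(1/4).  The numbers
   kappa are integers, so all the powers of q that occur lie there.       *)

Definition qfun : fieldType := {fraction {poly algC}}.

Definition qconst (c : algC) : qfun := tofrac (c%:P).

(* q4 k is q^(k/4). *)
Definition q4 (k : int) : qfun := (tofrac ('X : {poly algC}) : qfun) ^ k.

(* The power sum p_n at x_i = q^(-i + 1/2), i >= 1, i.e.
   \sum_i q^(- n (i - 1/2)) = 1 / (q^(n/2) - q^(-n/2)).                   *)
Definition power_sum_q (n : nat) : qfun := (q4 (2 * n%:Z) - q4 (- (2 * n%:Z)))^-1.

(* W_mu(q) = s_mu(x_i = q^(-i + 1/2), i >= 1). *)
Definition W1 (mu : seq nat) : qfun :=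
  mmap qconst (fun i : 'I_(sumn mu) => power_sum_q i.+1) (schur_power_sum mu).

(* In all the sums below, the omitted terms vanish because LR rho mu nu is 0
   unless |rho| = |mu| + |nu| (and sym_char mu nu is 0 unless |mu| = |nu|). *)

(* W_{mu / nu}(q). *)
Definition Wskew (mu nu : seq nat) : qfun :=
  \sum_(la <- parts_le (sumn mu)) qconst (LR mu nu la) * W1 la.

(* W_{mu nu}(q). *)
Definition W2 (mu nu : seq nat) : qfun :=
  q4 (2 * kappa mu + 2 * kappa nu) *
  \sum_(la <- parts_le (sumn mu))
     Wskew (conj_part mu) la * Wskew (conj_part nu) la.

Definition physical_vertex (mu1 mu2 mu3 : seq nat) : qfun :=
  q4 (2 * kappa mu2 + 2 * kappa mu3) *
  \sum_(rho <- parts_le (sumn mu1))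
  \sum_(rho1 <- parts_le (sumn mu1))
  \sum_(rho3 <- parts_le (sumn mu3))
     qconst (LR mu1 rho rho1 * LR (conj_part mu3) rho rho3) *
     (W2 (conj_part mu2) rho1 * W2 mu2 rho3 / W1 mu2).

Definition mathematical_vertex (mu1 mu2 mu3 : seq nat) : qfun :=
  q4 (- (2 * kappa mu1 - 4 * kappa mu2 - kappa mu3)) *
  \sum_(nup <- parts_le (sumn mu1 + sumn mu2)%N)
  \sum_(nu1 <- parts_le (sumn mu1))
  \sum_(nu3 <- parts_le (sumn mu3))
  \sum_(eta1 <- parts_le (sumn mu1))
  \sum_(eta3 <- parts_le (sumn mu3))
     qconst (LR nup (conj_part nu1) mu2 *
             LR mu1 (conj_part eta1) nu1 *
             LR mu3 eta3 (conj_part nu3)) *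
     q4 (- 4 * kappa nup - kappa nu3) *
     W2 nup nu3 *
     qconst (\sum_(sigma <- parts (sumn eta1))
               (zee sigma)%:R^-1 * sym_char eta1 sigma *
               sym_char eta3 (double_part sigma)).

(* -------------------------------------------------------------------- *)
(* Formal power series over qfun in Q_i = e^(- t_i), i = 1, 2, 3, given by
   their coefficients: f d1 d2 d3 is that of Q_1^d1 Q_2^d2 Q_3^d3.        *)
Definition series3 : Type := nat -> nat -> nat -> qfun.

(* The series \sum_(mu1, mu2, mu3) a mu1 mu2 mu3 *
   Q_1^|mu1| Q_2^|mu2| Q_3^|mu3| over all triples of partitions.          *)
Definition partition_series (a : seq nat -> seq nat -> seq nat -> qfun) : series3 :=
  fun d1 d2 d3 =>
    \sum_(mu1 <- parts d1) \sum_(mu2 <- parts d2) \sum_(mu3 <- parts d3)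
       a mu1 mu2 mu3.

(* Main.v *)
(** Let p be the specialization p_n = 1/(q^(n/2) - q^(-n/2)), so that W_mu = s_mu[p],
    and put G_mu = s_mu[-p]; then (-1)^|mu| W_(mu^t) = G_mu and q^(kappa/2) G_mu = G_(mu^t).
    All sums over partitions below are sums of Schur functions at the alphabets p (1 - c),
    where powers of c record the size of a skewing partition; coefficients of c are compared
    at the infinitely many values c = q^N, at which the alphabet p (1 - c) becomes finite.

    The coefficient of Q_1^d1 Q_2^d2 Q_3^d3 is sum_e h_(d3-e)[-p^2] A_e on either side, with
    sum_e A_e c^e = sum_i h_(d1-i)[Y] h_(d2-i)[Y] h_i[-Y] for Y = - p^2 (1 - c).  On the
    physical side this follows from Cauchy identities alone.

    Mathematical side: the terms with a nonempty eta^1 cancel.  Indeed, chi_eta3 is evaluated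
    at cycle type 2 sigma, so that the sum over mu^3 is the value of a linear functional at
    p_(2n) times an alternant; this value is a sum over the columns k of f(y_k) /
    prod_(j != k) (y_k - y_j) with deg f too small, which is zero by Lagrange interpolation.
    In the remaining sum of q^((kappa_al + kappa_be - kappa_nu)/2) c^nu_(al be) W_al W_be
    s_nu[-p (1 - q^N)], the sum over nu is a product of two Schur polynomials, because
    the weights q^(-m^2/2) turn multiplication by x^b into the substitution of q^(-b) x;
    Cauchy identities conclude. *)

From Stdlib Require Import ClassicalEpsilon FunctionalExtensionality.
From HB Require Import structures.
Require Import Defs.
From mathcomp Require Import all_boot all_order all_algebra.
From mathcomp Require Import all_fingroup all_field all_character.
From mathcomp Require Import ssrcomplements mpoly zify ring.

Set Implicit Arguments.
Unset Strict Implicit.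
Unset Printing Implicit Defensive.

Import Order.TTheory GRing.Theory Num.Theory.

Local Open Scope ring_scope.

(** * Partitions *)

(** Irreducible characters, Littlewood-Richardson coefficients and power sum expansions are given by
    choice, so each must first be identified with something computable. The central object is
    $m!^{-1}\sum_w\chi_\mu(w)p_w$: it makes sense for any sequence of power sums, in particular for
    $-p$ and $p(1-c)$, where there are no letters to substitute. Identities are proved for finite
    alphabets after multiplication by the staircase alternant, where nothing is divided and
    coefficients can be compared; they reach $p(1-c)$ because both sides are polynomials in $c$.

    The cancellation rests on the parts of $2\sigma$ being even. The weight $q^{\kappa/4}$ becomes
    $u^{l^2}$ on exponents, with $u=q^{1/4}$, and raising an exponent $l$ by $k$ contributes
    $u^{k^2}(q^l)^{k/2}$: for $k=2n$ this is polynomial in $q^l$. Taking $N=M+2n$ variables for a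
    partition with at most $M$ rows leaves $2n$ empty rows, whose factors cancel the denominators;
    the numerator then has degree at most $M+n-1$, below $N-1$ as soon as $n>0$. *)

Definition partn_seq (mu : seq nat) : bool := sorted geq mu && all (leq 1) mu.

Lemma geq_trans : transitive geq.
Proof. by move=> y x z /= yx zy; apply: leq_trans zy yx. Qed.

Lemma sumn_filter_pos (s : seq nat) : sumn [seq k <- s | (0 < k)%N] = sumn s.
Proof. by elim: s => //= x s <-; case: x. Qed.

(** The zeros of a weakly decreasing sequence sit at its end, so stripping them loses only their
    number; hence [partition_seq] is injective on sorted tuples of fixed length. *)
Lemma sorted_geq_pos_cat (s : seq nat) : sorted geq s ->
  s = [seq k <- s | (0 < k)%N] ++
      nseq (size s - size [seq k <- s | (0 < k)%N]) 0%N.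
Proof.
elim: s => //= x s IHs p_xs; have /IHs{IHs} s_eq := path_sorted p_xs.
case: x p_xs => [|x] /= p_xs; last by rewrite subSS -s_eq.
have s0 : s = nseq (size s) 0%N.
  apply/all_pred1P/allP=> y ys /=.
  by have /(order_path_min geq_trans)/allP/(_ y ys) := p_xs; rewrite /= leqn0.
have -> : [seq k <- s | (0 < k)%N] = [::] by rewrite s0 filter_nseq.
by rewrite /= -s0.
Qed.

Lemma size_leq_sumn (s : seq nat) : all (leq 1) s -> (size s <= sumn s)%N.
Proof. by elim: s => //= x s IHs /andP[x_gt0 /IHs]; lia. Qed.

Lemma leq_nth_sumn (s : seq nat) i : (nth 0 s i <= sumn s)%N.
Proof.
by elim: s i => [|x s IHs] [|i] //=; [lia | have := IHs i; lia].
Qed.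

Lemma filter_pos_cat_nseq0 (s : seq nat) m :
  all (leq 1) s -> [seq k <- s ++ nseq m 0%N | (0 < k)%N] = s.
Proof. by move=> s_pos; rewrite filter_cat filter_nseq cats0; apply/all_filterP. Qed.

Lemma mem_parts (n : nat) (mu : seq nat) :
  (mu \in parts n) = partn_seq mu && (sumn mu == n).
Proof.
apply/mapP/idP=> [[t] | /andP[/andP[mu_s mu_pos] /eqP mu_n]].
  rewrite mem_filter => /andP[/andP[t_s t_n] _] ->.
  rewrite /partn_seq /partition_seq sumn_filter_pos t_n andbT.
  by rewrite sorted_filter //= ?filter_all //; exact: geq_trans.
have le_mu_n : (size mu <= n)%N by rewrite -mu_n size_leq_sumn.
(* [nth] pads [mu] with zeros up to length [n]; [inord] loses nothing, since every part is at most
   the sum [n]. *)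
pose t : n.-tuple 'I_n.+1 := [tuple inord (nth 0%N mu i) | i < n].
have tE : map (@nat_of_ord n.+1) t = mu ++ nseq (n - size mu) 0%N.
  apply: (@eq_from_nth _ 0%N) => [|i].
    by rewrite size_map size_tuple size_cat size_nseq subnKC.
  rewrite size_map size_tuple => lt_i_n.
  rewrite (nth_map ord0) ?size_tuple // (_ : nth _ _ _ = tnth t (Ordinal lt_i_n)); last first.
    by rewrite (tnth_nth ord0).
  rewrite tnth_mktuple inordK; last by rewrite ltnS; apply: leq_trans (leq_nth_sumn _ _) _;
    rewrite mu_n.
  rewrite nth_cat nth_nseq; case: ltnP => // le_i; rewrite nth_default //=.
  by rewrite if_same.
exists t; last by rewrite /partition_seq tE filter_pos_cat_nseq0.
rewrite mem_filter mem_enum andbT tE sumn_cat sumn_nseq mul0n addn0 mu_n eqxx andbT.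
rewrite (sorted_pairwise geq_trans) pairwise_cat -!(sorted_pairwise geq_trans) mu_s /=.
apply/andP; split; first by apply/allrelP=> x y _ /nseqP[-> _].
by elim: (n - _)%N => //= k; case: k => //= k ->; rewrite andbT.
Qed.

Lemma uniq_parts (n : nat) : uniq (parts n).
Proof.
rewrite map_inj_in_uniq; first by apply: filter_uniq; apply: enum_uniq.
move=> s t.
rewrite !mem_filter => /andP[/andP[s_s _] _] /andP[/andP[t_s _] _] eq_st.
apply/val_inj/(inj_map val_inj); rewrite (sorted_geq_pos_cat s_s).
rewrite (sorted_geq_pos_cat t_s) !size_map !size_tuple.
by move: eq_st; rewrite /partition_seq => ->.
Qed.

Lemma parts0 : parts 0 = [:: [::]].
Proof.
apply/perm_small_eq => //; apply: uniq_perm => //; first exact: uniq_parts.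
move=> mu; rewrite mem_parts inE; apply/idP/eqP=> [|->//].
by case/andP=> /andP[_ /size_leq_sumn le_mu] /eqP mu0; apply/nilP; move: le_mu; rewrite mu0 leqn0.
Qed.

Lemma mem_parts_le n mu : (mu \in parts_le n) = partn_seq mu && (sumn mu <= n)%N.
Proof.
apply/flattenP/andP=> [[s /mapP[k]] | [mu_p mu_n]].
  by rewrite mem_iota add0n ltnS => /andP[_ le_k_n] -> ; rewrite mem_parts => /andP[-> /eqP->].
exists (parts (sumn mu)); last by rewrite mem_parts mu_p eqxx.
by apply: map_f; rewrite mem_iota.
Qed.

Lemma big_parts_le (V : nmodType) n (F : seq nat -> V) :
  \sum_(mu <- parts_le n) F mu = \sum_(k < n.+1) \sum_(mu <- parts k) F mu.
Proof.
rewrite big_flatten big_map -/(index_iota 0 n.+1) big_mkord.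
by [].
Qed.

Lemma big_parts_le_size (V : nmodType) n k (F : seq nat -> V) : (k <= n)%N ->
  (forall mu, sumn mu != k -> F mu = 0) ->
  \sum_(mu <- parts_le n) F mu = \sum_(mu <- parts k) F mu.
Proof.
move=> le_k_n F0; rewrite big_parts_le.
rewrite (bigD1 (Ordinal (le_k_n : (k < n.+1)%N))) //= [X in _ + X]big1 ?addr0 //.
move=> i; rewrite -val_eqE /= => ne_ik; rewrite big_seq big1 // => mu.
by rewrite mem_parts => /andP[_ /eqP mu_i]; apply: F0; rewrite mu_i.
Qed.

Lemma parts_eq (mu nu : seq nat) : all (leq 1) mu -> all (leq 1) nu ->
  nth 0%N mu =1 nth 0%N nu -> mu = nu.
Proof.
elim: mu nu => [|x mu IHmu] [|y nu] //=.
- by move=> _ /andP[y_gt0 _] /(_ 0%N) /= y0; rewrite -y0 in y_gt0.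
- by move=> /andP[x_gt0 _] _ /(_ 0%N) /= x0; rewrite x0 in x_gt0.
move=> /andP[_ mu_pos] /andP[_ nu_pos] eq_nth.
have /= -> := eq_nth 0%N; congr (_ :: _); apply: IHmu => // i; exact: (eq_nth i.+1).
Qed.

Lemma sorted_geq_nth (mu : seq nat) i j : sorted geq mu -> (i <= j)%N ->
  (nth 0 mu j <= nth 0 mu i)%N.
Proof.
move=> mu_s le_ij; have [lt_j|le_j] := ltnP j (size mu); last by rewrite nth_default.
have lt_i : (i < size mu)%N by apply: leq_ltn_trans lt_j.
exact: (sorted_leq_nth geq_trans leqnn 0%N mu_s i j lt_i lt_j le_ij).
Qed.

(** Both inequalities say that row [i] of the diagram reaches column [j]: this is the symmetry
    behind transposition. *)
Lemma count_sorted_geq (mu : seq nat) i j : sorted geq mu ->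
  (i < count (fun k => j < k) mu)%N = (j < nth 0 mu i)%N.
Proof.
elim: mu i => [|x mu IHmu] i /= mu_s; first by rewrite nth_nil.
have /IHmu{}IHmu := path_sorted mu_s.
have := sorted_geq_nth (mu_s : sorted geq (x :: mu)) (leq0n 1) => /= le_x.
have cnt0 : (x <= j)%N -> count (fun k => j < k)%N mu = 0%N.
  move=> le_xj; apply/eqP; rewrite -leqn0 leqNgt IHmu -leqNgt.
  exact: leq_trans le_x le_xj.
case: (ltnP j x) => [lt_jx|le_xj]; case: i => [|i] //=.
- by rewrite add1n ltnS IHmu.
- by rewrite cnt0 // [RHS]ltnNge le_xj.
by rewrite -IHmu cnt0.
Qed.

Lemma nth_conj_part mu j : sorted geq mu ->
  nth 0%N (conj_part mu) j = count (fun k => j < k)%N mu.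
Proof.
move=> mu_s; have [lt_j|le_j] := ltnP j (head 0%N mu).
  by rewrite (nth_map 0%N) ?size_iota // nth_iota.
rewrite nth_default ?size_map ?size_iota //; apply/esym/eqP.
by rewrite -leqn0 leqNgt count_sorted_geq // nth0 -leqNgt.
Qed.

Lemma sumn_count_gt (mu : seq nat) m : {in mu, forall k, k <= m}%N ->
  sumn [seq count (fun k => j < k)%N mu | j <- iota 0 m] = sumn mu.
Proof.
elim: mu => [|x mu IHmu] le_mu /=; first by elim: (iota 0 m) => //= ? ? ->.
rewrite -IHmu => [|k k_mu]; last by apply: le_mu; rewrite inE k_mu orbT.
have le_xm : (x <= m)%N by apply: le_mu; rewrite inE eqxx.
rewrite !sumnE !big_map big_split /=; congr (_ + _)%N.
have -> : iota 0 m = index_iota 0 m by rewrite /index_iota subn0.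
rewrite (@big_cat_nat _ _ _ x) //= [X in (_ + X)%N]big_nat_cond.
rewrite [X in (_ + X)%N]big1 ?addn0 => [|i /andP[/andP[le_xi _] _]].
  rewrite big_nat (eq_bigr (fun=> 1%N)) => [|i /= ->] //.
  by rewrite -big_nat sum_nat_const_nat muln1 subn0.
by rewrite ltnNge le_xi.
Qed.

Lemma conj_part_parts n mu : mu \in parts n -> conj_part mu \in parts n.
Proof.
rewrite !mem_parts => /andP[/andP[mu_s mu_pos] /eqP mu_n]; apply/andP; split; last first.
  rewrite -mu_n; apply/eqP; apply: sumn_count_gt => k k_mu.
  by rewrite -nth0 -(nth_index 0%N k_mu) sorted_geq_nth.
apply/andP; split.
  apply/(sortedP 0%N) => i; rewrite size_map size_iota => lt_i.
  rewrite !nth_conj_part //; apply: sub_count => k /=; exact: ltnW.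
apply/allP=> x /mapP[j]; rewrite mem_iota add0n => /andP[_ lt_j] ->.
by rewrite count_sorted_geq // nth0.
Qed.

Lemma conj_partK n mu : mu \in parts n -> conj_part (conj_part mu) = mu.
Proof.
move=> mu_n; have := mu_n; have := conj_part_parts mu_n.
have := conj_part_parts (conj_part_parts mu_n).
rewrite !mem_parts => /andP[/andP[_ cc_pos] _] /andP[/andP[c_s _] _].
case/andP=> /andP[mu_s mu_pos] _; apply: parts_eq => // i.
apply/eqP; rewrite eqn_leq; apply/andP; split; rewrite leqNgt; apply/negP.
  rewrite nth_conj_part // count_sorted_geq // nth_conj_part // count_sorted_geq //.
  by rewrite ltnn.
set k := nth 0%N (conj_part _) i => lt_k.
have : (k < k)%N by rewrite {2}/k nth_conj_part // count_sorted_geq // nth_conj_part //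
  count_sorted_geq.
by rewrite ltnn.
Qed.

Lemma perm_conj_parts n : perm_eq (map conj_part (parts n)) (parts n).
Proof.
apply: uniq_perm; [|exact: uniq_parts|].
  rewrite map_inj_in_uniq; first exact: uniq_parts.
  by move=> mu nu mu_n nu_n eq_c; rewrite -(conj_partK mu_n) eq_c (conj_partK nu_n).
move=> mu; apply/mapP/idP=> [[nu nu_n ->]|mu_n]; first exact: conj_part_parts.
by exists (conj_part mu); rewrite ?conj_part_parts ?(conj_partK mu_n).
Qed.

Lemma big_conj_part (V : nmodType) n (F : seq nat -> V) :
  \sum_(mu <- parts n) F (conj_part mu) = \sum_(mu <- parts n) F mu.
Proof. by rewrite -(big_map conj_part predT F) (perm_big _ (perm_conj_parts n)). Qed.

(** * Complete homogeneous functions of power sums *)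

(** Characteristic zero for rings that need not be fields: Newton's recurrence divides by [n.+1],
    and is used over polynomial rings as well as over [qfun]. *)
Definition nat_unit (R : unitRingType) := forall n, n.+1%:R \is a @GRing.unit R.

Section CompleteHomogeneous.

Variable R : comUnitRingType.

(* The values of the complete homogeneous symmetric functions at the power
   sums [p 1, p 2, ..] are computed by Newton's recurrence; [p 0] is junk. *)
Fixpoint hlist (p : nat -> R) (n : nat) : seq R :=
  if n is m.+1 then
    m.+1%:R^-1 * (\sum_(k < m.+1) p k.+1 * (hlist p m)`_k) :: hlist p m
  else [:: 1].

Definition hsym (p : nat -> R) (n : nat) : R := head 0 (hlist p n).

Lemma nth_hlist p n k : (k <= n)%N -> (hlist p n)`_k = hsym p (n - k).
Proof. by elim: n k => [|n IHn] [|k] //= le_kn; rewrite IHn. Qed.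

Lemma hsym0 p : hsym p 0 = 1. Proof. by []. Qed.

Hypothesis nuR : nat_unit R.

Lemma hsymS p n :
  n.+1%:R * hsym p n.+1 = \sum_(k < n.+1) p k.+1 * hsym p (n - k).
Proof.
rewrite /hsym /= mulVKr; last exact: nuR.
by apply: eq_bigr => k _; rewrite nth_hlist // -ltnS.
Qed.

(** Newton's recurrence determines the sequence because [n.+1] is invertible; most evaluations of
    [hsym] below just check the recurrence for a candidate. *)
Lemma hsym_unique p (g : nat -> R) : g 0%N = 1 ->
  (forall n, n.+1%:R * g n.+1 = \sum_(k < n.+1) p k.+1 * g (n - k)%N) ->
  g =1 hsym p.
Proof.
move=> g0 gS n; elim/ltn_ind: n => -[|n] IHn //.
apply: (mulrI (nuR n)); rewrite gS hsymS; apply: eq_bigr => k _.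
by rewrite IHn // ltnS leq_subr.
Qed.

Lemma eq_hsym p p' : (forall k, p k.+1 = p' k.+1) -> hsym p =1 hsym p'.
Proof.
move=> eq_p; apply: hsym_unique => // n; rewrite hsymS.
by apply: eq_bigr => k _; rewrite eq_p.
Qed.

Lemma hsym_zero n : hsym (fun=> 0) n = (n == 0%N)%:R.
Proof.
symmetry; move: n; apply: hsym_unique => // n.
by rewrite mulr0 big1 // => k _; rewrite mul0r.
Qed.

Lemma hsym_scale c p n : hsym (fun k => c ^+ k * p k) n = c ^+ n * hsym p n.
Proof.
symmetry; move: n; apply: hsym_unique => [|n]; first by rewrite mul1r.
rewrite mulrCA hsymS mulr_sumr; apply: eq_bigr => k _.
have le_kn : (k <= n)%N by rewrite -ltnS.
by rewrite -{1}(subnKC le_kn) -addSn exprD; ring.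
Qed.

Lemma hsym_exp x n : hsym (fun k => x ^+ k) n = x ^+ n.
Proof.
symmetry; move: n; apply: hsym_unique => // n.
rewrite (eq_bigr (fun=> x ^+ n.+1)) ?sumr_const ?card_ord ?mulr_natl // => k _.
by rewrite -exprD addSn subnKC // -ltnS.
Qed.

(** Minus one letter has the generating series $1-xt$, inverse to $1/(1-xt)$. *)
Lemma hsym_expN x n :
  hsym (fun k => - x ^+ k) n = (n == 0%N)%:R - (n == 1%N)%:R * x.
Proof.
symmetry; move: n; apply: hsym_unique => [|n]; first by rewrite mul0r subr0.
case: n => [|n]; first by rewrite big_ord1 /=; ring.
rewrite big_ord_recr big_ord_recr /= subnn subSnn !eqxx /= big1 => [|i _].
  by rewrite !exprS; ring.
rewrite (_ : (n.+1 - i)%N = (n - i).-1.+2); first by rewrite !mul0r subr0 mulr0.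
by have := ltn_ord i; lia.
Qed.

Definition hpoly (D : nat) (p : nat -> R) : {poly R} := \poly_(i < D.+1) hsym p i.

Lemma coefM_low (p p' q : {poly R}) n :
  (forall i, (i <= n)%N -> p`_i = p'`_i) -> (p * q)`_n = (p' * q)`_n.
Proof.
by move=> eq_p; rewrite !coefM; apply: eq_bigr => i _; rewrite eq_p // -ltnS.
Qed.

Lemma coef_hpoly D p i : (i <= D)%N -> (hpoly D p)`_i = hsym p i.
Proof. by rewrite coef_poly ltnS => ->. Qed.

(** For $P=\sum_{k\ge1}p_kt^k$ and $H$ the generating series of [hsym p], Newton's recurrence reads
    $tH'=PH$; [coef_theta] is this equation for the truncations, valid up to degree [D]. *)
Let ppoly D (p : nat -> R) : {poly R} := 'X * \poly_(i < D) p i.+1.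

Let coef_theta D p n : (n <= D)%N ->
  ('X * (hpoly D p)^`())`_n = (ppoly D p * hpoly D p)`_n.
Proof.
move=> le_nD; rewrite -mulrA !coefXM; case: n => [|n] //= in le_nD *.
rewrite coef_deriv coef_hpoly // -[LHS]mulr_natl hsymS coefM.
apply: eq_bigr => k _; rewrite coef_poly (leq_trans (ltn_ord k) _) //.
by rewrite coef_hpoly //; lia.
Qed.

(** If $tH_1'=P_1H_1$ and $tH_2'=P_2H_2$, the Leibniz rule gives $t(H_1H_2)'=(P_1+P_2)H_1H_2$, which
    is the recurrence for the sum of the power sums. *)
Lemma hsym_add p p' n :
  hsym (fun k => p k + p' k) n = \sum_(i < n.+1) hsym p i * hsym p' (n - i).
Proof.
symmetry; move: n; apply: hsym_unique => [|n]; first by rewrite big_ord1 mulr1.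
have hE m : (m <= n.+1)%N ->
    \sum_(i < m.+1) hsym p i * hsym p' (m - i) = (hpoly n.+1 p * hpoly n.+1 p')`_m.
  move=> le_m; rewrite coefM; apply: eq_bigr => i _; rewrite !coef_hpoly //.
    by have := ltn_ord i; lia.
  by have := ltn_ord i; lia.
rewrite hE // mulr_natl -[LHS](coef_deriv (_ * _) n).
have -> : forall P : {poly R}, P^`()`_n = ('X * P^`())`_n.+1 by move=> P; rewrite coefXM.
set H := hpoly _ p; set H' := hpoly _ p'.
have -> : 'X * (H * H')^`() = ('X * H^`()) * H' + ('X * H'^`()) * H.
  by rewrite derivM; ring.
rewrite coefD (coefM_low (p' := ppoly n.+1 p * H)) => [|i]; last exact: coef_theta.
rewrite [X in _ + X](coefM_low (p' := ppoly n.+1 p' * H')) => [|i]; last exact: coef_theta.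
rewrite -coefD (_ : _ + _ = (ppoly n.+1 p + ppoly n.+1 p') * (H * H')); last by ring.
rewrite /ppoly -mulrDr.
rewrite -mulrA coefXM /= coefM; apply: eq_bigr => k _.
rewrite coefD !coef_poly ltn_ord hE //.
exact: leq_trans (leq_subr _ _) _.
Qed.

Lemma coef_hpoly_prod (I : Type) (r : seq I) (p : I -> nat -> R) D n :
  (n <= D)%N ->
  (\prod_(i <- r) hpoly D (p i))`_n = hsym (fun k => \sum_(i <- r) p i k) n.
Proof.
elim: r n => [|i r IHr] n le_nD.
  rewrite big_nil coef1 (@eq_hsym _ (fun=> 0)) ?hsym_zero // => k.
  by rewrite big_nil.
rewrite big_cons coefM.
rewrite (@eq_hsym _ (fun k => p i k + \sum_(j <- r) p j k)); last first.
  by move=> k; rewrite big_cons.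
rewrite hsym_add; apply: eq_bigr => k _.
rewrite coef_hpoly ?IHr //; first exact: leq_trans (leq_subr _ _) _.
by apply: leq_trans le_nD; rewrite -ltnS.
Qed.

End CompleteHomogeneous.

Lemma hsym_rmorph (R S : comUnitRingType) (f : {rmorphism R -> S}) p n :
  nat_unit R -> nat_unit S -> f (hsym p n) = hsym (f \o p) n.
Proof.
move=> nuR nuS; move: n; apply: (hsym_unique nuS) => [|n] /=; first by rewrite rmorph1.
rewrite -(rmorph_nat f n.+1) -rmorphM hsymS // rmorph_sum.
by apply: eq_bigr => k _; rewrite rmorphM.
Qed.

Definition psum (R : pzSemiRingType) (I : finType) (x : I -> R) (k : nat) : R :=
  \sum_i x i ^+ k.

(** * Alternating polynomials *)

Local Notation "m # s" := [multinom m (s i) | i < _]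
  (at level 40, left associativity, format "m # s").

Lemma increasing_perm_le n (s : 'S_n) :
  (forall i j : 'I_n, (i < j)%N -> (s i < s j)%N) -> forall i : 'I_n, (i <= s i)%N.
Proof.
move=> s_incr i; case: i => i; elim: i => [|i IHi] //= lt_i.
apply: leq_ltn_trans (IHi (ltnW lt_i)) _; exact: s_incr.
Qed.

(** An increasing permutation never lowers an index, and the inverse of [s] is increasing too. *)
Lemma increasing_perm1 n (s : 'S_n) :
  (forall i j : 'I_n, (i < j)%N -> (s i < s j)%N) -> s = 1%g.
Proof.
move=> s_incr; apply/permP=> i; rewrite perm1; apply/val_inj/eqP.
rewrite eqn_leq increasing_perm_le // andbT.
have := @increasing_perm_le n s^-1%g _ (s i); rewrite permK; apply=> j k lt_jk.
rewrite ltnNge leq_eqVlt; apply/negP=> /orP[/eqP/val_inj/perm_inj eq_kj|].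
  by rewrite eq_kj ltnn in lt_jk.
by move/s_incr; rewrite !permKV ltnNge ltnW.
Qed.

Section Alternants.

Variable n : nat.

(** The exponents $\mu+\delta$ with $\delta=(n-1,\dots,1,0)$; they are strictly decreasing when [mu]
    is a partition. *)
Definition stair (mu : seq nat) : 'X_{1..n} :=
  [multinom (nth 0%N mu j + (n - j.+1))%N | j < n].

Definition altX (m : 'X_{1..n}) : {mpoly algC[n]} :=
  \det (\matrix_(i < n, j < n) ('X_i : {mpoly algC[n]}) ^+ m j).

Lemma alternantE mu : alternant n mu = altX (stair mu).
Proof.
rewrite /alternant /altX; congr (\det _); apply/matrixP=> i j.
by rewrite !mxE mnmE.
Qed.

Lemma altX_sum m : altX m = \sum_(s : 'S_n) (-1) ^+ s *: 'X_[m#s].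
Proof.
apply: eq_bigr => s _; rewrite -mul_mpolyC rmorphXn /= rmorphN1; congr (_ * _).
by rewrite mpolyXE_id; apply: eq_bigr => i _; rewrite !mxE mnmE.
Qed.

Lemma mcoeff_altX m k : (altX m)@_k = \sum_(s : 'S_n) (-1) ^+ s * (m#s == k)%:R.
Proof.
by rewrite altX_sum raddf_sum; apply: eq_bigr => s _; rewrite /= mcoeffZ mcoeffX.
Qed.

Definition antisymmetric (P : {mpoly algC[n]}) :=
  forall s : 'S_n, msym s P = (-1) ^+ s *: P.

Lemma antisym_altX m : antisymmetric (altX m).
Proof.
move=> t; rewrite altX_sum raddf_sum /= scaler_sumr.
rewrite (reindex_inj (mulgI t)); apply: eq_bigr => s _.
rewrite msymZ msymX -mpermM mulKg odd_permM signr_addb -scalerA.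
by [].
Qed.

Lemma antisymMl f P : f \is symmetric -> antisymmetric P -> antisymmetric (f * P).
Proof.
move=> /issymP f_sym P_anti s.
by rewrite msymM f_sym P_anti -scalerAr.
Qed.

Lemma mcoeff_antisym P (s : 'S_n) (m : 'X_{1..n}) : antisymmetric P -> P@_(m#s) =
  (-1) ^+ s * P@_m.
Proof. by move=> P_anti; rewrite -mcoeff_sym P_anti mcoeffZ. Qed.

Lemma stair_strict mu (i j : 'I_n) : sorted geq mu ->
  (i < j)%N -> (stair mu j < stair mu i)%N.
Proof.
move=> mu_s lt_ij; rewrite !mnmE.
by have := sorted_geq_nth mu_s (ltnW lt_ij); have := ltn_ord j; lia.
Qed.

Lemma stair_inj_ord mu : sorted geq mu -> injective (stair mu).
Proof.
move=> mu_s i j eq_ij; apply/val_inj/eqP; case: ltngtP => //.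
  by move/(stair_strict mu_s); rewrite eq_ij ltnn.
by move/(stair_strict mu_s); rewrite eq_ij ltnn.
Qed.

Lemma mdeg_stair mu : (size mu <= n)%N ->
  mdeg (stair mu) = (sumn mu + mdeg (stair [::]))%N.
Proof.
move=> le_mu; rewrite !mdegE -[sumn mu]/(foldr addn 0%N mu).
rewrite (eq_bigr (fun j : 'I_n => nth 0%N mu j + stair [::] j)%N); last first.
  by move=> j _; rewrite !mnmE nth_nil.
rewrite big_split /=; congr (_ + _)%N.
rewrite -/(sumn mu) sumnE (big_nth 0%N) big_mkord (big_ord_widen _ _ le_mu).
rewrite [RHS]big_mkcond /=; apply: eq_bigr => j _.
by case: ifPn => //; rewrite -leqNgt => le_j; rewrite nth_default.
Qed.

(** A permutation carrying one strictly decreasing sequence to another is increasing, hence trivial;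
    [d <= n] ensures that the [n] exponents see all the parts. *)
Lemma stair_mperm_inj d mu nu (s t : 'S_n) : mu \in parts d -> nu \in parts d ->
  (d <= n)%N -> (stair mu)#s = (stair nu)#t -> mu = nu /\ s = t.
Proof.
rewrite !mem_parts => /andP[/andP[mu_s mu_p] /eqP mu_d] /andP[/andP[nu_s nu_p] /eqP nu_d] le_dn.
move=> /mnmP eq_st.
have eq_stair j : stair mu j = stair nu ((s^-1 * t)%g j).
  by have := eq_st (s^-1%g j); rewrite !mnmE permM permKV.
have st1 : (s^-1 * t)%g = 1%g.
  apply: increasing_perm1 => i j lt_ij; rewrite ltnNge; apply/negP => le_ji.
  have := stair_strict mu_s lt_ij; rewrite !eq_stair ltnNge.
  move: le_ji; rewrite leq_eqVlt => /orP[/eqP/val_inj->|]; first by rewrite leqnn.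
  by move/(stair_strict nu_s)/ltnW->.
split; last by apply/(mulgI s^-1%g); rewrite mulVg st1.
have szle (la : seq nat) : all (leq 1) la -> sumn la = d -> (size la <= n)%N.
  by move=> la_p la_d; apply: leq_trans le_dn; rewrite -la_d size_leq_sumn.
apply: parts_eq => // i; have [lt_i|le_i] := ltnP i n; last first.
  by rewrite !nth_default ?(leq_trans _ le_i) ?szle.
have := eq_stair (Ordinal lt_i); rewrite st1 perm1 !mnmE /=; lia.
Qed.

(** Sort the exponents downwards and subtract the staircase: distinct entries drop by at least one
    at each step, so the differences are nonnegative and weakly decreasing. *)
Lemma stair_exists d (m : 'X_{1..n}) : injective m ->
  mdeg m = (d + mdeg (stair [::]))%N ->
  exists2 mu, mu \in parts d & exists s : 'S_n, m = (stair mu)#s.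
Proof.
move=> m_inj m_deg.
have /tuple_permP[s sE] : perm_eq m (sort_tuple geq (val m)).
  by rewrite perm_sym perm_sort.
pose l j := tnth (sort_tuple geq (val m)) j.
have mE j : m j = l (s j).
  rewrite /l mnm_tnth; have := congr1 (fun t => nth 0%N t j) sE.
  by rewrite -!tnth_nth tnth_mktuple.
have l_inj : injective l.
  move=> i j eq_l; apply: (can_inj (permKV s)); apply: m_inj.
  by rewrite !mE !permKV.
have l_s : sorted geq (sort_tuple geq (val m)).
  by apply: sort_sorted => x y /=; exact: leq_total.
have l_strict (i j : 'I_n) : (i < j)%N -> (l j < l i)%N.
  move=> lt_ij; rewrite ltn_neqAle; apply/andP; split.
    by apply/eqP=> /l_inj eq_ij; rewrite eq_ij ltnn in lt_ij.
  by rewrite /l !(tnth_nth 0%N) sorted_geq_nth // ltnW.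
have l_gap k (i j : 'I_n) : j = (i + k)%N :> nat -> (l j + k <= l i)%N.
  elim: k j => [|k IHk] j jE; first by rewrite (_ : j = i) ?addn0 //; apply/val_inj;
    rewrite /= jE addn0.
  have lt_ik : (i + k < n)%N by have := ltn_ord j; lia.
  have := IHk (Ordinal lt_ik) erefl.
  have := @l_strict (Ordinal lt_ik) j; rewrite /=; lia.
have l_ge (i : 'I_n) : (n - i.+1 <= l i)%N.
  have lt_n1 : (n.-1 < n)%N by have := ltn_ord i; lia.
  have := @l_gap (n - i.+1)%N i (Ordinal lt_n1); rewrite /=.
  by have := ltn_ord i; lia.
pose la := [seq (l i - (n - i.+1))%N | i : 'I_n].
have la_nth (i : 'I_n) : nth 0%N la i = (l i - (n - i.+1))%N.
  by rewrite (nth_map i) ?size_enum_ord // nth_ord_enum.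
have la_size : size la = n by rewrite size_map size_enum_ord.
have la_s : sorted geq la.
  apply/(sortedP 0%N) => i; rewrite la_size => lt_i.
  have lt_i' := ltnW lt_i.
  have := la_nth (Ordinal lt_i); have := la_nth (Ordinal lt_i'); rewrite /= => -> ->.
  have := @l_gap 1%N (Ordinal lt_i') (Ordinal lt_i); rewrite /= addn1 => /(_ erefl); lia.
pose mu := [seq k <- la | (0 < k)%N].
have mu_nth i : nth 0%N mu i = nth 0%N la i.
  rewrite [in RHS](sorted_geq_pos_cat la_s) nth_cat nth_nseq -/mu.
  by case: ltnP => // le_i; rewrite nth_default ?if_same.
have stairE j : stair mu j = l j.
  by rewrite mnmE mu_nth la_nth subnK.
exists mu; last by exists s; apply/mnmP=> j; rewrite mnmE stairE mE.
rewrite mem_parts /partn_seq filter_all sorted_filter //=; last exact: geq_trans.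
have : mdeg m = mdeg (stair mu).
  rewrite !mdegE [RHS](reindex_inj (@perm_inj _ s)) /=; apply: eq_bigr => j _.
  by rewrite mE stairE.
rewrite mdeg_stair; last by rewrite size_filter (leq_trans (count_size _ _)) ?la_size.
by rewrite m_deg => /addIn->.
Qed.

Lemma mcoeff_altX_stair d mu nu : mu \in parts d -> nu \in parts d -> (d <= n)%N ->
  (altX (stair mu))@_(stair nu) = (mu == nu)%:R.
Proof.
move=> mu_d nu_d le_dn; rewrite mcoeff_altX (bigD1 1%g) //= odd_perm1 mul1r mperm1.
rewrite big1 ?addr0 => [|s nt_s]; last first.
  case: eqP => [eq_s|]; last by rewrite mulr0.
  have := stair_mperm_inj mu_d nu_d le_dn (etrans eq_s (esym (mperm1 _))).
  by case=> _ s1; rewrite s1 eqxx in nt_s.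
congr (_ : bool)%:R; apply/eqP/eqP=> [eq_st|->] //.
by have [] := @stair_mperm_inj d mu nu 1%g 1%g mu_d nu_d le_dn; rewrite ?mperm1.
Qed.

(** Exchanging two equal exponents fixes the monomial but changes the sign of its coefficient. *)
Lemma mcoeff_antisym_eq0 P (m : 'X_{1..n}) :
  antisymmetric P -> ~ injective m -> P@_m = 0.
Proof.
move=> P_anti m_ninj.
have /injectivePn[i [j ne_ij eq_m]] : ~~ injectiveb m by apply/negP=> /injectiveP.
have := mcoeff_antisym (tperm i j) m P_anti.
rewrite odd_tperm ne_ij expr1 mulN1r (_ : m#(tperm i j) = m).
  move/eqP; rewrite -subr_eq0 opprK -mulr2n mulrn_eq0 /=; exact: eqP.
by apply/mnmP=> k; rewrite mnmE; case: tpermP => [->|->|].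
Qed.

(** An antisymmetric polynomial is determined by its coefficients at strictly decreasing exponents,
    and those of the right degree are the [stair mu]. Expansions in Schur polynomials are all found
    this way. *)
Lemma antisym_expand d P : (d <= n)%N -> antisymmetric P ->
  (forall m, P@_m != 0 -> mdeg m = (d + mdeg (stair [::]))%N) ->
  P = \sum_(mu <- parts d) P@_(stair mu) *: altX (stair mu).
Proof.
move=> le_dn P_anti P_homog; apply/mpolyP=> m; rewrite raddf_sum /=.
have [m_inj|m_ninj] := boolP (injectiveb m); last first.
  have {}m_ninj : ~ injective m by move/injectiveP; exact/negP.
  rewrite mcoeff_antisym_eq0 // big1 // => mu _.
  by rewrite mcoeffZ (mcoeff_antisym_eq0 (@antisym_altX _)) ?mulr0.
have {}m_inj := injectiveP _ m_inj.
have [m_deg|m_ndeg] := eqVneq (mdeg m) (d + mdeg (stair [::]))%N.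
  have [mu mu_d [s ->]] := stair_exists m_inj m_deg.
  rewrite (bigD1_seq mu) ?uniq_parts //= mcoeffZ.
  rewrite !mcoeff_antisym //; last exact: antisym_altX.
  rewrite (mcoeff_altX_stair mu_d mu_d le_dn) eqxx mulr1 mulrC.
  rewrite big_seq_cond big1 ?addr0 // => nu /andP[nu_d ne_nu].
  rewrite mcoeffZ mcoeff_antisym; last exact: antisym_altX.
  by rewrite (mcoeff_altX_stair nu_d mu_d le_dn) (negPf ne_nu) !mulr0.
have P0 m' : (mdeg m' != d + mdeg (stair [::]))%N -> P@_m' = 0.
  by move=> ne_m; apply/eqP; apply: contraNT ne_m => /P_homog->.
rewrite P0 // big_seq big1 // => mu; rewrite mem_parts.
case/andP=> /andP[mu_s mu_p] /eqP mu_d.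
rewrite mcoeffZ mcoeff_altX big1 ?mulr0 // => s _; case: eqP => [mE|]; last by rewrite mulr0.
case/eqP: m_ndeg; rewrite -mE mdeg_mperm mdeg_stair ?mu_d //.
by apply: leq_trans le_dn; rewrite -mu_d size_leq_sumn.
Qed.

Lemma altX_indep d (c c' : seq nat -> algC) : (d <= n)%N ->
  \sum_(mu <- parts d) c mu *: altX (stair mu) =
  \sum_(mu <- parts d) c' mu *: altX (stair mu) ->
  {in parts d, c =1 c'}.
Proof.
move=> le_dn eq_c mu mu_d.
have coefE (b : seq nat -> algC) :
    (\sum_(nu <- parts d) b nu *: altX (stair nu))@_(stair mu) = b mu.
  rewrite raddf_sum /= (bigD1_seq mu) ?uniq_parts //= mcoeffZ.
  rewrite (mcoeff_altX_stair mu_d mu_d le_dn) eqxx mulr1.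
  rewrite big_seq_cond big1 ?addr0 // => nu /andP[nu_d ne_nu].
  by rewrite mcoeffZ (mcoeff_altX_stair nu_d mu_d le_dn) (negPf ne_nu) mulr0.
by rewrite -[LHS]coefE eq_c coefE.
Qed.

Lemma altX_stair_neq0 mu : sorted geq mu -> altX (stair mu) != 0.
Proof.
move=> mu_s; apply/eqP=> /(congr1 (mcoeff (stair mu))); rewrite mcoeff0 mcoeff_altX.
rewrite (bigD1 1%g) //= odd_perm1 mul1r mperm1 eqxx big1 ?addr0.
  by move/eqP; rewrite oner_eq0.
move=> s nt_s; case: eqP => [/mnmP eq_s|]; last by rewrite mulr0.
case/eqP: nt_s; apply/permP=> i; rewrite perm1; apply: (stair_inj_ord mu_s).
by have := eq_s i; rewrite mnmE.
Qed.

End Alternants.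

(** * Irreducible characters and power sums *)

(* The product of the power sums indexed by the cycle type of w. *)
Definition pperm (R : pzSemiRingType) m (w : 'S_m) (p : nat -> R) : R :=
  \prod_(A in porbits w) p #|A|.

(** A colouring of the points that is constant on the cycles of [w]. Colourings stand for words in
    the letters, and [content] records the monomial. *)
Definition inv_col m (I : finType) (w : 'S_m) (f : {ffun 'I_m -> I}) : bool :=
  [forall k, f (w k) == f k].

Definition comp_col m (I : finType) (f : {ffun 'I_m -> I}) (y : 'S_m) :
  {ffun 'I_m -> I} := [ffun k => f (y k)].

Lemma inv_col_porbit m (I : finType) (w : 'S_m) (f : {ffun 'I_m -> I}) x y :
  inv_col w f -> y \in porbit w x -> f y = f x.
Proof.
move=> /forallP f_inv /porbitP[i ->]; elim: i => [|i IHi]; first by rewrite perm1.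
by rewrite expgSr permM (eqP (f_inv _)).
Qed.

Lemma prod_porbits (R : comPzSemiRingType) m (w : 'S_m) (F : {set 'I_m} -> R) :
  \prod_(A in porbits w) F A ^+ #|A| = \prod_k F (porbit w k).
Proof.
rewrite (partition_big (porbit w) (mem (porbits w))) => [|k _]; last exact: imset_f.
apply: eq_bigr => A /imsetP[k _ ->].
rewrite (eq_bigr (fun=> F (porbit w k))) => [|j /eqP-> //].
rewrite prodr_const; congr (_ ^+ _); apply: eq_card => j.
by rewrite -eq_porbit_mem.
Qed.

(** Expanding the product of power sums chooses one letter for each cycle, that is, a colouring
    constant on cycles. *)
Lemma pperm_psum (R : comPzSemiRingType) (I : finType) (x : I -> R) m (w : 'S_m) :
  pperm w (psum x) = \sum_(f | inv_col w f) \prod_k x (f k).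
Proof.
(* The colour [i0] extends a choice on cycles to all subsets. Without any colour, both sides are 1
   for [m = 0] and 0 otherwise. *)
rewrite /pperm /psum; have [i0 _|I0] := pickP (predT : pred I); last first.
  case: m w => [|m] w.
    rewrite big_pred0 => [|A]; last by apply/imsetP=> -[[]].
    rewrite (eq_big predT (fun=> 1)) => [|f|f _]; last by rewrite big_ord0.
      by rewrite sumr_const card_ffun card_ord expn0.
    by apply/forallP=> -[].
  rewrite (bigD1 (porbit w ord0)) ?imset_f //= [X in X * _]big_pred0 ?mul0r => [|i];
    last exact: I0.
  by rewrite big1 // => f; have := I0 (f ord0).
rewrite (big_distr_big i0) /=.
pose h (f : {ffun 'I_m -> I}) : {ffun {set 'I_m} -> I} :=
  [ffun A => if A \in porbits w then
     (if [pick k in A] is Some k then f k else i0) else i0].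
pose h' (g : {ffun {set 'I_m} -> I}) : {ffun 'I_m -> I} := [ffun k => g (porbit w k)].
have hE f k : inv_col w f -> h f (porbit w k) = f k.
  move=> f_inv; rewrite ffunE imset_f //; case: pickP => [j /= jk|/(_ k)].
    exact: inv_col_porbit jk.
  by rewrite /= porbit_id.
have h'_inv g : inv_col w (h' g).
  apply/forallP=> k; rewrite !ffunE.
  by have := porbit_perm w 1 k; rewrite expg1 => ->.
rewrite (reindex_onto h h') => [|g /pffun_onP[g_supp _]] /=; last first.
  apply/ffunP=> A; have [Aw|A'w] := boolP (A \in porbits w); last first.
    rewrite ffunE (negPf A'w); apply/esym/eqP; apply: contraNT A'w => gA.
    by apply: (subsetP g_supp).
  by case/imsetP: (Aw) => k _ ->; rewrite hE // ffunE.
apply: eq_big => [f|f /andP[_ /eqP f_h]].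
  apply/andP/idP=> [[_ /eqP<-] //|f_inv]; split; last first.
    by apply/eqP/ffunP=> k; rewrite ffunE hE.
  apply/pffun_onP; split=> //; apply/subsetP=> A; apply: contraNT => A'w.
  by rewrite ffunE (negPf A'w).
have f_inv : inv_col w f by rewrite -f_h.
rewrite prod_porbits; apply: eq_bigr => k _; by rewrite hE.
Qed.

Definition content m N (f : {ffun 'I_m -> 'I_N}) : 'X_{1..N} :=
  [multinom #|[pred k | f k == j]| | j < N].

Lemma prodX_content (R : comNzRingType) m N (f : {ffun 'I_m -> 'I_N}) :
  \prod_k ('X_(f k) : {mpoly R[N]}) = 'X_[content f].
Proof.
rewrite mpolyXE_id (partition_big f predT) //=; apply: eq_bigr => j _.
rewrite (eq_bigr (fun=> 'X_j)) => [|k /eqP-> //]; rewrite prodr_const mnmE.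
by congr (_ ^+ _); apply: eq_card.
Qed.

Lemma mcoeff_pperm (R : comNzRingType) m N (w : 'S_m) (g : 'X_{1..N}) :
  (pperm w (psum (fun i : 'I_N => 'X_i : {mpoly R[N]})))@_g =
  #|[pred f : {ffun 'I_m -> 'I_N} | inv_col w f & content f == g]|%:R.
Proof.
rewrite pperm_psum raddf_sum /= -sum1_card natr_sum big_mkcondr /=.
by apply: eq_bigr => f _; rewrite prodX_content mcoeffX; case: eqP.
Qed.

Definition col_stab m N (f : {ffun 'I_m -> 'I_N}) : {set 'S_m} :=
  [set s | inv_col s f].

Lemma inv_col_comp m N (f : {ffun 'I_m -> 'I_N}) w y :
  inv_col w (comp_col f y) = inv_col (w ^ y)%g f.
Proof.
apply/forallP/forallP=> f_inv k.
  have := f_inv ((y^-1)%g k); rewrite !ffunE permKV.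
  by rewrite conjgE mulgA !permM.
by have := f_inv (y k); rewrite conjgE !permM permK !ffunE.
Qed.

Lemma content_comp m N (f : {ffun 'I_m -> 'I_N}) y :
  content (comp_col f y) = content f.
Proof.
apply/mnmP=> j; rewrite !mnmE -!sum1_card [RHS](reindex_inj (@perm_inj _ y)) /=.
by apply: eq_bigl => k; rewrite !inE ffunE.
Qed.

Lemma content_eqP m N (f f' : {ffun 'I_m -> 'I_N}) :
  content f = content f' -> exists y, f' = comp_col f y.
Proof.
move/mnmP=> eq_cont.
pose t (g : {ffun 'I_m -> 'I_N}) : m.-tuple 'I_N := [tuple g k | k < m].
have cnt g j : count_mem j (t g) = content g j.
  by rewrite mnmE cardE size_filter /= count_map -enumT; apply: eq_count.
have /tuple_permP[y yE] : perm_eq (t f') (t f).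
  by apply/allP=> j _ /=; rewrite !cnt eq_cont.
exists y; apply/ffunP=> k; rewrite ffunE.
have := congr1 (fun s => nth (f k) s k) yE.
rewrite -!tnth_nth !tnth_mktuple.
by [].
Qed.

(** Colourings of equal content form one orbit of the symmetric group, so the permutations carrying
    one to another form a coset of the stabilizer. *)
Lemma card_comp_col m N (f f' : {ffun 'I_m -> 'I_N}) :
  #|[pred y | comp_col f y == f']| =
  ((content f' == content f) * #|col_stab f|)%N.
Proof.
case: eqP => [/esym/content_eqP[y0 ->]|ne_cont]; last first.
  rewrite mul0n; apply: eq_card0 => y; rewrite !inE; apply/eqP=> fE.
  by case: ne_cont; rewrite -fE content_comp.
rewrite mul1n -(card_lcoset (col_stab f) y0); apply: eq_card => y.
rewrite mem_lcoset !inE; apply/eqP/forallP=> [/ffunP eq_f k|f_inv].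
  have := eq_f ((y0^-1)%g k); rewrite !ffunE permKV => <-.
  by rewrite permM.
apply/ffunP=> k; rewrite !ffunE; have /eqP := f_inv (y0 k).
by rewrite permM permK.
Qed.

Lemma reshape_index_cons x sh i :
  reshape_index (x :: sh) i =
  if (i < x)%N then 0%N else (reshape_index sh (i - x)).+1.
Proof.
rewrite /reshape_index /= subn_eq0; case: ltnP => // le_xi.
by rewrite subSn.
Qed.

Lemma count_reshape_index sh j :
  count (fun i => reshape_index sh i == j) (iota 0 (sumn sh)) = nth 0%N sh j.
Proof.
elim: sh j => [|x sh IHsh] j /=; first by rewrite nth_nil.
rewrite iotaD count_cat add0n -[in X in iota X (sumn sh)](addn0 x) iotaDl count_map.
rewrite (@eq_in_count _ _ (fun=> 0%N == j)) => [|i]; last first.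
  by rewrite mem_iota add0n => /andP[_ lt_ix]; rewrite reshape_index_cons lt_ix.
case: j => [|j]; rewrite ?count_predT ?count_pred0 ?size_iota ?add0n /=.
  rewrite -[RHS]addn0; congr (_ + _)%N; elim: (iota 0 (sumn sh)) => //= a s ->.
  by rewrite reshape_index_cons ltnNge leq_addr.
rewrite -IHsh; apply: eq_count => i /=.
by rewrite reshape_index_cons ltnNge leq_addr /= addKn eqSS.
Qed.

(** * Characters induced from Young subgroups, as counts of colourings *)

Section YoungCharacters.

Variables (m N : nat).

Definition mshape (sh : seq nat) : 'X_{1..N} := [multinom nth 0%N sh j | j < N].

(** Colouring each point by its block makes the Young subgroup a stabilizer. The number [N] of
    colours will be the number of variables. *)
Lemma young_coloring (sh : seq nat) : sumn sh = m -> (size sh <= N)%N ->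
  exists2 f : {ffun 'I_m -> 'I_N}, content f = mshape sh &
    young_set m sh = col_stab f.
Proof.
move=> sh_m le_sh.
have lt_sh (k : 'I_m) : (reshape_index sh k < N)%N.
  by apply: leq_trans le_sh; apply: reshape_indexP; rewrite sh_m.
exists [ffun k => Ordinal (lt_sh k)].
  apply/mnmP=> j; rewrite !mnmE -count_reshape_index sh_m -val_enum_ord count_map.
  rewrite cardE size_filter -enumT /=; apply: eq_count => k /=.
  by rewrite inE ffunE -val_eqE.
apply/setP=> s; rewrite !inE; apply: eq_forallb => k.
by rewrite !ffunE -val_eqE.
Qed.

(** For [sh] of sum [m], its Frobenius characteristic is the product of the complete functions
    indexed by [sh]; for [echar] it is the product of the elementary ones. *)
Definition hchar (sh : seq nat) : 'CF([set: 'S_m]) :=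
  'Ind[[set: 'S_m]] (1 : 'CF(young_group m sh)).

Definition echar (sh : seq nat) : 'CF([set: 'S_m]) :=
  'Ind[[set: 'S_m]] (cf_sgn (young_group m sh)).

(** The induced trivial character is the permutation character on the colourings of content [sh],
    and a coefficient of [pperm w] counts the fixed ones. *)
Lemma hcharE sh w : sumn sh = m -> (size sh <= N)%N ->
  hchar sh w = (pperm w (psum (fun i : 'I_N => 'X_i : {mpoly algC[N]})))@_(mshape sh).
Proof.
move=> sh_m le_sh; have [f f_cont f_stab] := young_coloring sh_m le_sh.
rewrite cfIndE ?subsetT // mcoeff_pperm.
apply: canLR (mulKf (neq0CG _)) _; rewrite -natrM.
rewrite (eq_bigr (fun y => (inv_col w (comp_col f y) : bool)%:R)) => [|y _]; last first.
  by rewrite cfun1E /= f_stab inE inv_col_comp.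
rewrite -natr_sum; congr _%:R.
rewrite (eq_bigl predT) => [|y]; last by rewrite inE.
rewrite (partition_big (comp_col f) predT) //= -[X in (_ * X)%N]sum1_card big_distrr /=.
rewrite [RHS]big_mkcond; apply: eq_bigr => g _ /=.
rewrite (eq_bigr (fun=> inv_col w g : nat)) => [|y /eqP-> //].
rewrite sum_nat_const card_comp_col -f_cont /= f_stab inE.
by case: (inv_col w g); case: eqP => //=; rewrite ?mul1n ?muln0.
Qed.

Lemma echarE sh w : echar sh w = (-1) ^+ w * hchar sh w.
Proof.
rewrite /hchar /echar !cfIndE ?subsetT // mulrCA; congr (_ * _).
rewrite mulr_sumr; apply: eq_bigr => y _.
rewrite cfun1E cfunE odd_permJ -mulr_natr.
by [].
Qed.

Definition pair_col (f g : {ffun 'I_m -> 'I_N}) (k : 'I_m) := (f k, g k).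

(** If two points share both colours, multiplication by their transposition preserves both
    conditions on [w] and flips its sign; otherwise only the identity satisfies them. *)
Lemma sum_sgn_stab (f g : {ffun 'I_m -> 'I_N}) :
  \sum_(w in col_stab f | inv_col w g) (-1) ^+ w = (injectiveb (pair_col f g))%:R :> algC.
Proof.
have [/injectiveP inj_fg|/injectivePn[i [j ne_ij /= eq_ij]]] := boolP (injectiveb _).
  rewrite (big_pred1 1%g) ?odd_perm1 // => w /=; rewrite !inE.
  apply/andP/eqP=> [[/forallP f_w /forallP g_w]|->].
    apply/permP=> k; rewrite perm1; apply: inj_fg.
    by rewrite /pair_col (eqP (f_w k)) (eqP (g_w k)).
  by split; apply/forallP=> k; rewrite perm1.
have [fij gij] : f i = f j /\ g i = g j by case: eq_ij.
have invt (h : {ffun 'I_m -> 'I_N}) w : h i = h j ->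
    inv_col (w * tperm i j)%g h = inv_col w h.
  move=> hij; apply: eq_forallb => k; rewrite permM.
  by case: (tpermP i j (w k)) => [->|->|] //; rewrite hij.
set S := \sum_(w in _ | _) _; have : S = - S.
  rewrite {1}/S (reindex_inj (mulIg (tperm i j))) /= -sumrN.
  apply: eq_big => w; first by rewrite !inE !invt.
  by move=> _; rewrite odd_permM odd_tperm ne_ij addbT -signrN.
move/eqP; rewrite -subr_eq0 opprK -mulr2n mulrn_eq0 /=; exact: eqP.
Qed.

(** An injective pair of colourings puts the points into distinct cells of a grid, with rows given
    by [f1] and columns by [f2]: a labelled zero-one matrix. Dividing by the stabilizer forgets the
    labels. *)
Lemma cfdot_hchar_echar sh1 sh2 (f1 : {ffun 'I_m -> 'I_N}) :
  sumn sh1 = m -> (size sh1 <= N)%N -> sumn sh2 = m -> (size sh2 <= N)%N ->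
  young_set m sh1 = col_stab f1 ->
  '[hchar sh1, echar sh2] =
  #|[pred f2 | content f2 == mshape sh2 & injectiveb (pair_col f1 f2)]|%:R
    / #|col_stab f1|%:R.
Proof.
move=> sh1_m le_sh1 sh2_m le_sh2 f1_stab.
rewrite /hchar -cfdot_Res_r cfdotE mulrC; congr (_ * _); last by rewrite /= f1_stab.
rewrite (eq_bigl (fun w => w \in col_stab f1)) => [|w]; last by rewrite /= f1_stab.
rewrite -sum1_card natr_sum.
transitivity (\sum_(w in col_stab f1) \sum_(f2 | content f2 == mshape sh2)
   (inv_col w f2 : bool)%:R * (-1) ^+ w : algC).
  apply: eq_bigr => w w_stab; rewrite cfun1E /= f1_stab w_stab mul1r.
  rewrite cfResE ?subsetT //= ?f1_stab // echarE hcharE // mcoeff_pperm.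
  rewrite rmorphM rmorph_sign rmorph_nat mulrC -mulr_suml -natr_sum.
  congr (_%:R * _); rewrite -sum1_card big_mkcond /= [RHS]big_mkcond /=.
  by apply: eq_bigr => f2 _; rewrite inE; case: (inv_col _ _); case: eqP.
rewrite exchange_big /= [RHS]big_mkcondr /=; apply: eq_bigr => f2 _.
rewrite -[RHS](_ : (injectiveb (pair_col f1 f2))%:R = _); last by case: injectiveb.
rewrite -sum_sgn_stab big_mkcondr; apply: eq_bigr => w _.
by case: inv_col; rewrite ?mul1r ?mul0r.
Qed.

End YoungCharacters.

Lemma card_ord_ltn N r : (r <= N)%N -> #|[pred j : 'I_N | (j < r)%N]| = r.
Proof.
move=> le_rN; rewrite -sum1_card (eq_bigl (fun j : 'I_N => (j < r)%N)) //.
by rewrite -(big_ord_widen _ (fun=> 1%N)) // sum1_card card_ord.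
Qed.

(** When all smaller indices are fixed, the next index cannot be sent down, and sending it up would
    raise the partial sum that ends there. *)
Lemma perm_sum_leq1 N (v : 'S_N) :
  (forall r, (r <= N)%N ->
     (\sum_(j < N | j < r) v j <= \sum_(j < N | j < r) j)%N) -> v = 1%g.
Proof.
move=> le_v; suffices vE r (j : 'I_N) : (j < r)%N -> v j = j.
  by apply/permP=> j; rewrite perm1 (vE j.+1).
elim: r j => // r IHr j; rewrite ltnS leq_eqVlt => /orP[/eqP jr|]; last exact: IHr.
have lt_jN := ltn_ord j; have := le_v j.+1 lt_jN.
rewrite (bigD1 j) //= [X in (_ <= X)%N](bigD1 j) //=.
rewrite (eq_bigr (fun i : 'I_N => i : nat)) => [|i /andP[le_ij ne_ij]]; last first.
  by rewrite IHr // -jr ltn_neqAle -ltnS le_ij andbT.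
rewrite leq_add2r leq_eqVlt => /orP[/eqP/val_inj //|].
rewrite jr => /IHr/perm_inj.
by [].
Qed.

(** * Zero-one matrices whose column sums are the transpose of a partition *)

Section ZeroOneMatrices.

Variables (m N : nat) (mu : seq nat).
Hypotheses (mu_m : mu \in parts m) (le_mN : (m <= N)%N).

Let mu_s : sorted geq mu.
Proof. by move: mu_m; rewrite mem_parts => /andP[/andP[]]. Qed.

Let mu_p : all (leq 1) mu.
Proof. by move: mu_m; rewrite mem_parts => /andP[/andP[]]. Qed.

Let sumn_mu : sumn mu = m.
Proof. by move: mu_m; rewrite mem_parts => /andP[_ /eqP]. Qed.

Lemma size_parts_leq : (size mu <= N)%N.
Proof. by apply: leq_trans le_mN; rewrite -sumn_mu size_leq_sumn. Qed.

Lemma nth_parts_leq j : (nth 0 mu j <= N)%N.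
Proof. by apply: leq_trans le_mN; rewrite -sumn_mu leq_nth_sumn. Qed.

Lemma nth_conj_leq j : (nth 0 (conj_part mu) j <= N)%N.
Proof.
rewrite nth_conj_part //; exact: leq_trans (count_size _ _) size_parts_leq.
Qed.

Lemma conj_part_sym i j : (i < nth 0 (conj_part mu) j)%N = (j < nth 0 mu i)%N.
Proof. by rewrite nth_conj_part // count_sorted_geq. Qed.

Variables f1 f2 : {ffun 'I_m -> 'I_N}.
Hypotheses (f2_cont : content f2 = mshape N (conj_part mu)).
Hypothesis inj12 : injective (pair_col f1 f2).

Let colcard (c : 'I_N) r := #|[pred k | (f2 k == c) && (f1 k < r)%N]|.

Let leq_colcard c r : (r <= N)%N -> (colcard c r <= minn r (nth 0 (conj_part mu) c))%N.
Proof.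
move=> le_rN; rewrite leq_min; apply/andP; split; last first.
  have := congr1 (fun g : 'X_{1..N} => g c) f2_cont; rewrite !mnmE => <-.
  by apply/subset_leq_card/subsetP => k; rewrite !inE => /andP[].
rewrite -[X in (_ <= X)%N](card_ord_ltn le_rN) /colcard -(@card_in_imset _ _ f1) => [|k l].
  apply/subset_leq_card/subsetP => j /imsetP[k]; rewrite !inE.
  by case/andP=> _ lt_k ->.
rewrite !inE => /andP[/eqP k2 _] /andP[/eqP l2 _] eq1; apply: inj12.
by rewrite /pair_col eq1 k2 l2.
Qed.

Let sum_minn r : (r <= N)%N ->
  (\sum_(c < N) minn r (nth 0 (conj_part mu) c) = \sum_(j < N | j < r) nth 0 mu j)%N.
Proof.
move=> le_rN.
transitivity (\sum_(c < N) \sum_(j < N | j < r) (j < nth 0 (conj_part mu) c : nat))%N.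
  apply: eq_bigr => c _; rewrite -big_mkcondr /= sum1_card.
  set k := minn _ _; have le_kN : (k <= N)%N by rewrite geq_min le_rN.
  rewrite -{1}(card_ord_ltn le_kN); apply: eq_card => j.
  by rewrite !inE leq_min.
rewrite exchange_big /=; apply: eq_bigr => j _.
rewrite -(card_ord_ltn (nth_parts_leq j)) -sum1_card [RHS]big_mkcond /=.
by apply: eq_bigr => c _; rewrite conj_part_sym inE; case: ltnP.
Qed.

Let sum_colcard r : (\sum_c colcard c r = \sum_(j < N | j < r) content f1 j)%N.
Proof.
transitivity #|[pred k | (f1 k < r)%N]|.
  rewrite -sum1_card (partition_big f2 predT) //=; apply: eq_bigr => c _.
  by rewrite /colcard -sum1_card; apply: eq_bigl => k; rewrite !inE andbC.
rewrite -sum1_card (partition_big f1 (fun j => (j < r)%N)) //=.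
apply: eq_bigr => j lt_jr; rewrite mnmE -sum1_card; apply: eq_bigl => k.
by rewrite !inE; case: eqP => [->|]; rewrite ?lt_jr ?andbF.
Qed.

(** Column [c] has at most $\min(r,\mu'_c)$ cells in the first [r] rows, where $\mu'$ is the
    transpose, and these minima add up to the sum of the first [r] parts of [mu]. *)
Lemma gale_ryser r : (r <= N)%N ->
  (\sum_(j < N | j < r) content f1 j <= \sum_(j < N | j < r) nth 0 mu j)%N.
Proof.
move=> le_rN; rewrite -sum_colcard -sum_minn //.
by apply: leq_sum => c _; apply: leq_colcard.
Qed.

(** Equality in [gale_ryser] for every [r] forces each column to meet the first [r] rows in exactly
    $\min(r,\mu'_c)$ cells; this number grows at row [r] only inside the diagram. *)
Lemma pair_col_diagram : content f1 = mshape N mu ->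
  forall k, (f2 k < nth 0 mu (f1 k))%N.
Proof.
move=> f1_cont k; rewrite -conj_part_sym.
have colE c r : (r <= N)%N -> colcard c r = minn r (nth 0 (conj_part mu) c).
  move=> le_rN; have /leqifP := leqif_sum (fun c (_ : predT c) => leqif_eq (leq_colcard c le_rN)).
  rewrite sum_colcard sum_minn // f1_cont (eq_bigr (fun j : 'I_N => nth 0 mu j)%N); last first.
    by move=> j _; rewrite mnmE.
  by case: ifP => [/forallP/(_ c)/eqP //|]; rewrite ltnn.
have lt_k := ltn_ord (f1 k).
have : (colcard (f2 k) (f1 k) < colcard (f2 k) (f1 k).+1)%N.
  rewrite /colcard [X in (_ < X)%N](cardD1 k) !inE eqxx ltnSn /= add1n ltnS.
  apply/subset_leq_card/subsetP => l; rewrite !inE => /andP[-> lt_l] /=.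
  by rewrite (leq_trans lt_l) // andbT; apply: contraTneq lt_l => ->; rewrite ltnn.
rewrite !colE //; last exact: ltnW.
by rewrite /minn; case: ifP; case: ifP; lia.
Qed.

End ZeroOneMatrices.

Section ZeroOneCount.

Variables (m N : nat) (mu : seq nat).
Hypotheses (mu_m : mu \in parts m) (le_mN : (m <= N)%N).

Let mu_s : sorted geq mu.
Proof. by move: mu_m; rewrite mem_parts => /andP[/andP[]]. Qed.

Let sumn_mu : sumn mu = m.
Proof. by move: mu_m; rewrite mem_parts => /andP[_ /eqP]. Qed.

Let D : {set 'I_N * 'I_N} := [set x : 'I_N * 'I_N | (x.2 < nth 0 mu x.1)%N].

Let card_row (j : 'I_N) : #|[pred x in D | x.1 == j]| = nth 0%N mu j.
Proof.
rewrite -[RHS](card_ord_ltn (nth_parts_leq mu_m le_mN j)).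
rewrite -(@card_image _ _ (fun c : 'I_N => (j, c))) => [|c c' []] //.
apply: eq_card => -[i c]; rewrite !inE /=; apply/andP/imageP => [[lt_c /eqP ij]|].
  by exists c; rewrite ?inE -ij.
by case=> c' lt_c' [-> ->]; rewrite eqxx.
Qed.

Let card_col (c : 'I_N) : #|[pred x in D | x.2 == c]| = nth 0%N (conj_part mu) c.
Proof.
rewrite -[RHS](card_ord_ltn (nth_conj_leq mu_m le_mN c)).
rewrite -(@card_image _ _ (fun j : 'I_N => (j, c))) => [|i i' []] //.
apply: eq_card => -[i c']; rewrite !inE /=; apply/andP/imageP => [[lt_c /eqP cc]|].
  by exists i; rewrite ?inE ?conj_part_sym -?cc // (conj_part_sym mu_m).
by case=> i'; rewrite inE (conj_part_sym mu_m) => lt_c' [-> ->]; rewrite eqxx.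
Qed.

Let card_D : #|D| = m.
Proof.
rewrite -sum1_card (partition_big (fun x => x.1) predT) //= -sumn_mu sumnE.
rewrite (big_nth 0%N) big_mkord (big_ord_widen _ (nth 0%N mu) (size_parts_leq mu_m le_mN)).
rewrite [RHS]big_mkcond; apply: eq_bigr => j _; rewrite sum1_card.
rewrite (_ : #|_| = nth 0%N mu j); last first.
  by rewrite -card_row; apply: eq_card => x; rewrite !inE.
by case: ltnP => // le_j; rewrite nth_default.
Qed.

(** Label the boxes of the diagram arbitrarily by the [m] points, then permute the points so that
    the rows agree with [f1]. *)
Lemma pair_col_exists (f1 : {ffun 'I_m -> 'I_N}) : content f1 = mshape N mu ->
  exists2 f2, content f2 = mshape N (conj_part mu) & injective (pair_col f1 f2).
Proof.
move=> f1_cont.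
pose e (k : 'I_m) := enum_val (cast_ord (esym card_D) k).
have e_inj : injective e by move=> k l /enum_val_inj/cast_ord_inj.
have eD k : e k \in D by apply: enum_valP.
have card_e (P : pred ('I_N * 'I_N)) : #|[pred k | P (e k)]| = #|[pred x in D | P x]|.
  rewrite -(card_image e_inj); apply: eq_card => x; apply/imageP/andP.
    by case=> k; rewrite inE => Pk ->; rewrite eD.
  move=> [xD Px]; exists (cast_ord card_D (enum_rank_in xD x)).
    by rewrite inE /e cast_ordK enum_rankK_in.
  by rewrite /e cast_ordK enum_rankK_in.
pose g1 : {ffun 'I_m -> 'I_N} := [ffun k => (e k).1].
pose g2 : {ffun 'I_m -> 'I_N} := [ffun k => (e k).2].
have g1_cont : content g1 = mshape N mu.
  apply/mnmP=> j; rewrite !mnmE -card_row -card_e; apply: eq_card => k.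
  by rewrite !inE ffunE.
have g2_cont : content g2 = mshape N (conj_part mu).
  apply/mnmP=> j; rewrite !mnmE -card_col -card_e; apply: eq_card => k.
  by rewrite !inE ffunE.
have /content_eqP[y ->] : content g1 = content f1 by rewrite g1_cont f1_cont.
exists (comp_col g2 y); first by rewrite content_comp.
move=> k l; rewrite /pair_col !ffunE -!surjective_pairing => /e_inj.
exact: perm_inj.
Qed.

(** The diagram is the only zero-one matrix with these margins, and its labellings with rows [f1]
    form one free orbit of the stabilizer of [f1]. *)
Lemma card_pair_col (f1 : {ffun 'I_m -> 'I_N}) : content f1 = mshape N mu ->
  #|[pred f2 | content f2 == mshape N (conj_part mu) & injectiveb (pair_col f1 f2)]|
  = #|col_stab f1|.
Proof.
move=> f1_cont; have [g g_cont inj_g] := pair_col_exists f1_cont.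
have diag f : content f = mshape N (conj_part mu) -> injective (pair_col f1 f) ->
    forall k, pair_col f1 f k \in D.
  by move=> f_cont inj_f k; rewrite inE /=; apply: (pair_col_diagram mu_m).
have comp_inj : {in col_stab f1 &, injective (comp_col g)}.
  move=> s t; rewrite !inE => /forallP s1 /forallP t1 /ffunP eq_st.
  apply/permP=> k; apply: inj_g; rewrite /pair_col (eqP (s1 k)) (eqP (t1 k)).
  by have := eq_st k; rewrite !ffunE => ->.
rewrite -(card_in_imset comp_inj); apply: eq_card => f; rewrite !inE.
apply/andP/imsetP=> [[/eqP f_cont /injectiveP inj_f]|[s]]; last first.
  rewrite inE => /forallP s1 ->; rewrite content_comp g_cont; split=> //.
  apply/injectiveP=> k l; rewrite /pair_col !ffunE => -[eq1 eq2].
  apply: (@perm_inj _ s); apply: inj_g.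
  by rewrite /pair_col (eqP (s1 k)) (eqP (s1 l)) eq1 eq2.
have im_g : codom (pair_col f1 g) =i D.
  have cardE : #|codom (pair_col f1 g)| = #|D| by rewrite (card_codom inj_g) card_ord card_D.
  by apply/(subset_cardP cardE)/subsetP=> _ /codomP[k ->]; apply: diag.
have ex_s k : exists l, pair_col f1 g l == pair_col f1 f k.
  have := diag _ f_cont inj_f k; rewrite -im_g => /codomP[l ->].
  by exists l.
have sE k := eqP (xchooseP (ex_s k)); pose s k := xchoose (ex_s k).
have s_inj : injective s.
  by move=> k l eq_s; apply: inj_f; rewrite -(sE k) -(sE l) [xchoose _]eq_s.
exists (perm s_inj).
  by rewrite inE; apply/forallP=> k; rewrite permE; case: (sE k) => ->.
by apply/ffunP=> k; rewrite ffunE permE; case: (sE k).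
Qed.

End ZeroOneCount.

(** * Complete functions as averages over the symmetric group *)

Lemma hsym_one (R : comUnitRingType) n : nat_unit R -> hsym (fun=> 1 : R) n = 1.
Proof.
move=> nuR; rewrite (@eq_hsym _ nuR _ (fun k => 1 ^+ k)) ?hsym_exp ?expr1n // => k.
by rewrite expr1n.
Qed.

Lemma hsym_psum (R : comUnitRingType) N (p : nat -> R) (y : 'I_N -> R) m :
  nat_unit R ->
  hsym (fun k => p k * psum y k) m =
  \sum_(g : {ffun 'I_N -> 'I_m.+1} | (\sum_j g j == m)%N)
     \prod_j (hsym p (g j) * y j ^+ g j).
Proof.
move=> nuR; rewrite (eq_hsym nuR (p' := fun k => \sum_j y j ^+ k * p k)); last first.
  by move=> k; rewrite mulr_sumr; apply: eq_bigr => j _; rewrite mulrC.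
rewrite -(coef_hpoly_prod nuR _ _ (leqnn m)).
rewrite (eq_bigr (fun j => \sum_(i < m.+1) (hsym p i * y j ^+ i) *: 'X^i)); last first.
  move=> j _; rewrite /hpoly poly_def; apply: eq_bigr => i _.
  by rewrite hsym_scale // mulrC.
rewrite bigA_distr_bigA coef_sum [RHS]big_mkcond; apply: eq_bigr => g _.
rewrite scaler_prod coefZ -expr_sum coefXn eq_sym.
by case: eqP; rewrite ?mulr1 ?mulr0.
Qed.

Lemma prod_content (R : comPzSemiRingType) m N (f : {ffun 'I_m -> 'I_N}) (x : 'I_N -> R) :
  \prod_k x (f k) = \prod_j x j ^+ content f j.
Proof.
rewrite (partition_big f predT) //=; apply: eq_bigr => j _.
rewrite (eq_bigr (fun=> x j)) => [|k /eqP-> //]; rewrite prodr_const mnmE.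
by congr (_ ^+ _); apply: eq_card.
Qed.

Lemma mdeg_content m N (f : {ffun 'I_m -> 'I_N}) : mdeg (content f) = m.
Proof.
rewrite mdegE -[RHS]card_ord -sum1_card (partition_big f predT) //=.
by apply: eq_bigr => j _; rewrite mnmE -sum1_card.
Qed.

Lemma content_surj m N (g : 'X_{1..N}) : mdeg g = m ->
  exists f : {ffun 'I_m -> 'I_N}, content f = g.
Proof.
move=> g_m; have [||f f_cont _] := @young_coloring m N (val g).
- by rewrite -g_m /mdeg sumnE.
- by rewrite size_tuple.
exists f; rewrite f_cont; apply/mnmP=> j.
by rewrite mnmE mnm_tnth (tnth_nth 0%N).
Qed.

Lemma sum_card_stab m N (f0 : {ffun 'I_m -> 'I_N}) :
  (\sum_(f : {ffun 'I_m -> 'I_N} | content f == content f0) #|col_stab f| = m`!)%N.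
Proof.
transitivity (\sum_(f : {ffun 'I_m -> 'I_N}) #|[pred y | comp_col f y == f0]|)%N.
  rewrite big_mkcond; apply: eq_bigr => f _; rewrite card_comp_col eq_sym.
  by case: eqP; rewrite ?mul1n.
transitivity (\sum_(f : {ffun 'I_m -> 'I_N}) \sum_(y : 'S_m) (comp_col f y == f0 : nat))%N.
  by apply: eq_bigr => f _; rewrite -sum1_card big_mkcond.
rewrite exchange_big /= (eq_bigr (fun=> 1%N)) => [|y _].
  by rewrite sum1_card card_Sn.
rewrite (bigD1 (comp_col f0 y^-1)) //= (_ : comp_col _ y = f0); last first.
  by apply/ffunP=> k; rewrite !ffunE permK.
rewrite eqxx big1 ?addn0 // => f ne_f; apply/eqP; rewrite eqb0.
apply: contraNneq ne_f => <-; apply/eqP/ffunP=> k.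
by rewrite !ffunE permKV.
Qed.

Lemma eq_pperm_le (R : pzSemiRingType) m (w : 'S_m) (p p' : nat -> R) :
  (forall k, (k < m)%N -> p k.+1 = p' k.+1) -> pperm w p = pperm w p'.
Proof.
move=> eq_p; apply: eq_bigr => A /imsetP[k _ ->].
have := card_porbit_neq0 w k; have := max_card (porbit w k); rewrite card_ord.
by case: #|_| => // a lt_am _; apply: eq_p.
Qed.

Lemma eq_pperm (R : pzSemiRingType) m (w : 'S_m) (p p' : nat -> R) :
  (forall k, p k.+1 = p' k.+1) -> pperm w p = pperm w p'.
Proof. by move=> eq_p; apply: eq_pperm_le => k _; apply: eq_p. Qed.

(** Burnside's count: a colouring is fixed by as many permutations as its stabilizer has, and over
    the colourings of one content these orders add up to [m!]. *)
Lemma sum_pperm (R : comUnitRingType) (I : finType) (x : I -> R) m : nat_unit R ->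
  \sum_(w : 'S_m) pperm w (psum x) = m`!%:R * hsym (psum x) m.
Proof.
move=> nuR; wlog [N IN] : I x / exists N, I = 'I_N :> finType => [gen|].
  have psumE k : psum x k = psum (fun i : 'I_#|I| => x (enum_val i)) k.
    by rewrite /psum [LHS](reindex_onto enum_val enum_rank) /= => [|i _]; rewrite ?enum_rankK //;
       apply: eq_bigl => i; rewrite enum_valK eqxx.
  rewrite (eq_hsym nuR (p' := psum (fun i : 'I_#|I| => x (enum_val i)))) //.
  rewrite -gen; last by exists #|I|.
  by apply: eq_bigr => w _; apply: eq_pperm => k.
case: _ / (esym IN) x => {IN} x.
transitivity (\sum_(f : {ffun 'I_m -> 'I_N}) #|col_stab f|%:R * \prod_j x j ^+ content f j).
  rewrite (eq_bigr _ (fun w _ => pperm_psum x w)) (exchange_big_dep predT) //=.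
  apply: eq_bigr => f _; rewrite prod_content -sum1_card natr_sum mulr_suml.
  by apply: eq_big => w; rewrite ?inE // mul1r.
rewrite (eq_hsym nuR (p' := fun k => 1 * psum x k)); last by move=> k; rewrite mul1r.
rewrite hsym_psum // mulr_sumr.
pose cf (f : {ffun 'I_m -> 'I_N}) : {ffun 'I_N -> 'I_m.+1} := [ffun j => inord (content f j)].
have cfE f j : cf f j = content f j :> nat.
  rewrite ffunE inordK // ltnS -[X in (_ <= X)%N](mdeg_content f) mdegE.
  by rewrite (bigD1 j) //= leq_addr.
rewrite (partition_big cf (fun g => \sum_j g j == m)%N) => [|f _]; last first.
  by apply/eqP; rewrite -[RHS](mdeg_content f) mdegE; apply: eq_bigr => j _; rewrite cfE.
apply: eq_bigr => g /eqP g_m.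
have [|f0 f0_cont] := @content_surj m N [multinom (g j : nat) | j < N].
  by rewrite mdegE -[RHS]g_m; apply: eq_bigr => j _; rewrite mnmE.
rewrite -(sum_card_stab f0) natr_sum mulr_suml; apply: eq_big => f /=.
  rewrite f0_cont; apply/eqP/eqP=> [<-|f_cont].
    by apply/mnmP=> j; rewrite [RHS]mnmE; apply/esym/cfE.
  by apply/ffunP=> j; apply: val_inj; rewrite /= [LHS]cfE f_cont mnmE.
move/eqP=> <-; congr (_ * _); apply: eq_bigr => j _.
by rewrite hsym_one // mul1r; congr (_ ^+ _); apply/esym/cfE.
Qed.

Lemma ppermM (R : comPzSemiRingType) m (w : 'S_m) (p p' : nat -> R) :
  pperm w (fun k => p k * p' k) = pperm w p * pperm w p'.
Proof. by rewrite -big_split. Qed.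

Lemma pperm_rmorph (R S : pzSemiRingType) (f : {rmorphism R -> S}) m (w : 'S_m) p :
  f (pperm w p) = pperm w (f \o p).
Proof. exact: rmorph_prod. Qed.

Lemma psumM (R : comPzSemiRingType) (I J : finType) (x : I -> R) (y : J -> R) k :
  psum (fun ij : I * J => x ij.1 * y ij.2) k = psum x k * psum y k.
Proof.
rewrite /psum big_distrlr /= pair_big /=; apply: eq_bigr => -[i j] _.
by rewrite exprMn.
Qed.

Lemma nat_unit_mpoly (R : idomainType) N : nat_unit R -> nat_unit {mpoly R[N]}.
Proof.
move=> nuR n; rewrite -(rmorph_nat (@mpolyC N R)).
by apply: rmorph_unit; apply: nuR.
Qed.

(** Apply [sum_pperm] to the letters $x_iy_j$ and take the coefficient of $y^g$: complete functions
    are dual to monomials. *)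
Lemma sum_pperm_content (R : idomainType) (I : finType) (x : I -> R) m N
    (g : 'X_{1..N}) : nat_unit R -> mdeg g = m ->
  \sum_(w : 'S_m) pperm w (psum x) *
     (pperm w (psum (fun i : 'I_N => 'X_i : {mpoly R[N]})))@_g =
  m`!%:R * \prod_j hsym (psum x) (g j).
Proof.
move=> nuR g_m; have nuS := @nat_unit_mpoly R N nuR.
pose xS i : {mpoly R[N]} := (x i)%:MP; pose Y (j : 'I_N) : {mpoly R[N]} := 'X_j.
have psum_xS k : psum xS k = (psum x k)%:MP.
  by rewrite rmorph_sum; apply: eq_bigr => i _; rewrite rmorphXn.
have := sum_pperm (fun ij => xS ij.1 * Y ij.2) m nuS.
move/(congr1 (mcoeff g)); rewrite raddf_sum /=.
rewrite (eq_bigr (fun w => pperm w (psum x) * (pperm w (psum Y))@_g)) => [->|w _]; last first.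
  rewrite [X in mcoeff g X = _](@eq_pperm _ _ _ _ (fun k => psum xS k * psum Y k)) => [|k];
    last exact: psumM.
  rewrite ppermM [X in X * _](@eq_pperm _ _ _ (psum xS) (@mpolyC N R \o psum x)) => [|k];
    last exact: psum_xS.
  by rewrite -pperm_rmorph mcoeffCM.
rewrite (eq_hsym nuS (p' := fun k => (@mpolyC N R \o psum x) k * psum Y k)); last first.
  by move=> k; rewrite psumM psum_xS.
rewrite hsym_psum // -(rmorph_nat (@mpolyC N R)) mcoeffCM; congr (_ * _).
have le_g j : (g j < m.+1)%N by rewrite ltnS -[X in (_ <= X)%N]g_m mdegE (bigD1 j) //= leq_addr.
rewrite raddf_sum (bigD1 [ffun j => Ordinal (le_g j)]) /=; last first.
  by apply/eqP; rewrite -[RHS]g_m mdegE; apply: eq_bigr => j _; rewrite ffunE.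
have prodE (h : {ffun 'I_N -> 'I_m.+1}) :
    (\prod_j (hsym (@mpolyC N R \o psum x) (h j) * Y j ^+ h j))@_g =
    \prod_j hsym (psum x) (h j) * ([multinom (h j : nat) | j < N] == g)%:R.
  rewrite big_split /= (eq_bigr (fun j => (hsym (psum x) (h j))%:MP)) => [|j _]; last first.
    by rewrite hsym_rmorph.
  rewrite -rmorph_prod mcoeffCM; congr (_ * _).
  rewrite (_ : \prod_j _ = 'X_[[multinom (h j : nat) | j < N]]) ?mcoeffX //.
  by rewrite mpolyXE_id; apply: eq_bigr => j _; rewrite mnmE.
rewrite prodE [X in _ + X]big1 ?addr0 => [|h /andP[_ ne_h]].
  rewrite (_ : _ == g) ?mulr1; last by apply/eqP/mnmP=> j; rewrite mnmE ffunE.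
  by apply: eq_bigr => j _; rewrite ffunE.
rewrite prodE; case: eqP => [hE|]; last by rewrite mulr0.
case/eqP: ne_h; apply/ffunP=> j; apply: val_inj; rewrite ffunE /= -hE mnmE.
by [].
Qed.

Lemma sum_ord_eq (V : nmodType) (n m : nat) (G : nat -> V) :
  (forall b, (n <= b)%N -> G b = 0) -> (forall b, (m <= b)%N -> G b = 0) ->
  \sum_(b < n) G b = \sum_(b < m) G b.
Proof.
wlog le_nm : n m / (n <= m)%N => [gen Gn Gm|Gn _].
  by case/orP: (leq_total n m) => le; [|symmetry]; apply: gen.
rewrite (big_ord_widen _ G le_nm) big_mkcond; apply: eq_bigr => b _.
by case: ltnP => // /Gn->.
Qed.

Section JacobiTrudi.

Variables (R : comUnitRingType) (nuR : nat_unit R).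

(** The generating series is $\prod_l(1-x_lt)$, of degree at most [size s]. *)
Lemma hsym_negsum_eq0 (I : Type) (s : seq I) (x : I -> R) r : (size s < r)%N ->
  hsym (fun k => \sum_(l <- s) - x l ^+ k) r = 0.
Proof.
elim: s r => [|l s IHs] r /= lt_r.
  rewrite (eq_hsym nuR (p' := fun=> 0)) => [|k]; last by rewrite big_nil.
  by rewrite hsym_zero // gtn_eqF.
rewrite (eq_hsym nuR (p' := fun k => - x l ^+ k + \sum_(l <- s) - x l ^+ k)); last first.
  by move=> k; rewrite big_cons.
rewrite hsym_add // big1 // => -[i /= lt_i] _.
case: i => [|[|i]] in lt_i *; rewrite ?subn0 ?subn1.
- by rewrite IHs ?mulr0 // ltnW.
- by rewrite IHs ?mulr0 //; case: r lt_r {lt_i}.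
by rewrite hsym_expN //= mul0r subr0 mul0r.
Qed.

(** The complete function of index [a - b], with an explicit 0 at negative indices, where truncated
    subtraction would return 1. *)
Definition hsub (p : nat -> R) (a b : nat) : R :=
  if (b <= a)%N then hsym p (a - b) else 0.

(** The letter $x_i$ is the whole alphabet minus the $N-1$ other letters, so [N] terms suffice. One
    factor depends on [i] and the other on [a]: this factors the matrix of an alternant. *)
Lemma exp_hsub N (x : 'I_N -> R) i a :
  x i ^+ a = \sum_(k < N) hsym (fun n => \sum_(l | l != i) - x l ^+ n) (N - k.+1)
                          * hsub (psum x) a (N - k.+1).
Proof.
pose oth n := \sum_(l | l != i) - x l ^+ n; rewrite -/oth.
rewrite (reindex_inj rev_ord_inj) /=.
rewrite (eq_bigr (fun r : 'I_N => hsym oth r * hsub (psum x) a r)); last first.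
  by move=> r _; rewrite /= subnSK // subKn // ltnW.
rewrite -(sum_ord_eq (n := a.+1) (G := fun r => hsym oth r * hsub (psum x) a r)).
- rewrite -[LHS](hsym_exp nuR) (eq_hsym nuR (p' := fun k => oth k + psum x k)); last first.
    by move=> k; rewrite /oth /psum [X in _ + X](bigD1 i) //= sumrN addrCA addNr addr0.
  rewrite hsym_add //; apply: eq_bigr => b _.
  by rewrite /hsub -ltnS ltn_ord.
- by move=> b lt_ab; rewrite /hsub leqNgt lt_ab mulr0.
move=> b le_Nb; rewrite (eq_hsym nuR (p' := fun n =>
  \sum_(l <- [seq l <- enum 'I_N | l != i]) - x l ^+ n)).
  rewrite hsym_negsum_eq0 ?mul0r // size_filter; apply: leq_trans le_Nb.
  rewrite -[X in (_ < X)%N](size_enum_ord N) -(count_predC (pred1 i)).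
  by rewrite -[X in (X < _)%N]add0n ltn_add2r -has_count has_pred1 mem_enum.
by move=> k; rewrite big_filter big_enum_cond.
Qed.

End JacobiTrudi.

Lemma nat_unit_char0 (F : fieldType) : [pchar F] =i pred0 -> nat_unit F.
Proof. by move=> F0 n; rewrite unitfE; have /pcharf0P-> := F0. Qed.

Lemma nat_unit_algC : nat_unit algC.
Proof. exact: nat_unit_char0 (pchar_num _). Qed.

Section Frobenius.

Variable N : nat.

Local Notation delta := (stair N [::]).
Local Notation X := (fun i : 'I_N => 'X_i : {mpoly algC[N]}).

Lemma deltaE (j : 'I_N) : delta j = (N - j.+1)%N.
Proof. by rewrite mnmE nth_nil. Qed.

Let nuX : nat_unit {mpoly algC[N]}.
Proof. exact: nat_unit_mpoly nat_unit_algC. Qed.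

(** By [exp_hsub] every alternant is $\det M\cdot\det H(l)$ with the same [M], and $H(\delta)$ is
    triangular with unit diagonal, so $\det M$ is the staircase alternant. *)
Lemma jacobi_trudi (l : 'X_{1..N}) :
  altX l = altX delta *
    \sum_(v : 'S_N) (-1) ^+ v *: \prod_j hsub (psum X) (l j) (delta (v j)).
Proof.
pose M := \matrix_(i < N, k < N)
  hsym (fun n => \sum_(l | l != i) - X l ^+ n) (delta k).
pose H (l : 'X_{1..N}) := \matrix_(k < N, j < N) hsub (psum X) (l j) (delta k).
have altE l' : altX l' = \det M * \det (H l').
  rewrite -det_mulmx /altX; congr (\det _); apply/matrixP=> i j; rewrite !mxE.
  rewrite (exp_hsub nuX X); apply: eq_bigr => k _.
  by rewrite !mxE deltaE.
have detH1 : \det (H delta) = 1.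
  rewrite det_trig; last first.
    apply/is_trig_mxP=> k j lt_kj; rewrite mxE /hsub !deltaE ifN //.
    by rewrite -ltnNge; have := ltn_ord j; lia.
  by rewrite big1 // => k _; rewrite mxE /hsub leqnn subnn hsym0.
rewrite !altE detH1 mulr1; congr (_ * _); rewrite -det_tr.
apply: eq_bigr => v _; rewrite -mul_mpolyC rmorphXn rmorphN1; congr (_ * _).
by apply: eq_bigr => j _; rewrite !mxE.
Qed.

Variables (m : nat) (le_mN : (m <= N)%N).

(** The Jacobi-Trudi determinant with [hchar] in place of products of complete functions; the
    condition drops the permutations that give a negative index. *)
Definition frob_char (mu : seq nat) : 'CF([set: 'S_m]) :=
  \sum_(v : 'S_N | (delta#v <= stair N mu)%MM)
     (-1) ^+ v *: hchar m (val (stair N mu - delta#v)%MM).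

Lemma mshape_val (g : 'X_{1..N}) : mshape N (val g) = g.
Proof. by apply/mnmP=> j; rewrite mnmE mnm_tnth (tnth_nth 0%N). Qed.

Lemma sumn_mnm (g : 'X_{1..N}) : sumn (val g) = mdeg g.
Proof. by rewrite /mdeg sumnE. Qed.

Lemma hchar_mnm (g : 'X_{1..N}) w : mdeg g = m -> hchar m (val g) w = (pperm w (psum X))@_g.
Proof.
by move=> g_m; rewrite (@hcharE _ N) ?mshape_val ?sumn_mnm // size_tuple.
Qed.

Lemma mcoeffMXE (P : {mpoly algC[N]}) (k l : 'X_{1..N}) :
  (P * 'X_[k])@_l = if (k <= l)%MM then P@_(l - k) else 0.
Proof.
case: ifP => [le_kl|nle_kl].
  by have := mcoeffMX P k (l - k)%MM; rewrite addmC submK.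
apply: memN_msupp_eq0; apply/negP=> /msuppM_le /allpairsP[[k1 k2] [_ /=]].
rewrite msuppX inE => /eqP-> lE; move: nle_kl; rewrite lE => /negP; apply.
exact: lem_addl.
Qed.

Section OnePartition.

Variables (mu : seq nat) (mu_m : mu \in parts m).

Lemma mdeg_stair_part : mdeg (stair N mu) = (m + mdeg delta)%N.
Proof.
have := mu_m; rewrite mem_parts => /andP[/andP[_ mu_p] /eqP mu_sum].
by rewrite mdeg_stair ?mu_sum // (leq_trans (size_leq_sumn mu_p)) ?mu_sum.
Qed.

Lemma mdeg_stair_sub (v : 'S_N) : (delta#v <= stair N mu)%MM ->
  mdeg (stair N mu - delta#v)%MM = m.
Proof.
move=> le_v; have := congr1 (@mdeg N) (submK le_v); rewrite mdegD mdeg_mperm.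
by rewrite mdeg_stair_part => /addIn.
Qed.

(** Frobenius's formula: each term of the determinant is a coefficient of [pperm w], shifted by a
    monomial of the staircase alternant. *)
Lemma frob_charE w :
  frob_char mu w = (pperm w (psum X) * altX delta)@_(stair N mu).
Proof.
rewrite altX_sum mulr_sumr raddf_sum /= sum_cfunE big_mkcond; apply: eq_bigr => v _.
rewrite -scalerAr mcoeffZ mcoeffMXE; case: ifP => le_v; rewrite ?mulr0 //.
by rewrite cfunE hchar_mnm ?mdeg_stair_sub.
Qed.

Lemma frob_char_conj w : (frob_char mu w)^* = frob_char mu w.
Proof.
rewrite sum_cfunE rmorph_sum; apply: eq_bigr => v le_v.
by rewrite cfunE rmorphM rmorph_sign hchar_mnm ?mdeg_stair_sub // mcoeff_pperm rmorph_nat.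
Qed.

(** [sum_pperm_content] turns each [hchar] back into a product of complete functions, and
    [jacobi_trudi] reassembles the alternant. *)
Lemma sum_frob_char :
  (\sum_(w : 'S_m) frob_char mu w *: pperm w (psum X)) * altX delta =
  m`!%:R *: altX (stair N mu).
Proof.
rewrite [in RHS]jacobi_trudi scalerAr mulrC; congr (_ * _).
rewrite scaler_sumr.
under eq_bigr do rewrite sum_cfunE scaler_suml.
rewrite exchange_big big_mkcond; apply: eq_bigr => v _; case: ifP => le_v; last first.
  move/negbT: le_v; rewrite negb_forall => /existsP[j nle_j].
  by rewrite (bigD1 j) //= /hsub mnmE in nle_j *; rewrite (negPf nle_j) mul0r !scaler0.
transitivity ((-1) ^+ v *: (m`!%:R * \prod_j hsym (psum X) ((stair N mu - delta#v)%MM j))).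
  rewrite -(sum_pperm_content _ nuX (mdeg_stair_sub le_v)) scaler_sumr.
  apply: eq_bigr => w _; rewrite cfunE hchar_mnm ?mdeg_stair_sub // !mcoeff_pperm.
  by rewrite -scalerA scaler_nat mulr_natr.
rewrite [RHS]scalerA [in RHS](mulrC m`!%:R) -[RHS]scalerA scaler_nat -[in RHS]mulr_natl;
  congr (_ *: (_ * _)).
apply: eq_bigr => j _; rewrite /hsub mnmBE [(delta#v)%MM j]mnmE.
by have /mnm_lepP/(_ j) := le_v; rewrite mnmE => ->.
Qed.

Lemma frob_char_vchar : frob_char mu \in 'Z[irr [set: 'S_m]]%g.
Proof.
apply: rpred_sum => v _; rewrite rpredZsign; apply: char_vchar.
by apply: cfInd_char; apply: rpred1.
Qed.

End OnePartition.

Lemma mdeg_pperm_altX (w : 'S_m) (l k : 'X_{1..N}) :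
  (pperm w (psum X) * altX l)@_k != 0 -> mdeg k = (m + mdeg l)%N.
Proof.
rewrite altX_sum mulr_sumr raddf_sum /=; apply: contraNeq => ne_k.
rewrite big1 // => v _; rewrite -scalerAr mcoeffZ mcoeffMXE; case: ifP => le_v; rewrite ?mulr0 //.
rewrite mcoeff_pperm eq_card0 ?mulr0 // => f; rewrite !inE; apply/andP=> -[_ /eqP f_cont].
case/eqP: ne_k; rewrite -(submK le_v) mdegD mdeg_mperm -f_cont mdeg_content.
by [].
Qed.

Lemma issym_pperm (w : 'S_m) : pperm w (psum X) \is symmetric.
Proof.
apply/issymP=> s; rewrite pperm_rmorph; apply: eq_pperm => k /=.
rewrite rmorph_sum [RHS](reindex_inj (@perm_inj _ s)); apply: eq_bigr => i _ /=.
by rewrite rmorphXn /= msymX; congr ('X_[_] ^+ _); apply/mnmP=> j;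
  rewrite !mnmE eq_sym (canF_eq (permKV s)) eq_sym.
Qed.

Lemma pperm_altX (w : 'S_m) :
  pperm w (psum X) * altX delta = \sum_(mu <- parts m) frob_char mu w *: altX (stair N mu).
Proof.
have w_anti := antisymMl (issym_pperm w) (@antisym_altX _ delta).
rewrite [LHS](antisym_expand le_mN w_anti) => [|l]; last exact: mdeg_pperm_altX.
by rewrite !big_seq; apply: eq_bigr => mu mu_m; rewrite frob_charE.
Qed.

(** Inserting [frob_charE] for [nu] and summing over [w] by [sum_frob_char] for [mu] leaves a single
    coefficient of an alternant. *)
Lemma cfdot_frob_char mu nu : mu \in parts m -> nu \in parts m ->
  '[frob_char mu, frob_char nu] = (mu == nu)%:R.
Proof.
move=> mu_m nu_m; rewrite cfdotE /= -(mcoeff_altX_stair mu_m nu_m le_mN).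
apply: canLR (mulKf (neq0CG _)) _.
rewrite (_ : #|_| = m`!); last by rewrite cardsT card_Sn.
rewrite -mcoeffZ -sum_frob_char // mulr_suml raddf_sum /=.
apply: eq_big => [w|w _]; first by rewrite inE.
by rewrite -scalerAl mcoeffZ frob_char_conj // frob_charE.
Qed.

End Frobenius.

Lemma cf_sgnE m (H : {group 'S_m}) w : cf_sgn H w = (-1) ^+ w *+ (w \in H).
Proof. by rewrite cfunE. Qed.

Lemma cf_sgn_char m (H : {group 'S_m}) : cf_sgn H \is a character.
Proof.
pose rG (s : 'S_m) : 'M[algC]_1 := ((-1) ^+ s)%:M.
have rGP : mx_repr H rG.
  split=> [|s t _ _]; first by rewrite /rG odd_perm1.
  by rewrite /rG odd_permM signr_addb scalar_mxM.
suffices -> : cf_sgn H = cfRepr (MxRepresentation rGP) by apply: cfRepr_char.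
by apply/cfunP=> w; rewrite cf_sgnE cfunE /= mxtrace_scalar.
Qed.

(** * Identification of the irreducible characters chosen in [sym_irr] *)

Section Identification.

Variable m : nat.

Lemma echar_char sh : echar m sh \is a character.
Proof. by apply: cfInd_char; apply: cf_sgn_char. Qed.

Lemma hchar_char sh : hchar m sh \is a character.
Proof. by apply: cfInd_char; apply: rpred1. Qed.

Lemma cfdot_char_irr_ge0 (chi : 'CF([set: 'S_m])) i :
  chi \is a character -> 0 <= '[chi, 'chi_i].
Proof. by move/(Cnat_cfdot_char_irr i)/natrP=> [a ->]; rewrite ler0n. Qed.

Lemma cfdot_hchar_echar_le0 (chi psi : 'CF([set: 'S_m])) i :
  chi \is a character -> psi \is a character ->
  '[chi, psi] = 0 -> '[psi, 'chi_i] != 0 -> '[chi, 'chi_i] = 0.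
Proof.
move=> chi_char psi_char; rewrite cfdot_sum_irr => /eqP.
rewrite psumr_eq0 => [|j _]; last first.
  by rewrite mulr_ge0 ?conjC_ge0 ?cfdot_char_irr_ge0.
move/allP/(_ i); rewrite mem_index_enum => /(_ isT); rewrite /= mulf_eq0 conjC_eq0.
by case/orP=> /eqP->; rewrite ?eqxx.
Qed.

(** Two common constituents would each contribute at least 1 to the scalar product. *)
Lemma common_constt_uniq (chi psi : 'CF([set: 'S_m])) i j :
  chi \is a character -> psi \is a character -> '[chi, psi] = 1 ->
  i \in irr_constt chi -> i \in irr_constt psi ->
  j \in irr_constt chi -> j \in irr_constt psi -> i = j.
Proof.
move=> chi_char psi_char dot1; rewrite !irr_consttE => chi_i psi_i chi_j psi_j.
apply/eqP; apply: contraTT (erefl true) => ne_ij.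
have ge1 k : '[chi, 'chi_k] != 0 -> '[psi, 'chi_k] != 0 ->
    1 <= '[chi, 'chi_k] * ('[psi, 'chi_k])^*.
  have /natrP[a ->] := Cnat_cfdot_char_irr k chi_char.
  have /natrP[b ->] := Cnat_cfdot_char_irr k psi_char.
  by rewrite !pnatr_eq0 conjC_nat -natrM ler1n muln_gt0 -!lt0n => -> ->.
have : (2%:R : algC) <= 1.
  rewrite -{2}dot1 cfdot_sum_irr (bigD1 i) //= (bigD1 j) 1?eq_sym //= addrA.
  rewrite (natrD _ 1 1) -[X in X <= _]addr0 lerD ?lerD ?ge1 //.
  apply: sumr_ge0 => k _.
  by rewrite mulr_ge0 ?conjC_ge0 ?cfdot_char_irr_ge0.
by rewrite (ler_nat _ 2 1).
Qed.

Variables (N : nat) (le_mN : (m <= N)%N).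

Local Notation delta := (stair N [::]).

Section Partition.

Variables (mu : seq nat) (mu_m : mu \in parts m).

Let conj_m := conj_part_parts mu_m.

Let sumn_conj : sumn (conj_part mu) = m.
Proof. by move: conj_m; rewrite mem_parts => /andP[_ /eqP]. Qed.

Let sumn_mu : sumn mu = m.
Proof. by move: mu_m; rewrite mem_parts => /andP[_ /eqP]. Qed.

Let le_conj : (size (conj_part mu) <= N)%N := size_parts_leq conj_m le_mN.

(** The term [v] of the determinant has rows $\mu_j+v(j)-j$. By [gale_ryser] a zero-one matrix with
    these rows requires partial sums not above those of [mu], which leaves only the identity. *)
Lemma cfdot_hchar_echar_stair (v : 'S_N) : (delta#v <= stair N mu)%MM ->
  '[hchar m (val (stair N mu - delta#v)%MM), echar m (conj_part mu)] = (v == 1%g)%:R.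
Proof.
move=> le_v; set g := (_ - _)%MM; have g_m : mdeg g = m by apply: mdeg_stair_sub.
have [||f1 f1_cont f1_stab] := @young_coloring m N (val g).
- by rewrite sumn_mnm.
- by rewrite size_tuple.
rewrite mshape_val in f1_cont.
rewrite (cfdot_hchar_echar _ _ sumn_conj le_conj f1_stab) ?sumn_mnm ?size_tuple //.
have [v1|nt_v] := eqVneq v 1%g.
  rewrite (card_pair_col mu_m) ?f1_cont //; last first.
    by apply/mnmP=> j; rewrite /g v1 mperm1 mnmBE !mnmE nth_nil addnK.
  by rewrite -f1_stab divff // neq0CG.
rewrite [X in X%:R / _]eq_card0 ?mul0r // => f2; rewrite !inE;
  apply/andP=> -[/eqP f2_cont /injectiveP inj12].
case/eqP: nt_v; apply: perm_sum_leq1 => r le_rN.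
have := gale_ryser mu_m le_mN f2_cont inj12 le_rN; rewrite f1_cont.
have gE j : (g j + (N - (v j).+1) = nth 0 mu j + (N - j.+1))%N.
  rewrite -deltaE; have /mnmP/(_ j) := submK le_v.
  by rewrite mnmDE !mnmE.
have : (\sum_(j < N | j < r) (g j + j) = \sum_(j < N | j < r) (nth 0 mu j + v j))%N.
  by apply: eq_bigr => j _; have := gE j; have := ltn_ord j; have := ltn_ord (v j); lia.
by rewrite !big_split /=; lia.
Qed.

Lemma le_delta1 : (delta#(1 : 'S_N)%g <= stair N mu)%MM.
Proof. by apply/mnm_lepP=> j; rewrite mperm1 !mnmE nth_nil leq_addl. Qed.

Lemma hchar_stair1 :
  hchar m (val (stair N mu - delta#(1 : 'S_N)%g)%MM) = hchar m mu.
Proof.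
apply/cfunP=> w; rewrite hchar_mnm; last exact/mdeg_stair_sub/le_delta1.
rewrite (@hcharE _ N) //; last exact: size_parts_leq mu_m le_mN.
congr (_@__); apply/mnmP=> j; rewrite mperm1 mnmBE !mnmE nth_nil addnK.
by [].
Qed.

Lemma cfdot_hchar_echar_conj : '[hchar m mu, echar m (conj_part mu)] = 1.
Proof. by rewrite -hchar_stair1 cfdot_hchar_echar_stair ?eqxx // le_delta1. Qed.

Lemma sym_irr_eq j : j \in irr_constt (hchar m mu) ->
  j \in irr_constt (echar m (conj_part mu)) -> sym_irr m mu = 'chi_j.
Proof.
move=> h_j e_j; rewrite /sym_irr; case: pickP => [i /andP[h_i e_i]|/(_ j)]; last first.
  by rewrite -/(hchar m mu) -/(echar m _) h_j e_j.
congr 'chi__; apply: common_constt_uniq (hchar_char mu) (echar_char _) _ h_i e_i h_j e_j.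
exact: cfdot_hchar_echar_conj.
Qed.

(** A virtual character of norm 1 is irreducible up to sign, and its product 1 with [echar] excludes
    the minus sign. The other terms of the determinant are orthogonal to [echar], hence miss this
    irreducible, so it must occur in [hchar m mu]. *)
Lemma frob_char_irr : exists2 i, frob_char N m mu = 'chi_i &
  i \in irr_constt (hchar m mu) /\ i \in irr_constt (echar m (conj_part mu)).
Proof.
have dot_Fe : '[frob_char N m mu, echar m (conj_part mu)] = 1.
  rewrite cfdot_suml (bigD1 1%g) ?le_delta1 //= cfdotZl odd_perm1 mul1r.
  rewrite cfdot_hchar_echar_stair ?le_delta1 // eqxx big1 ?addr0 //.
  move=> v /andP[le_v nt_v]; rewrite cfdotZl cfdot_hchar_echar_stair //.
  by rewrite (negPf nt_v) mulr0.
have normF : '[frob_char N m mu] = 1 by rewrite cfdot_frob_char ?eqxx.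
have [b [i FE]] := vchar_norm1P (frob_char_vchar N m mu) normF.
have dot_e : '['chi_i, echar m (conj_part mu)] \in Num.nat.
  by rewrite cfdotC; have /natrP[a ->] := Cnat_cfdot_char_irr i (echar_char (conj_part mu));
    rewrite conjC_nat rpred_nat.
have b0 : b = false.
  move: dot_Fe dot_e; rewrite FE cfdotZl; case: b {FE} => //.
  rewrite expr1 mulN1r => /eqP; rewrite eqr_oppLR => /eqP-> /natrP[a /eqP].
  by rewrite eq_sym -subr_eq0 opprK natr1 pnatr_eq0.
move: FE dot_Fe; rewrite b0 scale1r => FE; rewrite FE => dot_ie.
have e_i : '[echar m (conj_part mu), 'chi_i] != 0.
  by rewrite cfdotC dot_ie conjC1 oner_eq0.
exists i => //; rewrite !irr_consttE; split=> //.
move: normF; rewrite {2}FE cfdot_suml (bigD1 1%g) ?le_delta1 //= cfdotZl odd_perm1 mul1r.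
rewrite hchar_stair1 big1 => [|v /andP[le_v nt_v]].
  by rewrite addr0 => ->; rewrite oner_eq0.
rewrite cfdotZl (cfdot_hchar_echar_le0 (hchar_char _) (echar_char (conj_part mu)) _ e_i) ?mulr0
  //.
by rewrite cfdot_hchar_echar_stair // (negPf nt_v).
Qed.

Lemma sym_irrE : sym_irr m mu = frob_char N m mu.
Proof. by have [i -> [h_i e_i]] := frob_char_irr; apply: sym_irr_eq. Qed.

End Partition.

Lemma pperm_altX_sym_irr (w : 'S_m) :
  pperm w (psum (fun i : 'I_N => 'X_i : {mpoly algC[N]})) * altX delta =
  \sum_(mu <- parts m) sym_irr m mu w *: altX (stair N mu).
Proof.
rewrite pperm_altX // !big_seq; apply: eq_bigr => mu mu_m.
by rewrite sym_irrE.
Qed.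

Lemma sum_sym_irr mu : mu \in parts m ->
  (\sum_(w : 'S_m) sym_irr m mu w *: pperm w (psum (fun i : 'I_N => 'X_i : {mpoly algC[N]})))
    * altX delta = m`!%:R *: altX (stair N mu).
Proof.
move=> mu_m; rewrite -sum_frob_char //; congr (_ * _); apply: eq_bigr => w _.
by rewrite sym_irrE.
Qed.

End Identification.

(** Tensoring with the sign exchanges [hchar] and [echar], hence the two conditions that define the
    irreducible of [mu] and of its transpose. *)
Lemma sym_irr_conj m mu (w : 'S_m) : mu \in parts m ->
  sym_irr m (conj_part mu) w = (-1) ^+ w * sym_irr m mu w.
Proof.
move=> mu_m; have [i FE [h_i e_i]] := frob_char_irr (leqnn m) mu_m.
pose sgn := cf_sgn [set: 'S_m]%G.
have sgnE s : sgn s = (-1) ^+ s by rewrite cf_sgnE inE.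
have sgn_lin : sgn \is a linear_char.
  by rewrite qualifE /= cf_sgn_char sgnE odd_perm1 eqxx.
have /irrP[j jE] : sgn * 'chi_i \in irr [set: 'S_m].
  by apply: mul_lin_irr => //; apply: mem_irr.
have dotE (phi psi : 'CF([set: 'S_m])) : (forall s : 'S_m, psi s = (-1) ^+ s * phi s) ->
    '[phi, 'chi_j] = '[psi, 'chi_i].
  move=> psiE; rewrite -jE !cfdotE; congr (_ * _); apply: eq_bigr => s _.
  by rewrite cfunE /= sgnE psiE rmorphM rmorph_sign mulrCA mulrA.
rewrite (sym_irr_eq (leqnn m) mu_m h_i e_i) -sgnE.
rewrite (sym_irr_eq (leqnn m) (conj_part_parts mu_m) (j := j)).
- by rewrite -jE cfunE.
- rewrite irr_consttE (dotE _ (echar m (conj_part mu))) -?irr_consttE // => s.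
  exact: echarE.
rewrite (conj_partK mu_m) irr_consttE (dotE _ (hchar m mu)) -?irr_consttE // => s.
by rewrite echarE mulrA -expr2 sqrr_sign mul1r.
Qed.

(** * Schur functions of power sums *)

Section SchurFunction.

Variables (K : comUnitRingType) (nuK : nat_unit K) (iota : {rmorphism algC -> K}).

(** The Frobenius characteristic of the irreducible of [mu] at arbitrary power sums; a ratio of
    alternants would require letters. *)
Definition schurp (mu : seq nat) (p : nat -> K) : K :=
  iota (sumn mu)`!%:R^-1 *
  \sum_(w : 'S_(sumn mu)) iota (sym_irr (sumn mu) mu w) * pperm w p.

Lemma eq_schurp mu (p p' : nat -> K) : (forall k, p k.+1 = p' k.+1) ->
  schurp mu p = schurp mu p'.
Proof.
by move=> eq_p; congr (_ * _); apply: eq_bigr => w _; rewrite (eq_pperm w eq_p).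
Qed.

Lemma schurp_scale mu c p :
  schurp mu (fun k => c ^+ k * p k) = c ^+ sumn mu * schurp mu p.
Proof.
rewrite /schurp mulrCA; congr (_ * _); rewrite mulr_sumr; apply: eq_bigr => w _.
rewrite mulrCA; congr (_ * _); rewrite ppermM; congr (_ * _).
by rewrite /pperm (prod_porbits w (fun=> c)) prodr_const card_ord.
Qed.

Lemma ppermN m (w : 'S_m) p : pperm w (fun k => - p k) = (-1) ^+ #|porbits w| * pperm w p :> K.
Proof. exact: prodrN. Qed.

(** The sign of [w] is $(-1)^m$ times $-1$ to the number of cycles, and negating the power sums
    produces the latter. *)
Lemma schurpN_conj m mu p : mu \in parts m ->
  schurp (conj_part mu) p = (-1) ^+ m * schurp mu (fun k => - p k).
Proof.
move=> mu_m; have := conj_part_parts mu_m; have := mu_m.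
rewrite !mem_parts /schurp => /andP[_ /eqP->] /andP[_ /eqP->].
rewrite mulrCA; congr (_ * _); rewrite mulr_sumr; apply: eq_bigr => w _.
rewrite sym_irr_conj // rmorphM rmorph_sign ppermN.
have -> : (-1) ^+ w = (-1) ^+ m * (-1) ^+ #|porbits w| :> K.
  by rewrite /odd_perm card_ord signr_addb !signr_odd.
by rewrite -!mulrA; congr (_ * _); rewrite mulrCA.
Qed.

Definition alt N (y : 'I_N -> K) (l : 'X_{1..N}) : K :=
  \det (\matrix_(i < N, j < N) y i ^+ l j).

Section FiniteAlphabet.

Variables (N : nat) (y : 'I_N -> K).

Local Notation X := (fun i : 'I_N => 'X_i : {mpoly algC[N]}).
Local Notation ev := (mmap iota y).

Lemma mmap_altX l : ev (altX l) = alt y l.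
Proof.
rewrite -det_map_mx; congr (\det _); apply/matrixP=> i j.
by rewrite !mxE rmorphXn /= mmapX mmap1U.
Qed.

Lemma mmap_psum k : ev (psum X k) = psum y k.
Proof.
by rewrite rmorph_sum; apply: eq_bigr => i _; rewrite rmorphXn /= mmapX mmap1U.
Qed.

Lemma mmap_pperm m (w : 'S_m) : ev (pperm w (psum X)) = pperm w (psum y).
Proof. by rewrite pperm_rmorph; apply: eq_pperm => k; rewrite /= mmap_psum. Qed.

Lemma pperm_alt m (w : 'S_m) : (m <= N)%N ->
  pperm w (psum y) * alt y (stair N [::]) =
  \sum_(mu <- parts m) iota (sym_irr m mu w) * alt y (stair N mu).
Proof.
move=> le_mN; rewrite -mmap_pperm -mmap_altX -rmorphM pperm_altX_sym_irr //.
by rewrite rmorph_sum; apply: eq_bigr => mu _; rewrite /= mmapZ mmap_altX.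
Qed.

Lemma schurp_alt m mu : mu \in parts m -> (m <= N)%N ->
  schurp mu (psum y) * alt y (stair N [::]) = alt y (stair N mu).
Proof.
move=> mu_m le_mN; have := mu_m; rewrite mem_parts /schurp => /andP[_ /eqP->].
rewrite -mulrA -mmap_altX (eq_bigr (fun w => ev (sym_irr m mu w *: pperm w (psum X))));
  last first.
  by move=> w _; rewrite mmapZ mmap_pperm.
rewrite -rmorph_sum -rmorphM sum_sym_irr //= mmapZ mmap_altX mulrA -rmorphM /=.
by rewrite mulVf ?rmorph1 ?mul1r // pnatr_eq0 -lt0n fact_gt0.
Qed.

(** Average $p_w(x)p_w(y)$ over [w] and expand the factor in [y] in alternants. Keeping the
    alternant in [y] as a factor allows letters that coincide and rings where it is not
    invertible. *)
Lemma cauchy_alt (I : finType) (x : I -> K) m : (m <= N)%N ->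
  hsym (fun k => psum x k * psum y k) m * alt y (stair N [::]) =
  \sum_(mu <- parts m) schurp mu (psum x) * alt y (stair N mu).
Proof.
move=> le_mN; have m_unit : m`!%:R \is a @GRing.unit K.
  by have := nuK (m`!).-1; rewrite prednK ?fact_gt0.
apply: (mulrI m_unit); rewrite mulrA.
rewrite -(eq_hsym nuK (fun k => psumM x y k.+1)) -sum_pperm //.
rewrite mulr_suml (eq_bigr (fun w =>
  pperm w (psum x) * (pperm w (psum y) * alt y (stair N [::])))).
  rewrite (eq_bigr _ (fun w _ => congr1 _ (pperm_alt w le_mN))) mulr_sumr.
  under eq_bigr do rewrite mulr_sumr; rewrite exchange_big /= !big_seq.
  apply: eq_bigr => mu; rewrite mem_parts /schurp => /andP[_ /eqP->].
  rewrite mulrA [m`!%:R * _]mulrA -[m`!%:R in RHS](rmorph_nat iota) -rmorphM.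
  rewrite mulfV ?pnatr_eq0 -?lt0n ?fact_gt0 // rmorph1 mul1r mulr_suml.
  by apply: eq_bigr => w _; ring.
move=> w _; rewrite mulrA -ppermM; congr (_ * _); apply: eq_pperm => k; exact: psumM.
Qed.

End FiniteAlphabet.

End SchurFunction.

Lemma schurp_rmorph (K K' : comUnitRingType) (iota : {rmorphism algC -> K})
    (iota' : {rmorphism algC -> K'}) (f : {rmorphism K -> K'}) mu p :
  f \o iota =1 iota' -> f (schurp iota mu p) = schurp iota' mu (f \o p).
Proof.
move=> fE; rewrite /schurp rmorphM rmorph_sum -fE; congr (_ * _).
by apply: eq_bigr => w _; rewrite rmorphM pperm_rmorph -fE.
Qed.

(** * Littlewood-Richardson coefficients and power sum expressions *)

Section GenericAlphabet.

Variable n : nat.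

Definition schur_mpoly mu : {mpoly algC[n]} :=
  schurp (@mpolyC n algC) mu (psum (fun i : 'I_n => 'X_i)).

Let altXE l : alt (fun i : 'I_n => 'X_i : {mpoly algC[n]}) l = altX l.
Proof. by []. Qed.

Lemma schur_mpolyE m mu : mu \in parts m -> (m <= n)%N ->
  schur_mpoly mu * altX (stair n [::]) = altX (stair n mu).
Proof. by move=> mu_m le_mn; rewrite -!altXE; apply: schurp_alt mu_m le_mn. Qed.

Lemma schurE m mu : mu \in parts m -> (m <= n)%N -> schur n mu = tofrac (schur_mpoly mu).
Proof.
move=> mu_m le_mn; rewrite /schur !alternantE -(schur_mpolyE mu_m le_mn) rmorphM /= mulfK //.
by rewrite tofrac_eq0 altX_stair_neq0.
Qed.

Lemma issym_schur_mpoly mu : schur_mpoly mu \is symmetric.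
Proof.
rewrite /schur_mpoly /schurp mul_mpolyC; apply: rpredZ.
apply: rpred_sum => w _; rewrite mul_mpolyC; apply: rpredZ.
exact: issym_pperm.
Qed.

Lemma mdeg_schur_altX m mu l k : sumn mu = m ->
  (schur_mpoly mu * altX l)@_k != 0 -> mdeg k = (m + mdeg l)%N.
Proof.
move=> mu_m; apply: contraNeq => ne_k.
rewrite /schur_mpoly /schurp -mulrA mul_mpolyC mcoeffZ mulr_suml raddf_sum /=.
rewrite big1 ?mulr0 // => w _; rewrite -mulrA mul_mpolyC mcoeffZ.
have [-> |] := eqVneq (pperm w (psum (fun i : 'I_n => 'X_i : {mpoly algC[n]})) * altX l)@_k 0.
  by rewrite mulr0.
by move/mdeg_pperm_altX => kE; case/eqP: ne_k; rewrite kE mu_m.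
Qed.

(** The coefficients read in [n] variables. [is_LR] demands the same ones for every large [n], hence
    the stability in [lr_coefS]. *)
Definition lr_coef mu nu rho : algC :=
  (schur_mpoly mu * altX (stair n nu))@_(stair n rho).

Lemma schur_mpolyM mu nu m1 m2 : mu \in parts m1 -> nu \in parts m2 -> (m1 + m2 <= n)%N ->
  schur_mpoly mu * schur_mpoly nu =
  \sum_(rho <- parts (m1 + m2)) lr_coef mu nu rho *: schur_mpoly rho.
Proof.
move=> mu_m nu_m le_n; apply: (mulIf (@altX_stair_neq0 n [::] isT)).
have le_m2n : (m2 <= n)%N by apply: leq_trans le_n; apply: leq_addl.
rewrite -mulrA (schur_mpolyE nu_m le_m2n) mulr_suml.
have mun_anti := antisymMl (issym_schur_mpoly mu) (@antisym_altX _ (stair n nu)).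
rewrite [LHS](antisym_expand le_n mun_anti) => [|k].
  rewrite !big_seq; apply: eq_bigr => rho rho_m.
  by rewrite -scalerAl (schur_mpolyE rho_m le_n).
have [mu_sum nu_sum] : sumn mu = m1 /\ sumn nu = m2.
  by move: mu_m nu_m; rewrite !mem_parts => /andP[_ /eqP->] /andP[_ /eqP->].
move/(mdeg_schur_altX mu_sum) ->; rewrite mdeg_stair ?nu_sum ?addnA //.
have := nu_m; rewrite mem_parts => /andP[/andP[_ /size_leq_sumn nu_p] _].
by rewrite (leq_trans nu_p) // nu_sum.
Qed.

Lemma schur_mpoly_indep d (c c' : seq nat -> algC) : (d <= n)%N ->
  \sum_(mu <- parts d) c mu *: schur_mpoly mu =
  \sum_(mu <- parts d) c' mu *: schur_mpoly mu -> {in parts d, c =1 c'}.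
Proof.
move=> le_dn eq_c; apply: (altX_indep le_dn).
have altE (b : seq nat -> algC) : \sum_(mu <- parts d) b mu *: altX (stair n mu) =
    (\sum_(mu <- parts d) b mu *: schur_mpoly mu) * altX (stair n [::]).
  rewrite mulr_suml !big_seq; apply: eq_bigr => mu mu_d.
  by rewrite -scalerAl (schur_mpolyE mu_d le_dn).
by rewrite !altE eq_c.
Qed.

End GenericAlphabet.

(** Setting the last variable to 0 removes one letter from every power sum of positive index. *)
Lemma schur_mpoly_restrict n mu :
  mmap (@mpolyC n algC) (fun i => if unlift ord_max i is Some j then 'X_j else 0)
    (schur_mpoly n.+1 mu) = schur_mpoly n mu.
Proof.
rewrite (schurp_rmorph (iota' := @mpolyC n algC)) => [|c]; last by rewrite /= mmapC.
apply: eq_schurp => k /=; rewrite mmap_psum /psum (bigD1 ord_max) //=.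
rewrite unlift_none expr0n add0r (reindex_omap (lift ord_max) (unlift ord_max)) /=; last first.
  by move=> i; rewrite eq_sym; case: unliftP => [j ->|->] //; rewrite eqxx.
apply: eq_big => j; first by rewrite liftK eqxx andbT eq_sym neq_lift.
by rewrite liftK.
Qed.

Lemma lr_coefS n mu nu m1 m2 : mu \in parts m1 -> nu \in parts m2 -> (m1 + m2 <= n)%N ->
  {in parts (m1 + m2), lr_coef n.+1 mu nu =1 lr_coef n mu nu}.
Proof.
move=> mu_m nu_m le_n; apply: (schur_mpoly_indep le_n).
rewrite -(schur_mpolyM mu_m nu_m le_n) -(schur_mpoly_restrict n mu) -(schur_mpoly_restrict n nu)
  -rmorphM /=.
rewrite (schur_mpolyM mu_m nu_m (leqW le_n)) rmorph_sum /=.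
by apply: eq_bigr => rho _; rewrite /= mmapZ mul_mpolyC schur_mpoly_restrict.
Qed.

Lemma is_LR_exists mu nu m1 m2 : mu \in parts m1 -> nu \in parts m2 ->
  is_LR mu nu (lr_coef (m1 + m2) mu nu).
Proof.
move=> mu_m nu_m n.
have [-> ->] : sumn mu = m1 /\ sumn nu = m2.
  by move: mu_m nu_m; rewrite !mem_parts => /andP[_ /eqP->] /andP[_ /eqP->].
move=> le_n; have le_m1n := leq_trans (leq_addr m2 m1) le_n.
have le_m2n := leq_trans (leq_addl m1 m2) le_n.
rewrite (schurE mu_m le_m1n) (schurE nu_m le_m2n) -rmorphM /=.
rewrite (schur_mpolyM mu_m nu_m le_n) rmorph_sum !big_seq; apply: eq_bigr => rho rho_m.
rewrite (schurE rho_m le_n) -mul_mpolyC rmorphM /=; congr (tofrac (mpolyC _ _) * _).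
elim: n le_n {le_m1n le_m2n} => [|n IHn]; first by rewrite leqn0 => /eqP->.
rewrite leq_eqVlt => /orP[/eqP<- //|]; rewrite ltnS => le_n.
by rewrite -(IHn le_n); apply: (lr_coefS mu_m nu_m le_n).
Qed.

Lemma LR_spec mu nu m1 m2 n : mu \in parts m1 -> nu \in parts m2 -> (m1 + m2 <= n)%N ->
  schur_mpoly n mu * schur_mpoly n nu =
  \sum_(rho <- parts (m1 + m2)) LR rho mu nu *: schur_mpoly n rho.
Proof.
move=> mu_m nu_m le_n.
have [mu_s nu_s] : sumn mu = m1 /\ sumn nu = m2.
  by move: mu_m nu_m; rewrite !mem_parts => /andP[_ /eqP->] /andP[_ /eqP->].
have exLR : exists c, is_LR mu nu c by exists (lr_coef (m1 + m2) mu nu); apply: is_LR_exists.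
have := epsilon_spec (inhabits (fun=> 0)) _ exLR; set c := epsilon _ _ => cP.
have le_m1n := leq_trans (leq_addr m2 m1) le_n.
have le_m2n := leq_trans (leq_addl m1 m2) le_n.
have := cP n; rewrite mu_s nu_s => /(_ le_n).
rewrite (schurE mu_m le_m1n) (schurE nu_m le_m2n) -rmorphM /=.
rewrite big_seq (eq_bigr (fun rho => tofrac (LR rho mu nu *: schur_mpoly n rho))).
  by rewrite -big_seq -rmorph_sum => /eqP; rewrite tofrac_eq => /eqP.
move=> rho rho_m; rewrite (schurE rho_m le_n) -mul_mpolyC [RHS]rmorphM /=.
by rewrite /LR mu_s nu_s rho_m.
Qed.

Lemma LR_size rho mu nu : sumn rho != (sumn mu + sumn nu)%N -> LR rho mu nu = 0.
Proof.
by rewrite /LR mem_parts => /negPf->; rewrite andbF.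
Qed.

Lemma schur_mpoly_nil n : schur_mpoly n [::] = 1.
Proof.
have nil0 : [::] \in parts 0 by rewrite mem_parts.
apply: (mulIf (@altX_stair_neq0 n [::] isT)); rewrite mul1r.
exact: (schur_mpolyE nil0).
Qed.

Lemma LR_nil rho nu : partn_seq nu -> LR rho [::] nu = (rho == nu)%:R.
Proof.
move=> nu_p; have nu_m : nu \in parts (sumn nu) by rewrite mem_parts nu_p eqxx.
have nil0 : [::] \in parts 0 by rewrite mem_parts.
have [rho_m|nrho] := boolP (rho \in parts (sumn nu)); last first.
  rewrite /LR add0n (negPf nrho); case: eqP nrho => // ->.
  by rewrite nu_m.
have := LR_spec nil0 nu_m (leqnn _); rewrite schur_mpoly_nil mul1r add0n.
move=> eqLR; apply/esym; move: rho rho_m; apply: (schur_mpoly_indep (leqnn _)).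
rewrite -eqLR (bigD1_seq nu) ?uniq_parts //= eqxx scale1r big1 ?addr0 // => rho /negPf->.
by rewrite scale0r.
Qed.

Section PowerSumExpression.

(** [schurp] is already a polynomial in the power sums, and no cycle is longer than $|\mu|$; the
    default value 0 in [p] is never met. *)
Lemma is_power_sum_expr_exists m mu : mu \in parts m -> exists f, @is_power_sum_expr mu f.
Proof.
move=> mu_m; have mu_s : sumn mu = m by move: mu_m; rewrite mem_parts => /andP[_ /eqP].
pose p k : {mpoly algC[sumn mu]} := if insub k.-1 is Some i then 'X_i else 0.
exists (schurp (@mpolyC _ algC) mu p) => n; rewrite {1}mu_s => le_mn.
rewrite (schurE mu_m le_mn); congr tofrac.
set t := [tuple _ | i < _].
transitivity (mmap (@mpolyC n algC) (tnth t) (schurp (@mpolyC _ algC) mu p)); last by [].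
rewrite (schurp_rmorph (iota' := @mpolyC n algC)) => [|c]; last by rewrite /= mmapC.
congr (_ * _); apply: eq_bigr => w _; congr (_ * _); apply: eq_pperm_le => k lt_k /=.
by rewrite /p /= insubT mmapX mmap1U tnth_mktuple.
Qed.

End PowerSumExpression.

Lemma schur_power_sumE m mu n : mu \in parts m -> (m <= n)%N ->
  schur_mpoly n mu =
  schur_power_sum mu \mPo [tuple power_sum n i.+1 | i < sumn mu].
Proof.
move=> mu_m le_mn; have mu_s : sumn mu = m by move: mu_m; rewrite mem_parts => /andP[_ /eqP].
have := epsilon_spec (inhabits 0) _ (is_power_sum_expr_exists mu_m).
move=> /(_ n); rewrite {1}mu_s => /(_ le_mn); rewrite (schurE mu_m le_mn) => /eqP.
by rewrite tofrac_eq => /eqP.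
Qed.

Section FiniteEvaluation.

Variables (K : comUnitRingType) (iota : {rmorphism algC -> K}).
Variables (N : nat) (y : 'I_N -> K).

Lemma mmap_schur_mpoly mu : mmap iota y (schur_mpoly N mu) = schurp iota mu (psum y).
Proof.
rewrite (schurp_rmorph (iota' := iota)) => [|c]; last by rewrite /= mmapC.
by apply: eq_schurp => k /=; rewrite mmap_psum.
Qed.

Lemma schurpM mu nu m1 m2 : mu \in parts m1 -> nu \in parts m2 -> (m1 + m2 <= N)%N ->
  schurp iota mu (psum y) * schurp iota nu (psum y) =
  \sum_(rho <- parts (m1 + m2)) iota (LR rho mu nu) * schurp iota rho (psum y).
Proof.
move=> mu_m nu_m le_n; rewrite -!mmap_schur_mpoly -rmorphM (LR_spec mu_m nu_m le_n).
by rewrite rmorph_sum; apply: eq_bigr => rho _; rewrite /= mmapZ mmap_schur_mpoly.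
Qed.

Lemma mmap_power_sum m mu : mu \in parts m -> (m <= N)%N ->
  mmap iota (fun i => psum y i.+1) (schur_power_sum mu) = schurp iota mu (psum y).
Proof.
move=> mu_m le_mN; rewrite -mmap_schur_mpoly (schur_power_sumE mu_m le_mN).
rewrite comp_mpolyEX rmorph_sum /=; apply: eq_bigr => k _.
rewrite mmapZ comp_mpolyX rmorph_prod /=; congr (_ * _); apply: eq_bigr => i _.
by rewrite rmorphXn /= tnth_mktuple mmap_psum.
Qed.

End FiniteEvaluation.

(** * Principal specializations *)

Section PolynomialFunctions.

Variable K : fieldType.

(** Polynomiality as a bare property, stable under the operations below: expressions in $c$ can then
    be compared at infinitely many points without exhibiting their polynomials. *)
Definition polyfun (f : K -> K) := exists P : {poly K}, forall c, f c = P.[c].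

Lemma polyfun_ext f g : f =1 g -> polyfun f -> polyfun g.
Proof. by move=> eq_fg [P fP]; exists P => c; rewrite -eq_fg. Qed.

Lemma polyfun_const a : polyfun (fun=> a).
Proof. by exists a%:P => c; rewrite hornerC. Qed.

Lemma polyfun_id : polyfun id.
Proof. by exists 'X => c; rewrite hornerX. Qed.

Lemma polyfunD f g : polyfun f -> polyfun g -> polyfun (fun c => f c + g c).
Proof. by move=> [P fP] [Q gQ]; exists (P + Q) => c; rewrite hornerD fP gQ. Qed.

Lemma polyfunM f g : polyfun f -> polyfun g -> polyfun (fun c => f c * g c).
Proof. by move=> [P fP] [Q gQ]; exists (P * Q) => c; rewrite hornerM fP gQ. Qed.

Lemma polyfunN f : polyfun f -> polyfun (fun c => - f c).
Proof. by move=> [P fP]; exists (- P) => c; rewrite hornerN fP. Qed.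

Lemma polyfunX f n : polyfun f -> polyfun (fun c => f c ^+ n).
Proof. by move=> [P fP]; exists (P ^+ n) => c; rewrite horner_exp fP. Qed.

Lemma polyfun_sum (I : Type) (r : seq I) (P : pred I) (f : I -> K -> K) :
  (forall i, P i -> polyfun (f i)) -> polyfun (fun c => \sum_(i <- r | P i) f i c).
Proof.
move=> f_poly; elim: r => [|i r IHr].
  by apply: polyfun_ext (polyfun_const 0) => c; rewrite big_nil.
apply: (@polyfun_ext (fun c => (if P i then f i c else 0) + \sum_(j <- r | P j) f j c)).
  by move=> c; rewrite big_cons; case: ifP => // _; rewrite add0r.
apply: polyfunD => //; case: (boolP (P i)) => [/f_poly //|_]; exact: polyfun_const.
Qed.

Lemma polyfun_prod (I : Type) (r : seq I) (P : pred I) (f : I -> K -> K) :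
  (forall i, P i -> polyfun (f i)) -> polyfun (fun c => \prod_(i <- r | P i) f i c).
Proof.
move=> f_poly; elim: r => [|i r IHr].
  by apply: polyfun_ext (polyfun_const 1) => c; rewrite big_nil.
apply: (@polyfun_ext (fun c => (if P i then f i c else 1) * \prod_(j <- r | P j) f j c)).
  by move=> c; rewrite big_cons; case: ifP => // _; rewrite mul1r.
apply: polyfunM => //; case: (boolP (P i)) => [/f_poly //|_]; exact: polyfun_const.
Qed.

Lemma polyfun_eq (a : nat -> K) N0 f g : injective a -> polyfun f -> polyfun g ->
  (forall N, (N0 <= N)%N -> f (a N) = g (a N)) -> f =1 g.
Proof.
move=> a_inj [P fP] [Q gQ] eq_fg c; rewrite fP gQ; congr _.[_].
apply/eqP; rewrite -subr_eq0; apply/eqP.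
pose rs := [seq a (N0 + i)%N | i <- iota 0 (size (P - Q))].
apply: (@roots_geq_poly_eq0 _ _ rs); last by rewrite size_map size_iota.
  apply/allP=> _ /mapP[i _ ->].
  by rewrite rootE hornerD hornerN -fP -gQ eq_fg ?leq_addr ?subrr.
by rewrite map_inj_uniq ?iota_uniq // => i j /a_inj; apply: addnI.
Qed.

Lemma polyfun_coef (a : nat -> K) n (b b' : nat -> K) : injective a ->
  (forall N, \sum_(i < n) b i * a N ^+ i = \sum_(i < n) b' i * a N ^+ i) ->
  forall i, (i < n)%N -> b i = b' i.
Proof.
move=> a_inj eq_b i lt_in.
have pE (d : nat -> K) c : \sum_(j < n) d j * c ^+ j = (\poly_(j < n) d j).[c].
  by rewrite horner_poly.
suffices : \poly_(j < n) b j = \poly_(j < n) b' j.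
  by move/(congr1 (fun P : {poly K} => P`_i)); rewrite !coef_poly lt_in.
apply/eqP; rewrite -subr_eq0; apply/eqP; set P := _ - _.
pose rs := [seq a i | i <- iota 0 (size P)].
apply: (@roots_geq_poly_eq0 _ _ rs); last by rewrite size_map size_iota.
  apply/allP=> _ /mapP[j _ ->].
  by rewrite rootE hornerD hornerN -!pE eq_b subrr.
by rewrite map_inj_uniq ?iota_uniq.
Qed.

Lemma polyfun_hsym (p : K -> nat -> K) n :
  nat_unit K -> (forall k, polyfun (fun c => p c k)) -> polyfun (fun c => hsym (p c) n).
Proof.
move=> nuK p_poly; elim/ltn_ind: n => -[|n] IHn; first exact: polyfun_const.
apply: (@polyfun_ext (fun c => n.+1%:R^-1 * \sum_(k < n.+1) p c k.+1 * hsym (p c) (n - k))).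
  by move=> c; rewrite -hsymS // mulKr.
apply: polyfunM; first exact: polyfun_const.
by apply: polyfun_sum => k _; apply: polyfunM => //; apply: IHn; rewrite ltnS leq_subr.
Qed.

Lemma polyfun_schurp (iota : {rmorphism algC -> K}) (p : K -> nat -> K) mu :
  (forall k, polyfun (fun c => p c k)) -> polyfun (fun c => schurp iota mu (p c)).
Proof.
move=> p_poly; rewrite /schurp; apply: polyfunM; first exact: polyfun_const.
apply: polyfun_sum => w _; apply: polyfunM; first exact: polyfun_const.
by apply: polyfun_prod.
Qed.

End PolynomialFunctions.

#[global] Opaque schurp.

(** Staircase exponents fall where those of [Vandermonde] rise; reversing the columns costs a
    sign. *)
Lemma altE_Vandermonde (K : comUnitRingType) N (y : 'I_N -> K) :
  exists b : bool, alt y (stair N [::]) =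
    (-1) ^+ b * \prod_(i < N) \prod_(j < N | (i < j)%N) (y j - y i).
Proof.
pose V := Vandermonde N (\row_j y j).
exists (odd_perm (perm (@rev_ord_inj N))).
have -> : \prod_(i < N) \prod_(j < N | (i < j)%N) (y j - y i) = \det V.
  by rewrite det_Vandermonde; apply: eq_bigr => i _; apply: eq_bigr => j _; rewrite !mxE.
rewrite /alt (_ : \matrix_(i, j) _ = col_perm (perm (@rev_ord_inj N)) V^T).
  by rewrite col_permE det_mulmx det_tr det_perm odd_permV mulrC.
by apply/matrixP=> i j; rewrite !mxE permE mnmE nth_nil.
Qed.

Lemma alt_delta_neq0 (K : fieldType) N (y : 'I_N -> K) : injective y ->
  alt y (stair N [::]) != 0.
Proof.
move=> y_inj; have [b ->] := altE_Vandermonde y.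
rewrite mulf_neq0 ?signr_eq0 //; apply/prodf_neq0 => i _; apply/prodf_neq0 => j lt_ij.
by rewrite subr_eq0; apply: contraTneq lt_ij => /y_inj->; rewrite ltnn.
Qed.

Section PrincipalSpecialization.

Variables (K : fieldType) (nuK : nat_unit K) (iota : {rmorphism algC -> K}).

Local Notation S := (schurp iota).

(** Makes the denominators of [alph] nonzero and the values $c=s^{2N}$ pairwise distinct. *)
Definition nonroot (s : K) := s != 0 /\ forall n, s ^+ n.+1 != 1.

(* For |s| < 1 the power sums of s^(2 i + 1), i >= 0, minus those of
   c s^(2 i + 1); the letters are s, s^3, .., s^(2 N - 1) when c = s^(2 N). *)
Definition alph (s c : K) (k : nat) : K := (c ^+ k - 1) / (s ^+ k - s ^- k).

Definition geom (s : K) N (i : 'I_N) : K := s ^+ i.*2.+1.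

Lemma nonroot_inj s : nonroot s -> injective (fun n => s ^+ n).
Proof.
move=> [s0 s1] i j /=; wlog le_ij : i j / (i <= j)%N => [gen eq_s|].
  by case/orP: (leq_total i j) => le; [|apply/esym]; apply: gen.
rewrite -(subnKC le_ij) exprD -{1}[s ^+ i]mulr1 => /(mulfI (expf_neq0 i s0))/esym/eqP.
by case: (j - i)%N => [|k]; rewrite ?addn0 // (negPf (s1 k)).
Qed.

Lemma nonrootV s : nonroot s -> nonroot s^-1.
Proof.
move=> [s0 s1]; split=> [|n]; first by rewrite invr_eq0.
by rewrite exprVn invr_eq1.
Qed.

Lemma alph_den_neq0 s k : nonroot s -> s ^+ k.+1 - s ^- k.+1 != 0.
Proof.
move=> [s0 s1]; rewrite subr_eq0; apply/eqP=> eq_s; have := s1 (k + k.+1)%N.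
by rewrite -addSn exprD {2}eq_s divff ?eqxx // expf_neq0.
Qed.

(** A finite geometric series, which gives [alph] actual letters at special values of [c]. Index 0
    is excluded: there [alph] is junk. *)
Lemma psum_geom s N k : nonroot s -> psum (geom s (N := N)) k.+1 = alph s (s ^+ N.*2) k.+1.
Proof.
move=> s_nr; apply: canRL (mulfK (alph_den_neq0 k s_nr)) _.
have s0 : s ^+ k.+1 != 0 by rewrite expf_neq0 //; case: s_nr.
have powE e : (s ^+ e) ^+ k.+1 = (s ^+ k.+1) ^+ e by rewrite exprAC.
rewrite /psum /geom; under eq_bigr do rewrite powE.
rewrite powE; move: (s ^+ k.+1) s0 => a a0; elim: N => [|N IHN].
  by rewrite big_ord0 mul0r expr0 subrr.
rewrite big_ord_recr /= mulrDl IHN doubleS !exprS.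
by field.
Qed.

Lemma geom_inj s N : nonroot s -> injective (geom s (N := N)).
Proof.
move=> s_nr i j /(nonroot_inj s_nr) [] /eqP; rewrite -!muln2 eqn_pmul2r // => /eqP.
exact: val_inj.
Qed.

Lemma nonroot_dbl_inj s : nonroot s -> injective (fun N : nat => s ^+ N.*2).
Proof.
by move=> s_nr i j /(nonroot_inj s_nr) /eqP; rewrite -!muln2 eqn_pmul2r // => /eqP.
Qed.

Lemma polyfun_alph s k : polyfun (fun c => alph s c k).
Proof.
apply: polyfunM; last exact: polyfun_const.
apply: polyfunD; last exact: polyfun_const.
exact/polyfunX/polyfun_id.
Qed.

Lemma alph_scale s c k : c != 0 -> alph s c k = c ^+ k * alph s^-1 c^-1 k.
Proof.
move=> c0; rewrite /alph !exprVn invrK -[s ^- k - _]opprB invrN mulrA mulrBr mulr1.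
by rewrite mulfV ?expf_neq0 // mulrN -mulNr opprB.
Qed.

Section Finite.

Variables (N : nat) (y : 'I_N -> K).

Lemma cauchy_psum (I : finType) (x : I -> K) m : (m <= N)%N -> injective y ->
  \sum_(mu <- parts m) S mu (psum x) * S mu (psum y) =
  hsym (fun k => psum x k * psum y k) m.
Proof.
move=> le_mN y_inj; apply: (mulIf (alt_delta_neq0 y_inj)).
rewrite (cauchy_alt nuK iota) // mulr_suml !big_seq; apply: eq_bigr => mu mu_m.
by rewrite -mulrA (schurp_alt iota y mu_m le_mN).
Qed.

(** Both sides are polynomials in [c], and $c=s^{2M}$ gives the identity for two finite alphabets;
    [cauchy_alph] repeats the argument for the other alphabet. *)
Lemma cauchy_alph_psum s c m : nonroot s -> (m <= N)%N -> injective y ->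
  \sum_(mu <- parts m) S mu (alph s c) * S mu (psum y) =
  hsym (fun k => alph s c k * psum y k) m.
Proof.
move=> s_nr le_mN y_inj; move: c; apply: (polyfun_eq (N0 := 0) (nonroot_dbl_inj s_nr)) => [||M _].
- apply: polyfun_sum => mu _; apply: polyfunM; last exact: polyfun_const.
  by apply: polyfun_schurp => k; apply: polyfun_alph.
- apply: polyfun_hsym => // k; apply: polyfunM; last exact: polyfun_const.
  exact: polyfun_alph.
rewrite -(eq_hsym nuK (p := fun k => psum (geom s (N := M)) k * psum y k)); last first.
  by move=> k; rewrite psum_geom.
rewrite -cauchy_psum //; apply: eq_bigr => mu _; congr (_ * _).
by apply: eq_schurp => k; rewrite psum_geom.
Qed.

End Finite.

Lemma cauchy_alph s s' c c' m : nonroot s -> nonroot s' ->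
  \sum_(mu <- parts m) S mu (alph s c) * S mu (alph s' c') =
  hsym (fun k => alph s c k * alph s' c' k) m.
Proof.
move=> s_nr s'_nr; move: c'; apply: (polyfun_eq (N0 := m) (nonroot_dbl_inj s'_nr)) => [||N le_mN].
- apply: polyfun_sum => mu _; apply: polyfunM; first exact: polyfun_const.
  by apply: polyfun_schurp => k; apply: polyfun_alph.
- apply: polyfun_hsym => // k; apply: polyfunM; first exact: polyfun_const.
  exact: polyfun_alph.
rewrite -(eq_hsym nuK (p := fun k => alph s c k * psum (geom s' (N := N)) k)); last first.
  by move=> k; rewrite psum_geom.
rewrite -cauchy_alph_psum //; last exact: geom_inj.
by apply: eq_bigr => mu _; congr (_ * _); apply: eq_schurp => k; rewrite psum_geom.
Qed.

Lemma schurpM_alph s c mu nu m1 m2 : nonroot s -> mu \in parts m1 -> nu \in parts m2 ->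
  S mu (alph s c) * S nu (alph s c) =
  \sum_(rho <- parts (m1 + m2)) iota (LR rho mu nu) * S rho (alph s c).
Proof.
move=> s_nr mu_m nu_m; move: c.
have S_poly la : polyfun (fun c => S la (alph s c)).
  by apply: polyfun_schurp => k; apply: polyfun_alph.
apply: (polyfun_eq (N0 := (m1 + m2)%N) (nonroot_dbl_inj s_nr)) => [||N le_N].
- exact: polyfunM.
- by apply: polyfun_sum => rho _; apply: polyfunM => //; apply: polyfun_const.
have SE la : S la (alph s (s ^+ N.*2)) = S la (psum (geom s (N := N))).
  by apply: eq_schurp => k; rewrite psum_geom.
rewrite !SE (schurpM iota _ mu_m nu_m le_N).
by apply: eq_bigr => rho _; rewrite SE.
Qed.

(** Ties the polynomial chosen in [schur_power_sum] to [schurp], through alphabets with at least [m]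
    letters, where its specification applies. *)
Lemma mmap_alph s c m mu : nonroot s -> mu \in parts m ->
  mmap iota (fun i : 'I_(sumn mu) => alph s c i.+1) (schur_power_sum mu) = S mu (alph s c).
Proof.
move=> s_nr mu_m; move: c; apply: (polyfun_eq (N0 := m) (nonroot_dbl_inj s_nr)) => [||N le_N].
- apply: polyfun_sum => k _; apply: polyfunM; first exact: polyfun_const.
  by apply: polyfun_prod => i _; apply/polyfunX/polyfun_alph.
- by apply: polyfun_schurp => k; apply: polyfun_alph.
transitivity (S mu (psum (geom s (N := N)))); last by apply: eq_schurp => k; rewrite psum_geom.
rewrite -(mmap_power_sum iota (geom s (N := N)) mu_m le_N).
apply: eq_bigr => k _; congr (_ * _); apply: eq_bigr => i _.
by rewrite psum_geom.
Qed.

Lemma mcoeff_alt N (l k : 'X_{1..N}) :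
  (alt (fun i : 'I_N => 'X_i : {mpoly K[N]}) l)@_k = iota (altX l)@_k.
Proof.
rewrite mcoeff_altX rmorph_sum raddf_sum /=; apply: eq_bigr => s _.
rewrite -(rmorph_sign (@mpolyC N K)) mcoeffCM rmorphM rmorph_sign; congr (_ * _).
rewrite (_ : \prod_i _ = 'X_[[multinom l (s i) | i < N]]).
  by rewrite mcoeffX rmorph_nat.
by rewrite mpolyXE_id; apply: eq_bigr => i _; rewrite !mxE mnmE.
Qed.

Lemma alt_delta_neq0_mpoly N : alt (fun i : 'I_N => 'X_i : {mpoly K[N]}) (stair N [::]) != 0.
Proof.
apply/eqP=> /(congr1 (mcoeff (stair N [::]))); rewrite mcoeff_alt mcoeff0.
have nil0 : [::] \in parts 0 by rewrite mem_parts.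
by rewrite (mcoeff_altX_stair nil0 nil0) // eqxx rmorph1 => /eqP; rewrite oner_eq0.
Qed.

End PrincipalSpecialization.

(** * Schur functions of a sum of two alphabets *)

Section Coproduct.

Variables (K : fieldType) (nuK : nat_unit K) (iota : {rmorphism algC -> K}).
Variables (R : idomainType) (nuR : nat_unit R) (cst : {rmorphism K -> R}).
Variables (m : nat) (Y : 'I_m -> R).

Local Notation iotaR := (cst \o iota : {rmorphism algC -> R}).
Local Notation S := (schurp iota).
Local Notation SR := (schurp iotaR).

Hypothesis alt0 : alt Y (stair m [::]) != 0.

(** The auxiliary letters [Y] must separate the Schur functions of degree [m]; they will be the
    variables of a polynomial ring over [K]. *)
Hypothesis alt_indep : forall c c' : seq nat -> K,
  \sum_(rho <- parts m) cst (c rho) * alt Y (stair m rho) =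
  \sum_(rho <- parts m) cst (c' rho) * alt Y (stair m rho) -> {in parts m, c =1 c'}.

Let cauchy_cst (L : finType) (z : L -> K) i : (i <= m)%N ->
  hsym (fun k => cst (psum z k) * psum Y k) i =
  \sum_(la <- parts i) cst (S la (psum z)) * SR la (psum Y).
Proof.
move=> le_im; apply: (mulIf alt0).
have psum_cst k : psum (cst \o z) k = cst (psum z k).
  by rewrite rmorph_sum; apply: eq_bigr => l _; rewrite rmorphXn.
rewrite -(eq_hsym nuR (p := fun k => psum (cst \o z) k * psum Y k)); last first.
  by move=> k; rewrite psum_cst.
rewrite (cauchy_alt nuR iotaR Y) // mulr_suml !big_seq; apply: eq_bigr => la la_i.
rewrite -mulrA (schurp_alt iotaR Y la_i le_im); congr (_ * _).
rewrite (schurp_rmorph (iota' := iotaR)) //; apply: eq_schurp => k.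
exact: psum_cst.
Qed.

(** Expand the Cauchy kernel of $x+y$ against [Y] in two ways: directly, and as the product of two
    kernels, where [LR] multiplies Schur functions of [Y]. *)
Lemma schurpD_psum_aux (I J : finType) (x : I -> K) (y : J -> K) :
  {in parts m, forall rho, S rho (fun k => psum x k + psum y k) =
  \sum_(i < m.+1) \sum_(la <- parts i) \sum_(tau <- parts (m - i))
     iota (LR rho la tau) * (S la (psum x) * S tau (psum y))}.
Proof.
pose xy (ij : I + J) := match ij with inl i => x i | inr j => y j end.
have psum_xy k : psum xy k = psum x k + psum y k by rewrite /psum big_sumType.
apply: alt_indep.
transitivity (hsym (fun k => cst (psum xy k) * psum Y k) m * alt Y (stair m [::])).
  rewrite cauchy_cst // mulr_suml !big_seq; apply: eq_bigr => rho rho_m.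
  rewrite -mulrA (schurp_alt iotaR Y rho_m (leqnn _)); congr (cst _ * _).
  by apply: eq_schurp => k; rewrite psum_xy.
rewrite (eq_hsym nuR (p' := fun k => cst (psum x k) * psum Y k + cst (psum y k) * psum Y k));
  last first.
  by move=> k; rewrite psum_xy rmorphD mulrDl.
rewrite hsym_add // mulr_suml.
under [RHS]eq_bigr do rewrite rmorph_sum mulr_suml.
rewrite exchange_big; apply: eq_bigr => i _ /=.
have le_im : (i <= m)%N by rewrite -ltnS.
rewrite !cauchy_cst ?leq_subr // big_distrlr /= mulr_suml.
under [RHS]eq_bigr do rewrite rmorph_sum mulr_suml.
rewrite exchange_big /= [LHS]big_seq [RHS]big_seq; apply: eq_bigr => la la_i.
under [RHS]eq_bigr do rewrite rmorph_sum mulr_suml.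
rewrite exchange_big big_distrl /= [LHS]big_seq [RHS]big_seq; apply: eq_bigr => tau tau_i.
rewrite mulrACA (schurpM iotaR Y la_i tau_i) ?subnKC // -(mulrA (_ * _)) mulr_suml mulr_sumr.
rewrite [LHS]big_seq [RHS]big_seq; apply: eq_bigr => rho rho_m.
rewrite -(schurp_alt iotaR Y rho_m (leqnn _)) (rmorphM cst (iota (LR rho la tau))).
by rewrite (rmorphM cst (S la (psum x)) (S tau (psum y))) /=; ring.
Qed.

End Coproduct.

Lemma schurpD_psum (K : fieldType) (iota : {rmorphism algC -> K}) (I J : finType)
    (x : I -> K) (y : J -> K) m rho : nat_unit K -> rho \in parts m ->
  schurp iota rho (fun k => psum x k + psum y k) =
  \sum_(i < m.+1) \sum_(la <- parts i) \sum_(tau <- parts (m - i))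
     iota (LR rho la tau) * (schurp iota la (psum x) * schurp iota tau (psum y)).
Proof.
move=> nuK; move: rho; apply: (@schurpD_psum_aux _ _ {mpoly K[m]} _ (@mpolyC m K) m (fun i =>
  'X_i)).
- exact: nat_unit_mpoly.
- exact: alt_delta_neq0_mpoly iota m.
move=> c c' eq_c rho rho_m.
have term_coef (a : K) r : r \in parts m ->
    (a%:MP * alt (fun i : 'I_m => 'X_i : {mpoly K[m]}) (stair m r))@_(stair m rho) =
    a * (r == rho)%:R.
  move=> r_m; rewrite mcoeffCM (mcoeff_alt iota) (mcoeff_altX_stair r_m rho_m) //.
  by rewrite rmorph_nat.
have coefE (b : seq nat -> K) :
    (\sum_(r <- parts m) (b r)%:MP * alt (fun i : 'I_m =>
      'X_i : {mpoly K[m]}) (stair m r))@_(stair m rho) = b rho.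
  move: term_coef; move: (alt _) => A term_coef.
  rewrite raddf_sum (bigD1_seq rho rho_m (uniq_parts m)) /= term_coef // eqxx mulr1.
  rewrite big_seq_cond big1 ?addr0 // => r /andP[r_m /negPf ne_r].
  by rewrite term_coef // ne_r mulr0.
by rewrite -[LHS]coefE -[RHS]coefE; congr (mcoeff _ _); apply: eq_c.
Qed.

Section CoproductAlph.

Variables (K : fieldType) (nuK : nat_unit K) (iota : {rmorphism algC -> K}).

Local Notation S := (schurp iota).

(** The alphabet [alph s c] is [alph s^-1 0] scaled by $c$ plus [alph s 0], and homogeneity yields
    $c^i$ for [la] of size [i]. *)
Lemma schurp_coproduct s c m rho : nonroot s -> rho \in parts m ->
  S rho (alph s c) =
  \sum_(i < m.+1) c ^+ i * \sum_(la <- parts i) \sum_(tau <- parts (m - i))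
     iota (LR rho la tau) * (S la (alph s^-1 0) * S tau (alph s 0)).
Proof.
move=> s_nr rho_m.
have s'_nr := nonrootV s_nr.
(* The parameters [d] and [e] are freed to reach values where both alphabets are finite; the claim
   is the case where both are 0. *)
have step1 d e : S rho (fun k => c ^+ k * alph s^-1 d k + alph s e k) =
   \sum_(i < m.+1) c ^+ i * \sum_(la <- parts i) \sum_(tau <- parts (m - i))
     iota (LR rho la tau) * (S la (alph s^-1 d) * S tau (alph s e)).
  move: d; apply: (polyfun_eq (N0 := 0) (nonroot_dbl_inj s'_nr)) => [||M _].
  - apply: polyfun_schurp => k; apply: polyfunD; last exact: polyfun_const.
    by apply: polyfunM; [exact: polyfun_const|exact: polyfun_alph].
  - apply: polyfun_sum => i _; apply: polyfunM; first exact: polyfun_const.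
    apply: polyfun_sum => la _; apply: polyfun_sum => tau _.
    apply: polyfunM; first exact: polyfun_const.
    apply: polyfunM; last exact: polyfun_const.
    by apply: polyfun_schurp => k; apply: polyfun_alph.
  move: e; apply: (polyfun_eq (N0 := 0) (nonroot_dbl_inj s_nr)) => [||N _].
  - apply: polyfun_schurp => k; apply: polyfunD; first exact: polyfun_const.
    exact: polyfun_alph.
  - apply: polyfun_sum => i _; apply: polyfunM; first exact: polyfun_const.
    apply: polyfun_sum => la _; apply: polyfun_sum => tau _.
    apply: polyfunM; first exact: polyfun_const.
    apply: polyfunM; first exact: polyfun_const.
    by apply: polyfun_schurp => k; apply: polyfun_alph.
  pose x (i : 'I_M) := c * geom s^-1 i.
  have psum_x k : psum x k.+1 = c ^+ k.+1 * alph s^-1 (s^-1 ^+ M.*2) k.+1.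
    rewrite -psum_geom // /psum mulr_sumr; apply: eq_bigr => i _.
    by rewrite exprMn.
  rewrite (@eq_schurp _ _ _ _ (fun k => psum x k + psum (geom s (N := N)) k)); last first.
    by move=> k; rewrite psum_x psum_geom.
  rewrite (schurpD_psum iota _ _ nuK rho_m); apply: eq_bigr => i _.
  rewrite mulr_sumr [LHS]big_seq [RHS]big_seq; apply: eq_bigr => la.
  rewrite mem_parts => /andP[_ /eqP la_i]; rewrite mulr_sumr; apply: eq_bigr => tau _.
  have -> : S la (psum x) = c ^+ i * S la (alph s^-1 (s^-1 ^+ M.*2)).
    by rewrite -la_i -schurp_scale; apply: eq_schurp => k; rewrite psum_x.
  have -> : S tau (psum (geom s (N := N))) = S tau (alph s (s ^+ N.*2)).
    by apply: eq_schurp => k; rewrite psum_geom.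
  by ring.
rewrite -step1; apply: eq_schurp => k.
have den' : s^-1 ^+ k.+1 - s^-1 ^- k.+1 = - (s ^+ k.+1 - s ^- k.+1).
  by rewrite exprVn invrK opprB.
by rewrite /alph den' invrN expr0n /= !sub0r; ring.
Qed.

End CoproductAlph.

(** * The content formula at principal specializations *)

Section ContentFormula.

Variables (K : fieldType) (nuK : nat_unit K) (iota : {rmorphism algC -> K}).
Variables (s : K) (s_nr : nonroot s).

Local Notation S := (schurp iota).

Let s0 : s != 0. Proof. by case: s_nr. Qed.

Definition vdm N (l : 'I_N -> nat) : K :=
  \prod_(i < N) \prod_(j < N | (i < j)%N) (s ^+ (l j).*2 - s ^+ (l i).*2).

(** The Pochhammer symbol $(q;q)_n$ for $q=s^2$. *)
Definition qfact n : K := \prod_(t < n) (1 - s ^+ t.+1.*2).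

Lemma expr_dbl_neq1 n : 1 - s ^+ n.+1.*2 != 0.
Proof.
rewrite subr_eq0 eq_sym; apply/eqP => eq1; have [_ /(_ n.*2.+1)] := s_nr.
by rewrite -doubleS eq1 eqxx.
Qed.

Lemma qfact_neq0 n : qfact n != 0.
Proof. by apply/prodf_neq0 => t _; apply: expr_dbl_neq1. Qed.

(** At letters in geometric progression, letters and exponents exchange roles: the matrix is a
    Vandermonde matrix in the $s^{2l_j}$. *)
Lemma alt_geom N (l : 'X_{1..N}) : alt (geom s (N := N)) l = s ^+ mdeg l * vdm l.
Proof.
have -> : vdm l = \det (Vandermonde N (\row_j s ^+ (l j).*2)).
  by rewrite det_Vandermonde; apply: eq_bigr => i _; apply: eq_bigr => j _; rewrite !mxE.
have -> : s ^+ mdeg l = \det (diag_mx (\row_j s ^+ l j)).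
  by rewrite det_diag mdegE -prodrXr; apply: eq_bigr => j _; rewrite mxE.
rewrite mulrC -det_mulmx /alt; congr (\det _); apply/matrixP=> i j.
rewrite mul_mx_diag !mxE /geom -!exprM -exprD; congr (_ ^+ _).
by rewrite -!muln2; lia.
Qed.

Lemma vdm_neq0 N mu : sorted geq mu -> vdm (stair N mu) != 0.
Proof.
move=> mu_s; apply/prodf_neq0 => i _; apply/prodf_neq0 => j lt_ij.
rewrite subr_eq0; apply/eqP => /(nonroot_inj s_nr) /eqP; rewrite -!muln2 eqn_pmul2r //.
by rewrite (inj_eq (stair_inj_ord mu_s)) => /eqP eq_ij; rewrite eq_ij ltnn in lt_ij.
Qed.

Section Stability.

Variables (N : nat).

Let shift (mu : seq nat) := \prod_(i < N) (1 - s ^+ (stair N mu i).+1.*2).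

Let stairS mu (i : 'I_N) : stair N.+1 mu (widen_ord (leqnSn N) i) = (stair N mu i).+1.
Proof. by rewrite !mnmE /=; have := ltn_ord i; lia. Qed.

Let stair_last mu : (size mu <= N)%N -> stair N.+1 mu ord_max = 0%N.
Proof. by move=> le_mu; rewrite mnmE /= subnn nth_default. Qed.

Let shift_neq0 mu : shift mu != 0.
Proof. by apply/prodf_neq0 => i _; apply: expr_dbl_neq1. Qed.

Lemma vdmS mu : (size mu <= N)%N ->
  vdm (stair N.+1 mu) =
  (\prod_(i < N) \prod_(j < N | (i < j)%N) s ^+ 2) * vdm (stair N mu) * shift mu.
Proof.
move=> le_mu; rewrite /vdm big_ord_recr /= [X in _ * X]big1 ?mulr1; last first.
  by move=> j; have := ltn_ord j; rewrite ltnS => le_j; rewrite ltnNge le_j.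
rewrite -!big_split /=; apply: eq_bigr => i _.
rewrite big_mkcond big_ord_recr /= ltn_ord stair_last // stairS -big_split /=.
congr (_ * _); rewrite [RHS]big_mkcond; apply: eq_bigr => j _.
case: ifP => // _; rewrite !stairS !doubleS !exprS.
by ring.
Qed.

Lemma qfactS mu : (size mu <= N)%N ->
  \prod_(i < N.+1) qfact (stair N.+1 mu i) = (\prod_(i < N) qfact (stair N mu i)) * shift mu.
Proof.
move=> le_mu; rewrite big_ord_recr /= stair_last // [qfact 0]big_ord0 mulr1 -big_split.
by apply: eq_bigr => i _; rewrite stairS /qfact big_ord_recr.
Qed.

(** A new variable adds 1 to every exponent and appends the exponent 0, which multiplies both
    products by [shift mu], up to a factor free of [mu]. The stable quotient is the inverse hook
    product up to a power of $q$. *)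
Lemma vdm_qfactS mu : (size mu <= N)%N ->
  vdm (stair N.+1 mu) / vdm (stair N.+1 [::]) /
    (\prod_(i < N.+1) qfact (stair N.+1 mu i) / \prod_(i < N.+1) qfact (stair N.+1 [::] i)) =
  vdm (stair N mu) / vdm (stair N [::]) /
    (\prod_(i < N) qfact (stair N mu i) / \prod_(i < N) qfact (stair N [::] i)).
Proof.
move=> le_mu; rewrite !vdmS // !qfactS //.
have a0 : \prod_(i < N) \prod_(j < N | (i < j)%N) s ^+ 2 != 0.
  by apply/prodf_neq0 => i _; apply/prodf_neq0 => j _; rewrite expf_neq0.
have b0 : vdm (stair N [::]) != 0 by apply: vdm_neq0.
have q0 la : \prod_(i < N) qfact (stair N la i) != 0.
  by apply/prodf_neq0 => i _; apply: qfact_neq0.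
by field; rewrite a0 b0 !q0 !shift_neq0.
Qed.

End Stability.

Definition boxes (mu : seq nat) : seq (nat * nat) :=
  [seq (i, j) | i <- seq.iota 0 (size mu), j <- seq.iota 0 (nth 0%N mu i)].

(* q^(content) for q = s^2. *)
Definition ct (x : nat * nat) : K := s ^+ x.2.*2 / s ^+ x.1.*2.

Lemma big_boxes (R : Type) (idx : R) (op : Monoid.com_law idx) mu (F : nat * nat -> R) :
  \big[op/idx]_(x <- boxes mu) F x =
  \big[op/idx]_(i < size mu) \big[op/idx]_(j < nth 0%N mu i) F (i : nat, j : nat).
Proof.
have iotaE n : seq.iota 0 n = index_iota 0 n by rewrite /index_iota subn0.
rewrite /boxes big_allpairs_dep iotaE big_mkord.
by apply: eq_bigr => i _; rewrite iotaE big_mkord.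
Qed.

Lemma size_boxes mu : size (boxes mu) = sumn mu.
Proof.
rewrite -sum1_size big_boxes sumnE (big_nth 0%N) big_mkord.
by apply: eq_bigr => i _; rewrite sum1_card card_ord.
Qed.

(** The surviving factors of row [i] are $1-q^{N-i+j}$, and $j-i$ is the content. *)
Lemma prod_qfact mu N : (size mu <= N)%N ->
  \prod_(i < N) qfact (stair N mu i) / \prod_(i < N) qfact (stair N [::] i) =
  \prod_(x <- boxes mu) (1 - s ^+ N.*2 * ct x).
Proof.
move=> le_mu; rewrite big_boxes -prodf_div.
rewrite (big_ord_widen N (fun i =>
  \prod_(j < nth 0%N mu i) (1 - s ^+ N.*2 * ct (i, j : nat)))) //.
rewrite [RHS]big_mkcond; apply: eq_bigr => i _.
apply: canLR (mulfK (qfact_neq0 _)) _; rewrite !mnmE nth_nil add0n /qfact.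
set d := (N - i.+1)%N; rewrite addnC.
have -> : \prod_(t < d + nth 0%N mu i) (1 - s ^+ t.+1.*2) =
   \prod_(t < d) (1 - s ^+ t.+1.*2) * \prod_(j < nth 0%N mu i) (1 - s ^+ (d + j).+1.*2).
  by rewrite big_split_ord.
rewrite mulrC; congr (_ * _); case: ltnP => [_|le_i]; last by rewrite nth_default ?big_ord0.
apply: eq_bigr => j _; congr (1 - _); rewrite /ct /= mulrA; apply: canRL (mulfK _) _.
  by rewrite expf_neq0.
by rewrite -!exprD; congr (_ ^+ _); rewrite /d -!muln2; have := ltn_ord i; lia.
Qed.

Lemma schurp_geom m mu N : mu \in parts m -> (m <= N)%N ->
  S mu (psum (geom s (N := N))) = s ^+ m * (vdm (stair N mu) / vdm (stair N [::])).
Proof.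
move=> mu_m le_mN; have nz : alt (geom s (N := N)) (stair N [::]) != 0.
  exact/alt_delta_neq0/geom_inj.
apply: (mulIf nz); rewrite (schurp_alt iota _ mu_m le_mN) !alt_geom.
rewrite (mdeg_stair_part le_mN mu_m) exprD; field; exact: vdm_neq0.
Qed.

(** At $c=s^{2N}$ this is the hook-content formula; the factor [C] independent of [N] is recognized
    by putting $c=0$. *)
Lemma schurp_content mu m c : mu \in parts m ->
  S mu (alph s c) = S mu (alph s 0) * \prod_(x <- boxes mu) (1 - c * ct x).
Proof.
move=> mu_m.
have le_size N : (m <= N)%N -> (size mu <= N)%N by move=> le_N; apply: size_parts_leq mu_m le_N.
pose C := s ^+ m * (vdm (stair m mu) / vdm (stair m [::]) /
    (\prod_(i < m) qfact (stair m mu i) / \prod_(i < m) qfact (stair m [::] i))).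
suffices SE d : S mu (alph s d) = C * \prod_(x <- boxes mu) (1 - d * ct x).
  by rewrite !SE [in RHS]big1 ?mulr1 // => x _; rewrite mul0r subr0.
move: d; apply: (polyfun_eq (N0 := m) (nonroot_dbl_inj s_nr)) => [||N le_mN].
- by apply: polyfun_schurp => k; apply: polyfun_alph.
- apply: polyfunM; first exact: polyfun_const.
  apply: polyfun_prod => x _; apply: polyfunD; first exact: polyfun_const.
  by apply/polyfunN/polyfunM; [exact: polyfun_id|exact: polyfun_const].
rewrite -prod_qfact ?le_size //.
transitivity (S mu (psum (geom s (N := N)))); first by apply: eq_schurp => k; rewrite psum_geom.
rewrite (schurp_geom mu_m le_mN) /C -[RHS]mulrA; congr (_ * _).
pose Q := \prod_(i < N) qfact (stair N mu i) / \prod_(i < N) qfact (stair N [::] i); rewrite -/Q.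
have Q0 : Q != 0 by rewrite mulf_neq0 ?invr_eq0 //; apply/prodf_neq0 => i _; apply: qfact_neq0.
suffices -> : vdm (stair m mu) / vdm (stair m [::]) /
    (\prod_(i < m) qfact (stair m mu i) / \prod_(i < m) qfact (stair m [::] i)) =
    vdm (stair N mu) / vdm (stair N [::]) / Q by rewrite divfK.
rewrite /Q {Q Q0}; elim: N le_mN => [|N IHN]; first by rewrite leqn0 => /eqP->.
rewrite leq_eqVlt => /orP[/eqP<- //|]; rewrite ltnS => le_mN.
by rewrite IHN // vdm_qfactS // le_size.
Qed.

Lemma schurp_alph0_neq0 m mu : mu \in parts m -> S mu (alph s 0) != 0.
Proof.
move=> mu_m; have mu_s : sorted geq mu by move: mu_m; rewrite mem_parts => /andP[/andP[]].
have : S mu (psum (geom s (N := m))) != 0.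
  rewrite (schurp_geom mu_m (leqnn m)) !mulf_neq0 ?invr_eq0 ?expf_neq0 //; exact: vdm_neq0.
rewrite (@eq_schurp _ _ _ _ (alph s (s ^+ m.*2))) => [|k]; last by rewrite psum_geom.
by rewrite (schurp_content _ mu_m) mulf_eq0 negb_or => /andP[].
Qed.

(** By [alph_scale], passing from [s] to its inverse reverses each factor $1-c\,q^{j-i}$ into
    $c-q^{j-i}$; then put $c=0$. *)
Lemma schurp_alphV0 m mu : mu \in parts m ->
  S mu (alph s^-1 0) = (-1) ^+ m * \prod_(x <- boxes mu) ct x * S mu (alph s 0).
Proof.
move=> mu_m; have mu_sum : sumn mu = m by move: mu_m; rewrite mem_parts => /andP[_ /eqP].
have SE : (fun c => S mu (alph s^-1 c)) =1
    (fun c => S mu (alph s 0) * \prod_(x <- boxes mu) (c - ct x)).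
  apply: (polyfun_eq (N0 := 0) (nonroot_dbl_inj s_nr)) => [||N _].
  - by apply: polyfun_schurp => k; apply: polyfun_alph.
  - apply: polyfunM; first exact: polyfun_const.
    apply: polyfun_prod => x _; apply: polyfunD; first exact: polyfun_id.
    exact: polyfun_const.
  move: (s ^+ N.*2) (expf_neq0 N.*2 s0) => c c0.
  transitivity (S mu (fun k => c ^+ k * alph s c^-1 k)).
    by apply: eq_schurp => k; rewrite (alph_scale _ _ c0) invrK.
  rewrite schurp_scale mu_sum (schurp_content _ mu_m) mulrCA; congr (_ * _).
  rewrite -mu_sum -size_boxes -[X in c ^+ X]sum1_size -prodrXr -big_split.
  by apply: eq_bigr => x _ /=; rewrite expr1; field.
rewrite [LHS](SE 0) mulrC; congr (_ * _).
rewrite (eq_bigr (fun x => (-1) ^+ 1 * ct x)) => [|x _]; last by rewrite sub0r mulN1r.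
by rewrite big_split prodrXr sum1_size size_boxes mu_sum.
Qed.

Lemma schurp_closed_form m mu N : mu \in parts m -> (m <= N)%N ->
  S mu (alph s 0) * (alt (geom s (N := N)) (stair N [::]) / \prod_(i < N) qfact (stair N [::]
    i)) =
  alt (geom s (N := N)) (stair N mu) / \prod_(i < N) qfact (stair N mu i).
Proof.
move=> mu_m le_mN; have q0 la : \prod_(i < N) qfact (stair N la i) != 0.
  by apply/prodf_neq0 => i _; apply: qfact_neq0.
rewrite -(schurp_alt iota _ mu_m le_mN).
rewrite [S mu (psum _)](@eq_schurp _ _ _ _ (alph s (s ^+ N.*2))) => [|k];
  last by rewrite psum_geom.
rewrite (schurp_content (s ^+ N.*2) mu_m) -prod_qfact ?(size_parts_leq mu_m le_mN) //.
by field; rewrite !q0.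
Qed.

End ContentFormula.

(** * Sums weighted by quadratic exponents *)

Section MonomialFunctional.

Variables (K : fieldType) (iota : {rmorphism algC -> K}) (N : nat).
Variable w : 'I_N -> nat -> K.

(* The linear functional sending x^m to prod_i w i (m i). *)
Definition mfun (P : {mpoly algC[N]}) : K :=
  \sum_(m <- msupp P) iota P@_m * \prod_i w i (m i).

Lemma mfunwE P b : (msize P <= b)%N ->
  mfun P = \sum_(m : 'X_{1..N < b}) iota P@_m * \prod_i w i (m i).
Proof.
move=> le_P; set I : subFinType _ := 'X_{1..N < b}; rewrite /mfun (big_mksub I) ?msupp_uniq //=;
  first last.
  by move=> m /msize_mdeg_lt /leq_trans; apply.
rewrite big_rmcond //= => m /memN_msupp_eq0 ->; by rewrite rmorph0 mul0r.
Qed.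

Lemma mfunD P Q : mfun (P + Q) = mfun P + mfun Q.
Proof.
pose b := maxn (msize P) (msize Q).
rewrite !(@mfunwE _ b) ?leq_maxl ?leq_maxr ?msizeD_le // -big_split.
by apply: eq_bigr => m _; rewrite mcoeffD rmorphD mulrDl.
Qed.

Lemma mfun0 : mfun 0 = 0.
Proof. by rewrite /mfun msupp0 big_nil. Qed.

Lemma mfunZX a m : mfun (a *: 'X_[m]) = iota a * \prod_i w i (m i).
Proof.
have [->|a0] := eqVneq a 0; first by rewrite scale0r mfun0 rmorph0 mul0r.
by rewrite /mfun (perm_big _ (msuppZ _ a0)) /= msuppX big_seq1 mcoeffZ mcoeffX eqxx mulr1.
Qed.

Lemma mfun_sum (I : Type) (r : seq I) (P : pred I) (F : I -> {mpoly algC[N]}) :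
  mfun (\sum_(i <- r | P i) F i) = \sum_(i <- r | P i) mfun (F i).
Proof. by apply: (big_morph mfun mfunD mfun0). Qed.

Lemma mfunZ a P : mfun (a *: P) = iota a * mfun P.
Proof.
rewrite [P in LHS]mpolyE scaler_sumr mfun_sum mulr_sumr; apply: eq_bigr => m _.
by rewrite scalerA mfunZX rmorphM mulrA.
Qed.

Lemma mfun_altX (l : 'X_{1..N}) : mfun (altX l) = \det (\matrix_(i < N, j < N) w i (l j)).
Proof.
rewrite altX_sum mfun_sum; apply: eq_bigr => s _; rewrite mfunZX rmorph_sign.
by congr (_ * _); apply: eq_bigr => i _; rewrite !mxE mnmE.
Qed.

Lemma mfun_altX_split (y : 'I_N -> K) (g : nat -> K) (l : 'X_{1..N}) :
  (forall i n, w i n = g n * y i ^+ n) ->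
  mfun (altX l) = (\prod_j g (l j)) * alt y l.
Proof.
move=> wE; rewrite mfun_altX.
have -> : \prod_j g (l j) = \det (diag_mx (\row_j g (l j))).
  by rewrite det_diag; apply: eq_bigr => j _; rewrite mxE.
rewrite mulrC -det_mulmx; congr (\det _); apply/matrixP=> i j.
by rewrite mul_mx_diag !mxE wE mulrC.
Qed.

End MonomialFunctional.

Lemma mfun_altX_pow (K : fieldType) (iota : {rmorphism algC -> K}) N (y : 'I_N -> K)
  (g : nat -> K) (l : 'X_{1..N}) :
  mfun iota (fun i m => g m * y i ^+ m) (altX l) = (\prod_j g (l j)) * alt y l.
Proof. exact: mfun_altX_split. Qed.

(** Multiplication by $p_k$ raises one exponent by [k]. The exponents need no sorting afterwards,
    since [altX] accepts any of them. *)
Lemma psum_altX N k (l : 'X_{1..N}) :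
  psum (fun i : 'I_N => 'X_i : {mpoly algC[N]}) k * altX l =
  \sum_(j < N) altX (l + U_(j) *+ k)%MM.
Proof.
rewrite altX_sum mulr_sumr; under [RHS]eq_bigr do rewrite altX_sum.
rewrite exchange_big /=; apply: eq_bigr => s _.
rewrite mulr_suml [RHS](reindex_inj (@perm_inj _ s)) /=; apply: eq_bigr => i _.
rewrite -scalerAr; congr (_ *: _); rewrite mpolyXn -mpolyXD; congr (mpolyX _ _).
apply/mnmP=> j; rewrite !(mnmE, mnmDE, mulmnE, mnm1E).
by rewrite (inj_eq perm_inj) addnC.
Qed.

(** * Lagrange interpolation and the vanishing of the functional on even power sums *)

Section Lagrange.

Variables (K : fieldType) (N : nat).

(** The sum is the coefficient of degree $N-1$ in the interpolation formula, which returns [f]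
    itself. *)
Lemma lagrange_sum0 (y : 'I_N -> K) (f : {poly K}) : injective y -> (size f < N)%N ->
  \sum_k f.[y k] / \prod_(j | j != k) (y k - y j) = 0.
Proof.
move=> y_inj lt_fN.
pose L k := \prod_(j | j != k) ('X - (y j)%:P).
pose c k := f.[y k] / \prod_(j | j != k) (y k - y j).
have size_L k : size (L k) = N.
  rewrite /L -big_filter size_prod_XsubC -sum1_size big_filter (sum1_card (predC1 k)) cardC1
    card_ord prednK //.
  by case: N k => [[]|].
suffices fE : f = \sum_k c k *: L k.
  have : f`_N.-1 = 0 by apply: nth_default; case: N lt_fN.
  rewrite {1}fE coef_sum => f0; rewrite -[RHS]f0; apply: eq_bigr => k _.
  rewrite coefZ -[LHS]mulr1; congr (_ * _).
  have /monicP : L k \is monic by apply: monic_prod_XsubC.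
  by rewrite lead_coefE size_L.
apply/eqP; rewrite -subr_eq0; apply/eqP.
apply: (@roots_geq_poly_eq0 _ _ [seq y i | i : 'I_N]).
- apply/allP=> _ /mapP[i _ ->]; rewrite rootE hornerD hornerN horner_sum subr_eq0; apply/eqP.
  rewrite (bigD1 i) //= big1 ?addr0 => [|k ne_ki].
    rewrite hornerZ /L horner_prod /c; under [X in _ * X]eq_bigr do rewrite hornerXsubC.
    rewrite divfK //; apply/prodf_neq0 => j ne_ji; rewrite subr_eq0.
    by apply: contra_neq ne_ji => /y_inj.
  rewrite hornerZ /L horner_prod (bigD1 i) 1?eq_sym //= hornerXsubC subrr mul0r mulr0.
  by [].
- by rewrite map_inj_uniq ?enum_uniq.
rewrite size_map size_enum_ord (leq_trans (size_polyD _ _)) // geq_max (ltnW lt_fN) size_polyN.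
apply: (leq_trans (size_sum _ _ _)); apply/bigmax_leqP => k _.
by rewrite (leq_trans (size_scale_leq _ _)) // size_L.
Qed.

Definition vdm_prod (z : 'I_N -> K) : K :=
  \prod_(i < N) \prod_(j < N | (i < j)%N) (z j - z i).

Lemma vdm_prod_split (z : 'I_N -> K) (k : 'I_N) :
  vdm_prod z =
  (\prod_(i < N | i != k) \prod_(j < N | (i < j)%N && (j != k)) (z j - z i)) *
  ((-1) ^+ #|[pred j : 'I_N | (k < j)%N]| * \prod_(j | j != k) (z k - z j)).
Proof.
rewrite /vdm_prod (bigD1 k) //= mulrC.
have -> : \prod_(i | i != k) \prod_(j < N | (i < j)%N) (z j - z i) =
    \prod_(i < N | i != k) \prod_(j < N | (i < j)%N && (j != k)) (z j - z i) *
    \prod_(i < N | (i < k)%N) (z k - z i).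
  rewrite [X in _ * X](eq_bigl (fun i : 'I_N => (i != k) && (i < k)%N)) => [|i]; last first.
    by rewrite -val_eqE /=; case: ltngtP.
  rewrite big_mkcondr /= -big_split /=; apply: eq_bigr => i ne_ik.
  rewrite (bigID (fun j => j == k)) /= mulrC; congr (_ * _).
  case: ifP => lt_ik; first by rewrite (big_pred1 k) // => j /=; case: eqP => [->|];
    rewrite ?lt_ik ?andbF.
  by rewrite big_pred0 // => j; case: eqP => [->|]; rewrite ?lt_ik ?andbF.
rewrite -mulrA; congr (_ * _).
have -> : \prod_(j < N | (k < j)%N) (z j - z k) =
    (-1) ^+ #|[pred j : 'I_N | (k < j)%N]| * \prod_(j < N | (k < j)%N) (z k - z j).
  by rewrite -prodrN; apply: eq_bigr => j _; rewrite opprB.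
rewrite mulrCA; congr (_ * _); rewrite [RHS](bigID (fun j : 'I_N => (j < k)%N)) /=.
congr (_ * _); apply: eq_bigl => j; rewrite -val_eqE /=; first by case: ltngtP.
by case: ltngtP.
Qed.

End Lagrange.

Lemma nonrootX (K : fieldType) (u : K) k : nonroot u -> nonroot (u ^+ k.+1).
Proof.
move=> [u0 u_nr]; split=> [|n]; first exact: expf_neq0.
by rewrite -exprM mulSn addSn; apply: u_nr.
Qed.

Lemma stair_tail M k mu (t : 'I_k) : (size mu <= M)%N ->
  stair (M + k) mu (rshift M t) = (k.-1 - t)%N.
Proof.
move=> le_mu; rewrite /stair mnmE nth_default ?(leq_trans le_mu) ?leq_addr //=.
by have := ltn_ord t; lia.
Qed.

Section Kill.

Variables (K : fieldType) (nuK : nat_unit K) (iota : {rmorphism algC -> K}) (u : K).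
Hypothesis u_nr : nonroot u.

Local Notation S := (schurp iota).
Local Notation s := (u ^+ 2).

Let s_nr : nonroot s := nonrootX 1 u_nr.

(* Up to a factor depending only on N and |mu|, the functional of weight
   kweight m * y_i ^ m sends the alternant of mu to u^(kappa mu) s_mu. *)
Definition kweight (m : nat) : K := u ^+ (m ^ 2) / qfact s m.

(** Since $(l+2n)^2=l^2+4n^2+4ln$, the shift contributes $u^{4ln}=(s^{2l})^n$, polynomial in
    $s^{2l}$ because the shift is even. *)
Lemma kweight_shift l n :
  kweight (l + n.*2) * \prod_(t < n.*2) (1 - s ^+ t.+1.*2 * s ^+ l.*2) =
  kweight l * (u ^+ (4 * n ^ 2) * (s ^+ l.*2) ^+ n).
Proof.
have qE : qfact s (l + n.*2) = qfact s l * \prod_(t < n.*2) (1 - s ^+ t.+1.*2 * s ^+ l.*2).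
  rewrite /qfact big_split_ord /=; congr (_ * _); apply: eq_bigr => t _.
  by rewrite -exprD -doubleD addSn addnC.
have := qfact_neq0 s_nr (l + n.*2); rewrite /kweight qE mulf_eq0 negb_or => /andP[q0 p0].
have -> : ((l + n.*2) ^ 2 = l ^ 2 + (4 * n ^ 2 + 2 * l.*2 * n))%N by lia.
rewrite !exprD !exprM; field; exact/andP.
Qed.

Lemma kweight_neq0 m : kweight m != 0.
Proof.
by rewrite mulf_neq0 ?expf_neq0 ?invr_eq0 ?(qfact_neq0 s_nr) //; case: u_nr.
Qed.

Local Notation kfun := (@mfun K iota _ (fun i m => kweight m * geom s i ^+ m)).

(** Raising the exponent [k] gives, up to a common factor, $f(z_k)/\prod_{j\ne k}(z_k-z_j)$ with
    $z_j=s^{2l_j}$. The last $2n$ exponents are $2n-1,\dots,0$, and their Vandermonde factors cancel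
    the denominators from [kweight_shift]. *)
Lemma kfun_psum_altX M n la : (0 < n)%N -> sorted geq la -> (size la <= M)%N ->
  kfun (psum (fun i : 'I_(M + n.*2) =>
    'X_i : {mpoly algC[_]}) n.*2 * altX (stair (M + n.*2) la)) = 0.
Proof.
move=> n_gt0 la_s le_la; set N := (M + n.*2)%N.
pose l := stair N la; pose z (j : 'I_N) : K := s ^+ (l j).*2.
have z_inj : injective z by move=> i j /(nonroot_dbl_inj s_nr) /stair_inj_ord; apply.
have z0 j : z j != 0 by rewrite expf_neq0 //; case: s_nr.
have q1 : s ^+ n.*2.*2 - 1 != 0.
  rewrite subr_eq0; case: s_nr => _ /(_ n.*2.*2.-1); rewrite prednK //; lia.
(* The power is [n.-1] and not [n]: the product over all [j] in [tail] includes $j=k$, with factor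
   $(s^{4n}-1)z_k$, and removing it costs one power of $z_k$. *)
pose f : {poly K} := 'X ^+ n.-1 * \prod_(j < M) ((s ^+ n.*2.*2)%:P * 'X - (z (lshift _ j))%:P).
pose c1 : K := \prod_(t < n.*2) - s ^+ (n.*2.-1 - t).*2.
have tail k : \prod_j (s ^+ n.*2.*2 * z k - z j) =
    (\prod_(j < M) (s ^+ n.*2.*2 * z k - z (lshift _ j))) *
    (c1 * \prod_(t < n.*2) (1 - s ^+ t.+1.*2 * z k)).
  rewrite big_split_ord /=; congr (_ * _); rewrite -big_split /=; apply: eq_bigr => t _.
  have -> : z (rshift M t) = s ^+ (n.*2.-1 - t).*2 by rewrite /z /l stair_tail.
  have -> : s ^+ n.*2.*2 = s ^+ (n.*2.-1 - t).*2 * s ^+ t.+1.*2.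
    by rewrite -exprD; congr (_ ^+ _); have := ltn_ord t; lia.
  ring.
pose C := (\prod_j kweight (l j)) * s ^+ (mdeg l +
  n.*2) * vdm_prod z * u ^+ (4 * n ^ 2) * c1 / (s ^+ n.*2.*2 - 1).
rewrite psum_altX mfun_sum.
transitivity (\sum_k C * (f.[z k] / \prod_(j | j != k) (z k - z j))); last first.
  rewrite -mulr_sumr lagrange_sum0 ?mulr0 //.
  (* The degree is at most $n-1+M$, less than $N-1=M+2n-1$ because [n] is positive. *)
  apply: (@leq_ltn_trans (n.-1 + M).+1); last by rewrite /N; lia.
  apply: leq_trans (size_polyMleq _ _) _; rewrite size_polyXn addSn /= -addnS leq_add2l.
  apply: leq_trans (size_poly_prod_leq _ _) _; rewrite leq_subLR.
  apply: (@leq_trans (\sum_(j < M) 2).+1).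
    rewrite ltnS; apply: leq_sum => j _; apply: leq_trans (size_polyD _ _) _.
    rewrite geq_max size_polyN (leq_trans (size_polyC_leq1 _)) // andbT mul_polyC.
    by rewrite (leq_trans (size_scale_leq _ _)) // size_polyX.
  by rewrite sum_nat_const !card_ord; lia.
apply: eq_bigr => k _.
rewrite mfun_altX_pow alt_geom.
set lk := (l + _)%MM.
have lk_k : lk k = (l k + n.*2)%N by rewrite mnmDE mulmnE mnm1E eqxx mul1n.
have lk_j j : j != k -> lk j = l j.
  by move=> ne_jk; rewrite mnmDE mulmnE mnm1E eq_sym (negPf ne_jk) mul0n addn0.
have -> : mdeg lk = (mdeg l + n.*2)%N by rewrite mdegD mdegMn mdeg1 mul1n.
pose D c := \prod_(j | j != k) (c * z k - z j).
have -> : \prod_(j | j != k) (z k - z j) = D 1 by rewrite /D mul1r.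
have D0 : D 1 != 0.
  apply/prodf_neq0 => j ne_jk; rewrite mul1r subr_eq0; apply: contra_neq ne_jk => /z_inj //.
have [rest [vdmE vdmE']] : exists rest, vdm_prod z = rest * D 1 /\
    vdm s lk = rest * D (s ^+ n.*2.*2).
  have -> : vdm s lk = vdm_prod (fun j => s ^+ (lk j).*2) by [].
  rewrite !(vdm_prod_split _ k) !mulrA.
  eexists; split; first by rewrite /D mul1r; reflexivity.
  congr (_ * _); last first.
    by apply: eq_bigr => j /lk_j->; rewrite lk_k /z -exprD doubleD addnC.
  congr (_ * _); apply: eq_bigr => i /lk_j->; apply: eq_bigr => j /andP[_ /lk_j->] //.
have tailD := tail k; rewrite (bigD1 k) //= -/(D _) in tailD.
have kwE := kweight_shift (l k) n; rewrite -/(z k) in kwE.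
have fE : f.[z k] = z k ^+ n.-1 * \prod_(j < M) (s ^+ n.*2.*2 * z k - z (lshift n.*2 j)).
  rewrite hornerM hornerXn horner_prod; congr (_ * _); apply: eq_bigr => j _.
  by rewrite hornerD hornerN hornerM !hornerC hornerX.
have wE : \prod_j kweight (lk j) = kweight (l k + n.*2) * \prod_(j | j != k) kweight (l j).
  by rewrite (bigD1 k) //= lk_k; congr (_ * _); apply: eq_bigr => j /lk_j->.
have wE' : \prod_j kweight (l j) = kweight (l k) * \prod_(j | j != k) kweight (l j).
  by rewrite (bigD1 k).
rewrite fE /C vdmE vdmE' wE wE'.
move: tailD kwE; set P := \prod_(t < n.*2) _; set F := \prod_(j < M) _.
set D' := D (s ^+ _) => tailD kwE.
have nz : u ^+ (4 * n ^ 2) * z k ^+ n != 0.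
  by rewrite mulf_neq0 // expf_neq0 //; case: u_nr.
have P0 : P != 0.
  apply: contraNneq (kweight_neq0 (l k)) => P0; move: kwE; rewrite P0 mulr0 => /esym/eqP.
  by rewrite mulf_eq0 (negPf nz) orbF.
have zn : z k ^+ n = z k ^+ n.-1 * z k by rewrite -exprSr prednK.
have D'E : D' = F * (c1 * P) / ((s ^+ n.*2.*2 - 1) * z k).
  by rewrite -tailD; field; rewrite q1 z0.
have {kwE} -> : kweight (l k + n.*2) =
  kweight (l k) * (u ^+ (4 * n ^ 2) * (z k ^+ n.-1 * z k)) / P.
  by rewrite -zn -kwE mulfK.
rewrite D'E; move: (\prod_(i < N | _) _) => R; field.
by rewrite q1 P0 z0 D0.
exact: s_nr.
Qed.

(** Squaring $\mu_j+(N-1-j)$ produces $\kappa_\mu$ plus terms in [N] and $|\mu|$ alone; this is how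
    weights quadratic in the exponents encode [kappa]. *)
Lemma sum_stair_sqr N mu : (size mu <= N)%N ->
  (\sum_(j < N) stair N mu j ^ 2)%N%:Z =
  kappa mu + (2 * N%:Z - 1) * (sumn mu)%:Z + (\sum_(j < N) stair N [::] j ^ 2)%N%:Z.
Proof.
move=> le_mu.
have sumE (F : 'I_N -> nat) : (\sum_j F j)%N%:Z =
  \sum_j (F j)%:Z by rewrite (big_morph Posz PoszD (erefl _)).
have -> : (sumn mu)%:Z = \sum_(i < N) (nth 0%N mu i)%:Z.
  rewrite sumnE (big_nth 0%N) big_mkord (big_ord_widen N (fun i =>
    nth 0%N mu i)) // big_mkcond -sumE.
  by congr (Posz _); apply: eq_bigr => i _; case: ltnP => // le_i; rewrite nth_default.
rewrite /kappa (big_ord_widen N (fun i =>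
  (nth 0%N mu i)%:Z * ((nth 0%N mu i)%:Z - 2 * i.+1%:Z + 1))) //.
rewrite [X in _ = X + _ + _]big_mkcond mulr_sumr !sumE -!big_split; apply: eq_bigr => i _ /=.
rewrite !mnmE nth_nil add0n.
have -> : (if (i < size mu)%N then (nth 0%N mu i)%:Z * ((nth 0%N mu i)%:Z - 2 * i.+1%:Z +
  1) else 0) =
  (nth 0%N mu i)%:Z * ((nth 0%N mu i)%:Z - 2 * i.+1%:Z + 1).
  by case: ltnP => // le_i; rewrite nth_default ?mul0r.
by have := ltn_ord i; nia.
Qed.

Lemma kfun_altX N m mu : mu \in parts m -> (m <= N)%N ->
  kfun (altX (stair N mu)) = u ^ kappa mu * S mu (alph s 0) *
    (u ^ ((2 * N%:Z - 1) * m%:Z + (\sum_(j < N) stair N [::] j ^ 2)%N%:Z) *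
     (alt (geom s (N := N)) (stair N [::]) / \prod_(i < N) qfact s (stair N [::] i))).
Proof.
move=> mu_m le_mN; have le_mu : (size mu <= N)%N by apply: size_parts_leq mu_m le_mN.
have mu_s : sumn mu = m by move: mu_m; rewrite mem_parts => /andP[_ /eqP].
have u0 : u != 0 by case: u_nr.
rewrite mfun_altX_pow.
rewrite mulrACA (schurp_closed_form iota s_nr mu_m le_mN) -expfzDr // addrA -mu_s.
rewrite -sum_stair_sqr // -exprnP expr_sum /kweight big_split /= prodfV.
by rewrite -!mulrA; congr (_ * _); rewrite mulrC.
Qed.

(** [kfun] kills the right side of the hypothesis and turns the left side into the sum times a
    nonzero constant. Each [la] has at most [m'] rows, hence $2n$ empty ones. *)
Lemma sum_kappa_eq0 n m' (c d : seq nat -> algC) : (0 < n)%N ->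
  let X := psum (fun i : 'I_(m' + n.*2) => 'X_i : {mpoly algC[_]}) in
  \sum_(mu <- parts (m' + n.*2)) c mu *: altX (stair _ mu) =
    X n.*2 * \sum_(la <- parts m') d la *: altX (stair _ la) ->
  \sum_(mu <- parts (m' + n.*2)) iota (c mu) * (u ^ kappa mu * S mu (alph s 0)) = 0.
Proof.
move=> n_gt0 X; set N := (m' + n.*2)%N; move/(congr1 (fun P => kfun P)).
rewrite mulr_sumr !mfun_sum [RHS]big_seq [RHS]big1 => [|la la_m]; last first.
  rewrite -scalerAr mfunZ kfun_psum_altX ?mulr0 //; last exact: (size_parts_leq la_m (leqnn _)).
  by move: la_m; rewrite mem_parts => /andP[/andP[]].
set B := u ^ ((2 * N%:Z - 1) * N%:Z + (\sum_(j < N) stair N [::] j ^ 2)%N%:Z) *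
     (alt (geom s (N := N)) (stair N [::]) / \prod_(i < N) qfact s (stair N [::] i)).
have -> : \sum_(mu <- parts N) kfun (c mu *: altX (stair N mu)) =
    (\sum_(mu <- parts N) iota (c mu) * (u ^ kappa mu * S mu (alph s 0))) * B.
  rewrite mulr_suml !big_seq; apply: eq_bigr => mu mu_m.
  by rewrite mfunZ (kfun_altX mu_m (leqnn N)) -[RHS]mulrA.
move/eqP; rewrite mulf_eq0 => /orP[/eqP // |].
rewrite mulf_eq0 expfz_eq0 (negPf (proj1 u_nr)) andbF mulf_eq0 invr_eq0 /=.
rewrite (negPf (alt_delta_neq0 (geom_inj (N := N) s_nr))) /= => /eqP q0.
have /negP[] : \prod_(i < N) qfact s (stair N [::] i) != 0.
  by apply/prodf_neq0 => i _; apply: qfact_neq0.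
by rewrite q0.
Qed.

Lemma dhomog_altX N (l : 'X_{1..N}) : altX l \is (mdeg l).-homog.
Proof.
rewrite altX_sum; apply: rpred_sum => v _; apply: rpredZ.
by rewrite dhomogX /= mdeg_mperm.
Qed.

Lemma dhomog_psum N k : psum (fun i : 'I_N => 'X_i : {mpoly algC[N]}) k \is k.-homog.
Proof.
apply: rpred_sum => i _; rewrite -{2}[k]mul1n; apply: dhomogMn.
by rewrite dhomogX /= mdeg1.
Qed.

Lemma sum_porbits k (w : 'S_k) : (\sum_(A in porbits w) #|A|)%N = k.
Proof.
rewrite -[RHS](card_ord k) -sum1_card (partition_big (porbit w) (mem (porbits w))) => [|i _].
  apply: eq_bigr => A /imsetP[i _ ->]; rewrite -sum1_card; apply: eq_bigl => j.
  by rewrite -eq_porbit_mem eq_sym.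
exact: imset_f.
Qed.

(** The cycle [A0] contributes a factor $p_{2n}$ to [pperm w]; its cofactor times the alternant of
    [nu] is antisymmetric and expands in alternants, so [sum_kappa_eq0] applies. *)
Lemma sum_kappa_LR_eq0 k l n (w : 'S_k) (A0 : {set 'I_k}) nu :
  (0 < n)%N -> A0 \in porbits w -> #|A0| = n.*2 -> nu \in parts l ->
  \sum_(mu <- parts (k + l)) iota (\sum_(eta <- parts k) sym_irr k eta w * LR mu eta nu) *
    (u ^ kappa mu * S mu (alph s 0)) = 0.
Proof.
move=> n_gt0 A0_w A0_n nu_l.
have sumA0 := sum_porbits w; rewrite (bigD1 A0) //= A0_n in sumA0.
set k' := (\sum_(A in _ | _) _)%N in sumA0.
have E : (k + l = (k' + l) + n.*2)%N by rewrite -{1}sumA0; lia.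
pose N := ((k' + l) + n.*2)%N; pose x (i : 'I_N) : {mpoly algC[N]} := 'X_i.
pose Q := \prod_(A in porbits w | A != A0) psum x #|A|.
pose R := Q * altX (stair N nu).
have nu_s : sumn nu = l by move: nu_l; rewrite mem_parts => /andP[_ /eqP].
have le_lN : (l <= N)%N by rewrite /N; lia.
have le_klN : (k + l <= N)%N by rewrite E.
have R_anti : antisymmetric R.
  apply: antisymMl (@antisym_altX _ _); apply: rpred_prod => A _.
  apply/issymP=> t; rewrite /psum rmorph_sum [RHS](reindex_inj (@perm_inj _ t)) /=.
  apply: eq_bigr => i _; rewrite rmorphXn /= msymX; congr ('X_[_] ^+ _); apply/mnmP=> j.
  by rewrite !mnmE eq_sym (canF_eq (permKV t)) eq_sym.
have R_homog m : R@_m != 0 -> mdeg m = ((k' + l) + mdeg (stair N [::]))%N.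
  have Q_h : Q \is k'.-homog.
    apply: (big_ind2 (fun (p : {mpoly algC[N]}) d => p \is d.-homog)) => [|p d p' d'|A _].
    - exact: dhomog1.
    - exact: dhomogM.
    - exact: dhomog_psum.
  have /dhomog_nemf_coeff R_h := dhomogM Q_h (dhomog_altX (stair N nu)).
  move=> Rm; apply/eqP; move: Rm; apply: contraNT => ne_m; apply/eqP/R_h.
  by rewrite (mdeg_stair_part le_lN nu_l) addnA.
have le_k'N : (k' + l <= N)%N by rewrite /N leq_addr.
have RE := antisym_expand le_k'N R_anti R_homog.
rewrite E; apply: (sum_kappa_eq0 (d := fun la => R@_(stair N la))) => //=.
rewrite -/N -RE /R mulrA.
have <- : pperm w (psum x) = psum x n.*2 * Q by rewrite /pperm (bigD1 A0) //= A0_n.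
have le_kN : (k <= N)%N by rewrite -[k]addn0 (leq_trans _ le_klN) ?leq_add2l.
rewrite -(schur_mpolyE nu_l le_lN) mulrCA pperm_altX_sym_irr // mulr_sumr.
under eq_bigr do rewrite scaler_suml.
rewrite exchange_big big_seq [RHS]big_seq; apply: eq_bigr => eta eta_k /=.
rewrite -(schur_mpolyE eta_k le_kN) -scalerAr mulrCA mulrA.
rewrite (LR_spec eta_k nu_l le_klN) E -/N mulr_suml scaler_sumr !big_seq.
by apply: eq_bigr => mu mu_N; rewrite -scalerA -scalerAl (schur_mpolyE mu_N).
Qed.

End Kill.

(** * Fusion of two Schur functions *)

(** By symmetry of [f], each monomial of [f] may be permuted along with the term of the determinant
    that it multiplies. *)
Lemma symM_altX N (f : {mpoly algC[N]}) (l : 'X_{1..N}) : f \is symmetric ->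
  f * altX l = \sum_(a <- msupp f) f@_a *: altX (a + l)%MM.
Proof.
move=> /issymP f_sym; rewrite altX_sum mulr_sumr.
under [RHS]eq_bigr do rewrite altX_sum scaler_sumr.
rewrite exchange_big; apply: eq_bigr => w _ /=.
rewrite -[f in LHS](f_sym w^-1%g) {1}[f]mpolyE raddf_sum mulr_suml; apply: eq_bigr => a _ /=.
rewrite msymZ msymX -scalerAl -scalerAr scalerA [_ *
  (-1) ^+ w]mulrC -scalerA scalerA mulrC -scalerA.
congr (_ *: (_ *: _)); rewrite -mpolyXD; congr (mpolyX _ _).
by apply/mnmP=> i; rewrite !(mnmDE, mnmE) invgK.
Qed.

Section Fusion.

Variables (K : fieldType) (nuK : nat_unit K) (iota : {rmorphism algC -> K}) (s : K).
Hypothesis s_nr : nonroot s.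
Variable N : nat.

Local Notation S := (schurp iota).
Local Notation delta := (stair N [::]).
Local Notation t := (s ^+ N.*2 / s).
Local Notation Z := (geom s (N := N)).

Let s0 : s != 0 := proj1 s_nr.

Let t0 : t != 0.
Proof. by rewrite mulf_neq0 ?invr_eq0 ?expf_neq0. Qed.

(* q^(- (m^2 - (2 N - 1) m) / 2) for q = s^2: since (a + b)^2 = a^2 + b^2 + 2 a b,
   multiplying by x^b twists the weighted functional by q^(- a b). *)
Definition eweight m : K := t ^+ m / s ^+ (m ^ 2).

(* The letters q^(i + 1/2 - al_i), 0 <= i < N, for l_i = al_i + N - 1 - i. *)
Definition fused (l : 'X_{1..N}) (i : 'I_N) : K := t / s ^+ (l i).*2.

Lemma eweight_neq0 m : eweight m != 0.
Proof. by rewrite mulf_neq0 ?invr_eq0 ?expf_neq0. Qed.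

Lemma eweightD a b : eweight (a + b) = eweight a * eweight b / s ^+ (a * b).*2.
Proof.
rewrite /eweight; have -> : ((a + b) ^ 2 = a ^ 2 + b ^ 2 + (a * b).*2)%N by lia.
move: t => t'; rewrite !exprD; field.
by rewrite !expf_neq0.
Qed.

Local Notation funZ := (mfun iota (fun i m => eweight m * Z i ^+ m)).
Local Notation funY l := (mfun iota (fun i m => eweight m * fused l i ^+ m)).

(** Since $s^{2i+1}=t\,s^{-2(N-1-i)}$, the alternant in these letters is, transposed, a staircase
    alternant in the letters $s^{-2m_i}$. *)
Lemma alt_geom_fused (m : 'X_{1..N}) :
  alt Z m = t ^+ mdeg m * \det (\matrix_(i < N, j < N) (s ^+ (m i).*2)^-1 ^+ delta j).
Proof.
have -> : t ^+ mdeg m = \det (diag_mx (\row_i t ^+ m i)).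
  by rewrite det_diag mdegE -prodrXr; apply: eq_bigr => j _; rewrite mxE.
rewrite -det_mulmx -det_tr; congr (\det _); apply/matrixP=> i j.
rewrite mul_diag_mx !mxE mnmE nth_nil add0n /geom.
have -> : t = s ^+ (i.*2.+1 + (N - i.+1).*2).
  by rewrite -[RHS](mulfK s0) -exprSr; congr (_ ^+ _ / _); have := ltn_ord i; lia.
rewrite exprD exprMn -!exprM -mulrA -[LHS]mulr1; congr (_ * _).
rewrite exprVn -exprM -doubleMl -doubleMl mulnC.
by rewrite divff // expf_neq0.
Qed.

(** Compare the monomials $x^a$ of [f]. The cross term $\prod_js^{-2a_jl_j}$ of the weight of $a+l$
    is what evaluating $x^a$ at the letters [fused l] yields, and the same determinant in
    $s^{-2(a_i+l_i)}$ remains on both sides. *)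
Lemma mfun_sym_altX f (l : 'X_{1..N}) : f \is symmetric ->
  funZ (f * altX l) * (\prod_j eweight (delta j) * t ^+ mdeg delta) =
  (\prod_j eweight (l j) * t ^+ mdeg l) * funY l (f * altX delta).
Proof.
move=> f_sym; rewrite symM_altX // mfun_sum mulr_suml.
rewrite [f in RHS]mpolyE mulr_suml mfun_sum mulr_sumr; apply: eq_bigr => a _.
rewrite -scalerAl !mfunZ [RHS]mulrCA -mulrA; congr (_ * _).
rewrite mfun_altX_pow alt_geom_fused.
rewrite altX_sum ['X_[a] * _]mulr_sumr mfun_sum.
have -> : \sum_(w : 'S_N) funY l ('X_[a] * ((-1) ^+ w *: 'X_[delta#w])) =
   (\prod_j (eweight (a j) * t ^+ a j / s ^+ (a j * l j).*2)) *
   (\prod_j eweight (delta j) * t ^+ mdeg delta) *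
   \det (\matrix_(i < N, j < N) (s ^+ ((a + l)%MM i).*2)^-1 ^+ delta j).
  rewrite mulr_sumr; apply: eq_bigr => w _.
  rewrite -scalerAr -mpolyXD mfunZX rmorph_sign [RHS]mulrCA; congr (_ * _).
  rewrite (reindex_inj (@perm_inj _ w) (F := fun j => eweight (delta j))) /= mdegE -prodrXr.
  rewrite (reindex_inj (@perm_inj _ w) (F := fun j => t ^+ _)) /=.
  rewrite -!big_split; apply: eq_bigr => i _ /=.
  rewrite !mxE !mnmDE mnmE eweightD /fused; move: t t0 => t' t'0.
  move: (eweight _) (eweight _) => e1 e2; set d := delta _.
  rewrite exprMn !exprVn -!exprM doubleD mulnDl mulnDr !exprD -!muln2.
  rewrite ![(_ * 2)%N]mulnC -!mulnA [(a i * l i)%N]mulnC.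
  by field; rewrite !expf_neq0.
rewrite mdegD exprD.
have -> : \prod_j eweight ((a + l)%MM j) =
    \prod_j eweight (l j) * \prod_j (eweight (a j) / s ^+ (a j * l j).*2).
  by rewrite -big_split; apply: eq_bigr => j _ /=; rewrite mnmDE eweightD mulrAC [RHS]mulrC.
have -> : \prod_j (eweight (a j) * t ^+ a j / s ^+ (a j * l j).*2) =
    t ^+ mdeg a * \prod_j (eweight (a j) / s ^+ (a j * l j).*2).
  by rewrite mdegE -prodrXr -big_split; apply: eq_bigr => j _ /=; rewrite mulrAC [RHS]mulrC.
by ring.
Qed.

Lemma prod_eweight (l : 'X_{1..N}) :
  \prod_j eweight (l j) = s ^ ((2 * N%:Z - 1) * (mdeg l)%:Z - (\sum_j l j ^ 2)%N%:Z).
Proof.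
have tE : t = s ^ (2 * N%:Z - 1).
  by rewrite expfzDr // exprN1 -muln2 mulnC -PoszM.
rewrite /eweight tE big_split /= prodfV !prodrXr -mdegE !exprnP exprz_exp invr_expz -expfzDr //.
Qed.

Lemma prod_eweight_stair mu : (size mu <= N)%N ->
  \prod_j eweight (stair N mu j) = s ^ (- kappa mu) * \prod_j eweight (delta j).
Proof.
move=> le_mu; rewrite !prod_eweight sum_stair_sqr // mdeg_stair // -expfzDr // PoszD.
by congr (_ ^ _); ring.
Qed.

Lemma alt_fused l : alt (fused l) delta * t ^+ mdeg l = t ^+ mdeg delta * alt Z l.
Proof.
have := @mfun_sym_altX 1 l (rpred1 _); rewrite !mul1r.
rewrite !mfun_altX_pow.
have d0 : \prod_j eweight (delta j) != 0 by apply/prodf_neq0 => j _; apply: eweight_neq0.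
have l0 : \prod_j eweight (l j) != 0 by apply/prodf_neq0 => j _; apply: eweight_neq0.
move: t (\prod_j eweight (delta j)) (\prod_j eweight (l j)) d0 l0 => t' d' l' d0 l0 E.
apply: (mulfI (mulf_neq0 d0 l0)); rewrite -[LHS]mulrA [LHS]mulrCA.
by transitivity (l' * t' ^+ mdeg l * (d' * alt (fused l) delta)); [ring | rewrite -E; ring].
Qed.

(** In [mfun_sym_altX] take the Schur polynomial of [be] for [f]: the left side expands by [LR],
    with $s^{-\kappa_\nu}$ coming from the weights, and the right side is a single alternant at the
    fused letters. *)
Lemma schur_fusion al be d1 d2 : al \in parts d1 -> be \in parts d2 -> (d1 + d2 <= N)%N ->
  \sum_(nu <- parts (d1 + d2)) iota (LR nu al be) * (s ^ (- kappa nu) * S nu (psum Z)) =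
  s ^ (- kappa al - kappa be) * S al (psum Z) * S be (psum (fused (stair N al))).
Proof.
move=> al_d be_d le_N; set l := stair N al.
have le_d1 : (d1 <= N)%N by apply: leq_trans le_N; apply: leq_addr.
have le_d2 : (d2 <= N)%N by apply: leq_trans le_N; apply: leq_addl.
have d0 : \prod_j eweight (delta j) != 0 by apply/prodf_neq0 => j _; apply: eweight_neq0.
have altZ0 : alt Z delta != 0 by apply/alt_delta_neq0/geom_inj.
have le_al : (size al <= N)%N by apply: size_parts_leq al_d le_d1.
have le_be : (size be <= N)%N by apply: size_parts_leq be_d le_d2.
have E := mfun_sym_altX l (issym_schur_mpoly N be).
rewrite (schur_mpolyE be_d le_d2) mfun_altX_pow in E.
rewrite -(schurp_alt iota _ be_d le_d2) -(schur_mpolyE al_d le_d1) [schur_mpoly N be *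
  _]mulrA in E.
rewrite [schur_mpoly N be * _]mulrC (LR_spec al_d be_d le_N) [_ *
  altX delta]mulr_suml mfun_sum in E.
move: E; have -> : \sum_(nu <- parts (d1 +
  d2)) funZ (LR nu al be *: schur_mpoly N nu * altX delta) =
    (\sum_(nu <- parts (d1 + d2)) iota (LR nu al be) * (s ^ (- kappa nu) * S nu (psum Z))) *
    (\prod_j eweight (delta j) * alt Z delta).
  rewrite mulr_suml big_seq [RHS]big_seq; apply: eq_bigr => nu nu_d.
  rewrite -scalerAl (schur_mpolyE nu_d le_N) mfunZ mfun_altX_pow.
  rewrite -(schurp_alt iota _ nu_d le_N) prod_eweight_stair; first by ring.
  exact: size_parts_leq nu_d le_N.
rewrite (prod_eweight_stair le_al) (prod_eweight_stair le_be) => E.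
have altE := alt_fused l; rewrite -(schurp_alt iota _ al_d le_d1) in altE.
have tn0 : t ^+ mdeg delta != 0 by rewrite expf_neq0.
apply: (mulIf (mulf_neq0 (mulf_neq0 d0 altZ0) (mulf_neq0 d0 tn0))); rewrite mulrA E.
rewrite -/l expfzDr //; move: altE.
move: (alt Z delta) (alt (fused l) _) (t ^+ mdeg delta) (t ^+ mdeg l) => x1 x2 x3 x4 altE.
transitivity (s ^ (- kappa al) * s ^ (- kappa be) * (\prod_j eweight (delta j)) ^+ 2 *
  S be (psum (fused l)) * (x2 * x4)); first by ring.
by rewrite altE; ring.
Qed.

End Fusion.

Section NegativeAlphabet.

Variables (K : fieldType) (nuK : nat_unit K).

Lemma hsym_consN (a : K) p n :
  hsym (fun k => - a ^+ k + p k) n.+1 = hsym p n.+1 - a * hsym p n.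
Proof.
rewrite (hsym_add nuK) big_ord_recl big_ord_recl big1 => [|i _]; last first.
  by rewrite hsym_expN // /bump /= mul0r subr0 mul0r.
by rewrite !hsym_expN //= /bump /= subn0 subSS subn0; ring.
Qed.

Definition neg_alphabet (T : Type) (a : T -> K) (r : seq T) (k : nat) : K :=
  - \sum_(x <- r) a x ^+ k.

Lemma prod_neg_alphabet (T : Type) (a : T -> K) (r : seq T) c n : (size r <= n)%N ->
  \prod_(x <- r) (1 - c * a x) = \sum_(i < n.+1) c ^+ i * hsym (neg_alphabet a r) i.
Proof.
elim: r n => [|x r IHr] n le_n.
  rewrite big_nil big_ord_recl big1 ?mul1r ?addr0 // => i _.
  rewrite (@eq_hsym _ nuK _ (fun=> 0)) => [|k]; last by rewrite /neg_alphabet big_nil oppr0.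
  by rewrite hsym_zero // mulr0.
case: n le_n => // n le_n; rewrite big_cons.
have hE i : hsym (neg_alphabet a (x :: r)) i = hsym (fun k => - a x ^+ k + neg_alphabet a r k) i.
  by apply: eq_hsym => // k; rewrite /neg_alphabet big_cons opprD.
rewrite big_ord_recl hE hsym0 mulr1.
rewrite (eq_bigr (fun i : 'I_n.+1 => c ^+ i.+1 * hsym (neg_alphabet a r) i.+1 -
   c * a x * (c ^+ i * hsym (neg_alphabet a r) i))) => [|i _]; last first.
  by rewrite hE hsym_consN exprS; ring.
rewrite sumrB -mulr_sumr -(IHr n le_n) addrA.
have := IHr n.+1 (leqW le_n); rewrite big_ord_recl hsym0 mulr1 => <-.
by ring.
Qed.

Lemma hsym_neg_alphabet_eq0 (T : Type) (a : T -> K) (r : seq T) n : (size r < n)%N ->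
  hsym (neg_alphabet a r) n = 0.
Proof.
case: n => // n; rewrite ltnS => le_n.
have := prod_neg_alphabet a 1 (leqW le_n);
  rewrite (prod_neg_alphabet a 1 le_n) [RHS]big_ord_recr /=.
by rewrite -[LHS]addr0 => /addrI; rewrite expr1n mul1r.
Qed.

End NegativeAlphabet.

Section TwoLegSum.

Variables (K : fieldType) (nuK : nat_unit K) (iota : {rmorphism algC -> K}) (s : K).
Hypothesis s_nr : nonroot s.
Variable N : nat.

Local Notation S := (schurp iota).
Local Notation X := (alph s^-1 0).
Local Notation Z := (geom s (N := N)).

Let s0 : s != 0 := proj1 s_nr.
Let s'_nr : nonroot s^-1 := nonrootV s_nr.

Lemma alphV0E k : X k.+1 = (s ^+ k.+1 - s ^- k.+1)^-1.
Proof. by rewrite /alph expr0n sub0r !exprVn invrK -opprB invrN mulrNN mul1r. Qed.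

(** Row [i] changes the letter $s^{2i+1}$ into $s^{2i+1-2\mu_i}$; the difference of their powers,
    divided by $s^{k+1}-s^{-k-1}$, telescopes over the boxes of the row. *)
Lemma psum_fused mu k : (size mu <= N)%N ->
  X k.+1 * psum (fused s (stair N mu)) k.+1 =
  X k.+1 * psum Z k.+1 + neg_alphabet (ct s^-1) (boxes mu) k.+1.
Proof.
move=> le_mu; have d0 := alph_den_neq0 k s_nr; rewrite alphV0E.
apply: (mulfI d0); rewrite mulrDr !mulVKf //.
rewrite /neg_alphabet big_boxes (big_ord_widen N
  (fun i => \sum_(j < nth 0%N mu i) ct s^-1 (i, nat_of_ord j) ^+ k.+1)) // big_mkcond.
rewrite mulrN mulr_sumr -sumrB; apply: eq_bigr => i _.
have -> : (if (i < size mu)%N then \sum_(j < nth 0%N mu i) ct s^-1 (i : nat, j :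
  nat) ^+ k.+1 else 0) =
    \sum_(j < nth 0%N mu i) ct s^-1 (i : nat, j : nat) ^+ k.+1.
  by case: ltnP => // le_i; rewrite nth_default // big_ord0.
rewrite /fused mnmE /geom /ct /=.
have -> : s ^+ N.*2 / s / s ^+ (nth 0%N mu i + (N - i.+1)).*2 =
    s ^+ i.*2.+1 / s ^+ (nth 0%N mu i).*2.
  have -> : s ^+ N.*2 = s ^+ i.*2.+1 * s ^+ (N - i.+1).*2 * s.
    by rewrite -exprD -exprSr; congr (_ ^+ _); have := ltn_ord i; lia.
  rewrite doubleD exprD; field; rewrite !expf_neq0 //.
elim: (nth 0%N mu i) => [|a IHa]; first by rewrite big_ord0 mulr0 subr0 divr1.
rewrite big_ord_recr /= mulrDr opprD addrA -IHa {IHa} doubleS !exprVn invrK.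
rewrite [s ^+ i.*2.+1]exprS [s ^+ a.*2.+2]exprS [s ^+ a.*2.+1]exprS !(exprMn, exprVn).
move: d0 (expf_neq0 k.+1 s0) (expf_neq0 k.+1 (expf_neq0 a.*2 s0)) => _.
move: (s ^+ k.+1) ((s ^+ a.*2) ^+ _) ((s ^+ i.*2) ^+ _) => x y z x0 y0.
by field; rewrite x0 y0.
Qed.

Lemma fused_inj mu : sorted geq mu -> injective (fused s (stair N mu)).
Proof.
move=> mu_s i j; rewrite /fused => /mulfI eq_ij.
have /invr_inj/(nonroot_dbl_inj s_nr)/stair_inj_ord : (s ^+ (stair N mu i).*2)^-1 =
  (s ^+ (stair N mu j).*2)^-1.
  by apply: eq_ij; rewrite mulf_neq0 ?invr_eq0 ?expf_neq0.
exact.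
Qed.

Definition two_leg (Y : nat -> K) (d1 d2 : nat) : K :=
  \sum_(i < d2.+1) (if (i <= d1)%N then
    hsym Y (d1 - i) * hsym Y (d2 - i) * hsym (fun k => - Y k) i else 0).

(** Both sides are the coefficient of $c^i$ in Cauchy's identity for [alph s^-1 c]: by the content
    formula, and by splitting the alphabet into its part scaled by $c$ and the rest. *)
Lemma sum_schurp_content d i : (d <= N)%N ->
  \sum_(al <- parts d) S al X * S al (psum Z) * hsym (neg_alphabet (ct s^-1) (boxes al)) i =
  if (i <= d)%N then hsym (fun k => X k * psum Z k) (d - i) *
    hsym (fun k => - (X k * psum Z k)) i else 0.
Proof.
move=> le_dN; case: leqP => [le_id|lt_di]; last first.
  rewrite big_seq big1 // => al al_d; rewrite hsym_neg_alphabet_eq0 ?mulr0 // size_boxes.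
  by move: al_d; rewrite mem_parts => /andP[_ /eqP->].
pose b i := \sum_(al <- parts d) S al X * S al (psum Z) *
  hsym (neg_alphabet (ct s^-1) (boxes al)) i.
pose b' i := hsym (fun k => X k * psum Z k) (d - i) * hsym (fun k => - (X k * psum Z k)) i.
apply: (@polyfun_coef _ (fun n => s^-1 ^+ n.*2) d.+1 b b' (nonroot_dbl_inj s'_nr) _ i) => // M.
move: (s^-1 ^+ M.*2) => c.
transitivity (hsym (fun k => alph s^-1 c k * psum Z k) d).
  rewrite -(cauchy_alph_psum nuK iota _ s'_nr le_dN (geom_inj s_nr)).
  under eq_bigr do rewrite mulr_suml; rewrite exchange_big big_seq [RHS]big_seq;
    apply: eq_bigr => al al_d /=.
  rewrite (schurp_content iota s'_nr c al_d) (prod_neg_alphabet nuK _ _ (n := d)); last first.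
    by rewrite size_boxes; move: al_d; rewrite mem_parts => /andP[_ /eqP->].
  rewrite [RHS]mulrAC [RHS]mulr_sumr; apply: eq_bigr => j _.
  by rewrite -[LHS]mulrA; congr (_ * _); rewrite mulrC.
transitivity (hsym (fun k => c ^+ k * - (X k * psum Z k) + X k * psum Z k) d).
  by apply: eq_hsym => // k; rewrite /alph expr0n /= mulr0n; ring.
rewrite (hsym_add nuK); apply: eq_bigr => j _; rewrite hsym_scale // /b'.
by ring.
Qed.

(** The power of $s$ left by [schur_fusion] cancels the prefactor. Cauchy sums over [be] at the
    fused letters, where [psum_fused] isolates the contents of [al], ready for
    [sum_schurp_content]. *)
Lemma two_leg_sum d1 d2 : (d1 + d2 <= N)%N ->
  \sum_(al <- parts d1) \sum_(be <- parts d2) s ^ (kappa al + kappa be) * (S al X * S be X) *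
    (\sum_(nu <- parts (d1 + d2)) iota (LR nu al be) * (s ^ (- kappa nu) * S nu (psum Z))) =
  two_leg (fun k => X k * psum Z k) d1 d2.
Proof.
move=> le_N; have le_d1 : (d1 <= N)%N by apply: leq_trans le_N; apply: leq_addr.
have le_d2 : (d2 <= N)%N by apply: leq_trans le_N; apply: leq_addl.
transitivity (\sum_(al <- parts d1) \sum_(i < d2.+1)
   S al X * S al (psum Z) * hsym (neg_alphabet (ct s^-1) (boxes al)) i *
   hsym (fun k => X k * psum Z k) (d2 - i)); last first.
  rewrite exchange_big; apply: eq_bigr => i _ /=; rewrite -mulr_suml sum_schurp_content //.
  by case: ifP => _; rewrite ?mul0r //; ring.
rewrite !big_seq; apply: eq_bigr => al al_d.
have al_s : sorted geq al by move: al_d; rewrite mem_parts => /andP[/andP[]].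
have le_al : (size al <= N)%N by apply: size_parts_leq al_d le_d1.
transitivity (S al X * S al (psum Z) *
    (\sum_(be <- parts d2) S be X * S be (psum (fused s (stair N al))))).
  rewrite [RHS]mulr_sumr big_seq [RHS]big_seq; apply: eq_bigr => be be_d.
  rewrite (schur_fusion iota s_nr al_d be_d le_N) -opprD -invr_expz.
  have k0 : s ^ (kappa al + kappa be) != 0 by rewrite expfz_neq0.
  by field.
rewrite (cauchy_alph_psum nuK iota _ s'_nr le_d2 (fused_inj al_s)).
transitivity (S al X * S al (psum Z) * hsym (fun k =>
    neg_alphabet (ct s^-1) (boxes al) k + X k * psum Z k) d2).
  by congr (_ * _); apply: eq_hsym => // k; rewrite psum_fused // addrC.
by rewrite (hsym_add nuK) mulr_sumr; apply: eq_bigr => i _; rewrite mulrA.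
Qed.

End TwoLegSum.

(** * The vertices *)

Definition qcst : {rmorphism algC -> qfun} := @tofrac {poly algC} \o polyC.

Lemma qconstE c : qconst c = qcst c. Proof. by []. Qed.

(** This is $q^{1/4}$; the local [v] is $q^{1/2}$, so that [ct v] is $q$ to the content. *)
Definition qroot4 : qfun := tofrac ('X : {poly algC}).

Local Notation v := (qroot4 ^+ 2).

Lemma q4E k : q4 k = qroot4 ^ k. Proof. by []. Qed.

Lemma nonroot_u : nonroot qroot4.
Proof.
split=> [|n]; first by rewrite tofrac_eq0 polyX_eq0.
rewrite -[qroot4 ^+ _](rmorphXn (@tofrac {poly algC})) -tofrac1 tofrac_eq.
by apply/eqP => /(congr1 (size \o (@polyseq algC))) /=; rewrite size_polyXn size_polyC oner_eq0.
Qed.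

Lemma nonroot_v : nonroot v. Proof. exact: nonrootX nonroot_u. Qed.

Lemma nonroot_vV : nonroot v^-1. Proof. exact: nonrootV nonroot_v. Qed.

Lemma nat_unit_qfun : nat_unit qfun.
Proof.
move=> n; rewrite unitfE -(rmorph_nat qcst) fmorph_eq0.
by rewrite pnatr_eq0.
Qed.

Lemma q4D a b : q4 (a + b) = q4 a * q4 b.
Proof. by rewrite !q4E expfzDr //; case: nonroot_u. Qed.

Lemma q4_v a : q4 (2 * a) = v ^ a.
Proof. by rewrite q4E -exprz_exp. Qed.

Local Notation S := (schurp qcst).
Local Notation X := (alph v^-1 0).
Local Notation Xm := (alph v 0).

(* s_mu at minus the power sums of [power_sum_q]. *)
Definition schur_neg (mu : seq nat) : qfun := S mu Xm.

Lemma power_sum_qE k : power_sum_q k.+1 = X k.+1.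
Proof. by rewrite alphV0E /power_sum_q -mulrN !q4_v -exprnN. Qed.

Lemma alphN c k : - alph v c k = alph v^-1 c k.
Proof. by rewrite /alph !exprVn invrK -[v ^- k - _]opprB invrN mulrN. Qed.

Lemma sumn_parts m mu : mu \in parts m -> sumn mu = m.
Proof. by rewrite mem_parts => /andP[_ /eqP]. Qed.

Lemma W1E m mu : mu \in parts m -> W1 mu = S mu X.
Proof.
move=> mu_m; rewrite -(mmap_alph qcst 0 nonroot_vV mu_m) /W1.
apply: eq_bigr => l _; congr (_ * _); apply: eq_bigr => i _.
by rewrite power_sum_qE.
Qed.

Lemma schurp_conj_alph m mu c : mu \in parts m ->
  S (conj_part mu) (alph v^-1 c) = (-1) ^+ m * S mu (alph v c).
Proof.
move=> mu_m; rewrite (schurpN_conj _ _ mu_m); congr (_ * _); apply: eq_schurp => k.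
by rewrite -alphN opprK.
Qed.

Lemma W1_conj m mu : mu \in parts m -> W1 (conj_part mu) = (-1) ^+ m * schur_neg mu.
Proof.
by move=> mu_m; rewrite -(schurp_conj_alph _ mu_m) (W1E (conj_part_parts mu_m)).
Qed.

(** $\kappa_\mu$ is twice the sum of the contents, row by row. *)
Lemma prod_ct mu : \prod_(x <- boxes mu) ct v x = v ^ kappa mu.
Proof.
have v0 := proj1 nonroot_v.
rewrite big_boxes /kappa.
have -> : v ^ (\sum_(i < size mu) (nth 0%N mu i)%:Z * ((nth 0%N mu i)%:Z - 2 * i.+1%:Z + 1)) =
   \prod_(i < size mu) v ^ ((nth 0%N mu i)%:Z * ((nth 0%N mu i)%:Z - 2 * i.+1%:Z + 1)).
  by apply: (big_morph (fun k => v ^ k)) => [a b|//]; rewrite expfzDr.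
apply: eq_bigr => i _; elim: (nth 0%N mu i) => [|a IHa]; first by rewrite big_ord0 mul0r.
rewrite big_ord_recr /= IHa /ct /= !exprnP invr_expz -!expfzDr //; congr (_ ^ _).
by lia.
Qed.

Lemma W1_G m mu : mu \in parts m -> W1 mu = (-1) ^+ m * (q4 (2 * kappa mu) * schur_neg mu).
Proof.
by move=> mu_m; rewrite (W1E mu_m) (schurp_alphV0 qcst nonroot_v mu_m) prod_ct q4_v [RHS]mulrA.
Qed.

Lemma W1_neq0 m mu : mu \in parts m -> W1 mu != 0.
Proof. by move=> mu_m; rewrite (W1E mu_m) (schurp_alph0_neq0 _ nonroot_vV mu_m). Qed.

Lemma G_neq0 m mu : mu \in parts m -> schur_neg mu != 0.
Proof. by move=> mu_m; rewrite /schur_neg (schurp_alph0_neq0 _ nonroot_v mu_m). Qed.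

Lemma q4_G m mu : mu \in parts m -> q4 (2 * kappa mu) * schur_neg mu = schur_neg (conj_part mu).
Proof.
move=> mu_m; have E := W1_G mu_m.
rewrite -[in LHS](conj_partK mu_m) (W1_conj (conj_part_parts mu_m)) in E.
by move/mulfI: E => <- //; rewrite signr_eq0.
Qed.

(** Transposing twice in [q4_G] multiplies a nonzero value by $q^{(\kappa_\mu+\kappa_{\mu^t})/2}$,
    and $q^{1/2}$ is not a root of unity. *)
Lemma kappa_conj m mu : mu \in parts m -> kappa (conj_part mu) = - kappa mu.
Proof.
move=> mu_m; have mu'_m := conj_part_parts mu_m.
have E := q4_G mu'_m; rewrite (conj_partK mu_m) -(q4_G mu_m) mulrA -q4D -mulrDr in E.
move: E; rewrite -[RHS]mul1r => /(mulIf (G_neq0 mu_m)) /eqP.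
rewrite q4_v; set k := kappa _ + _ => v1.
suffices k0 : k = 0 by apply/eqP; rewrite -addr_eq0 -/k k0.
case: (nonroot_v) => _ v_nr; case: k v1 => [[//|n]|n].
  by rewrite -exprnP (negPf (v_nr n)).
by rewrite NegzE -exprnN invr_eq1 (negPf (v_nr n)).
Qed.

Lemma sum_G_LR d1 d2 al be : al \in parts d1 -> be \in parts d2 ->
  \sum_(mu <- parts (d1 + d2)) qconst (LR mu al be) * schur_neg mu = schur_neg al * schur_neg be.
Proof.
by move=> al_d be_d; rewrite (schurpM_alph qcst 0 nonroot_v al_d be_d).
Qed.

(** The coefficient of $c^b$ in $s_\nu[p(1-c)]$, by the coproduct. *)
Definition skew_sum (b : nat) (nu : seq nat) : qfun := \sum_(la <- parts b) Wskew nu la *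
  schur_neg la.

Lemma Wskew_parts nu la n b : nu \in parts n -> la \in parts b -> (b <= n)%N ->
  Wskew nu la = \sum_(tau <- parts (n - b)) qconst (LR nu la tau) * W1 tau.
Proof.
move=> nu_n la_b le_bn; rewrite /Wskew (sumn_parts nu_n);
  apply: big_parts_le_size (leq_subr _ _) _.
move=> tau ne_tau; rewrite LR_size ?qconstE ?rmorph0 ?mul0r //.
by rewrite (sumn_parts nu_n) (sumn_parts la_b); apply: contra_neq ne_tau; lia.
Qed.

Lemma Wskew_eq0 nu la n b : nu \in parts n -> la \in parts b -> (n < b)%N -> Wskew nu la = 0.
Proof.
move=> nu_n la_b lt_nb; rewrite /Wskew big1_seq // => tau _.
rewrite LR_size ?qconstE ?rmorph0 ?mul0r //.
by rewrite (sumn_parts nu_n) (sumn_parts la_b); lia.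
Qed.

Lemma T_eq0 nu n b : nu \in parts n -> (n < b)%N -> skew_sum b nu = 0.
Proof.
move=> nu_n lt_nb; rewrite /skew_sum big_seq big1 // => la la_b.
by rewrite (Wskew_eq0 nu_n la_b lt_nb) mul0r.
Qed.

Lemma sum_T nu n D c : nu \in parts n -> (n <= D)%N ->
  \sum_(b < D.+1) c ^+ b * skew_sum b nu = S nu (alph v^-1 c).
Proof.
move=> nu_n le_nD.
rewrite (schurp_coproduct nat_unit_qfun qcst c nonroot_vV nu_n) invrK.
rewrite (big_ord_widen D.+1 (fun i => c ^+ i * \sum_(la <- parts i) \sum_(tau <- parts (n - i))
   qcst (LR nu la tau) * (S la Xm * S tau X))) // [RHS]big_mkcond.
apply: eq_bigr => b _ /=; rewrite ltnS; case: leqP => [le_bn|lt_nb]; last first.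
  by rewrite (T_eq0 nu_n lt_nb) mulr0.
congr (_ * _); rewrite /skew_sum big_seq [RHS]big_seq; apply: eq_bigr => la la_b.
rewrite (Wskew_parts nu_n la_b le_bn) mulr_suml big_seq [RHS]big_seq.
apply: eq_bigr => tau tau_t; rewrite (W1E tau_t) -mulrA; congr (_ * _).
exact: mulrC.
Qed.

Definition hsym_sqr (sgn : qfun) (n : nat) : qfun := hsym (fun k => sgn * (X k * X k)) n.

Lemma sum_GG n : \sum_(mu <- parts n) schur_neg mu * schur_neg mu = hsym_sqr 1 n.
Proof.
rewrite (cauchy_alph nat_unit_qfun qcst _ _ _ nonroot_v nonroot_v).
apply: eq_hsym => [|k]; first exact: nat_unit_qfun.
by rewrite -alphN mul1r mulrNN.
Qed.

Lemma sum_GW n : \sum_(mu <- parts n) schur_neg mu * W1 mu = hsym_sqr (-1) n.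
Proof.
rewrite big_seq (eq_bigr (fun mu => S mu Xm * S mu X)) => [|mu /W1E-> //]; rewrite -big_seq.
rewrite (cauchy_alph nat_unit_qfun qcst _ _ _ nonroot_v nonroot_vV).
apply: eq_hsym => [|k]; first exact: nat_unit_qfun.
by rewrite -alphN mulrN mulN1r mulrNN.
Qed.

Section TriangularSums.

Variable V : nmodType.

Lemma sum_if_swap m n (F : nat -> V) :
  \sum_(a < m.+1) (if (a <= n)%N then F a else 0) =
    \sum_(a < n.+1) (if (a <= m)%N then F a else 0).
Proof.
rewrite (big_ord_widen (m + n).+1 (fun a => if (a <= n)%N then F a else 0)) ?ltnS ?leq_addr //.
rewrite (big_ord_widen (m + n).+1 (fun a => if (a <= m)%N then F a else 0)) ?ltnS ?leq_addl //.
rewrite big_mkcond [RHS]big_mkcond; apply: eq_bigr => a _; rewrite !ltnS.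
by case: (a <= m)%N; case: (a <= n)%N.
Qed.

Lemma triangle_cond n (F : nat -> nat -> V) :
  \sum_(a < n.+1) \sum_(e < (n - a).+1) F a e =
  \sum_(a < n.+1) \sum_(e < n.+1 | (a + e <= n)%N) F a e.
Proof.
apply: eq_bigr => a _; rewrite (big_ord_widen n.+1 (F a)) ?ltnS ?leq_subr //.
by apply: eq_bigl => e; rewrite ltnS leq_subRL // -ltnS.
Qed.

Lemma triangle_swap n (F : nat -> nat -> V) :
  \sum_(a < n.+1) \sum_(e < (n - a).+1) F a e = \sum_(e < n.+1) \sum_(a < (n - e).+1) F a e.
Proof.
rewrite triangle_cond (triangle_cond n (fun e a => F a e)) (exchange_big_dep predT) //=.
by apply: eq_bigr => e _; apply: eq_bigl => a; rewrite addnC.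
Qed.

Lemma triangle_diag n (F : nat -> nat -> V) :
  \sum_(a < n.+1) \sum_(e < (n - a).+1) F a e = \sum_(i < n.+1) \sum_(a < i.+1) F a (i - a)%N.
Proof.
elim: n => [|n IHn]; first by rewrite !big_ord1.
rewrite big_ord_recr /= subnn big_ord1 [RHS]big_ord_recr /= -IHn.
rewrite [X in _ = _ + X]big_ord_recr /= subnn addrA -big_split /=; congr (_ + _).
apply: eq_bigr => a _; have le_an : (a <= n)%N by rewrite -ltnS.
by rewrite subSn // big_ord_recr.
Qed.

End TriangularSums.

Lemma two_legC (Y : nat -> qfun) d1 d2 : two_leg Y d1 d2 = two_leg Y d2 d1.
Proof.
rewrite /two_leg (sum_if_swap _ _ (fun i => hsym Y (d1 - i) * hsym Y (d2 - i) * hsym (fun k =>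
  - Y k) i)).
by apply: eq_bigr => i _; case: ifP => // _; rewrite [hsym _ (d1 - _) * _]mulrC.
Qed.

Lemma sum_LR_G (f : seq nat -> qfun) d a rho : rho \in parts a ->
  \sum_(tau <- parts_le d) f tau * (\sum_(mu <- parts d) qconst (LR mu rho tau) * schur_neg mu) =
  if (a <= d)%N then schur_neg rho * \sum_(tau <- parts (d - a)) f tau * schur_neg tau else 0.
Proof.
move=> rho_a; case: leqP => [le_ad|lt_da]; last first.
  rewrite big1_seq // => tau _; rewrite big_seq big1 ?mulr0 // => mu mu_d.
  rewrite LR_size ?qconstE ?rmorph0 ?mul0r // (sumn_parts rho_a) (sumn_parts mu_d); lia.
rewrite (big_parts_le_size (leq_subr a d)) => [|tau ne_tau]; last first.
  rewrite big_seq big1 ?mulr0 // => mu mu_d.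
  rewrite LR_size ?qconstE ?rmorph0 ?mul0r // (sumn_parts rho_a) (sumn_parts mu_d); lia.
rewrite mulr_sumr big_seq [RHS]big_seq; apply: eq_bigr => tau tau_d.
by rewrite [RHS]mulrCA -(sum_G_LR rho_a tau_d) subnKC.
Qed.

Definition edge_coef (d : nat) (nu : seq nat) : qfun := \sum_(b < d.+1) hsym_sqr (-1) (d - b) *
  skew_sum b nu.

Lemma UE d nu : edge_coef d nu = \sum_(b < d.+1) hsym_sqr (-1) (d - b) * skew_sum b nu.
Proof. by []. Qed.

(** $q^{\kappa_\nu/2}G_\nu=G_{\nu^t}$ absorbs the power of $q$ in [W2]. After reindexing by
    transposes, summing over [nu] gives $G_\lambda G_\tau$, and [sum_GW] sums over $\tau$. *)
Lemma sum_W2 m mu d : mu \in parts m ->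
  \sum_(nu <- parts d) W2 mu nu * schur_neg nu = q4 (2 * kappa mu) * edge_coef d (conj_part mu).
Proof.
move=> mu_m; have mu'_m := conj_part_parts mu_m.
pose F nu := (\sum_(la <- parts_le m) Wskew (conj_part mu) la * Wskew nu la) * schur_neg nu.
have -> : \sum_(nu <- parts d) W2 mu nu * schur_neg nu =
  q4 (2 * kappa mu) * \sum_(nu <- parts d) F (conj_part nu).
  rewrite mulr_sumr big_seq [RHS]big_seq; apply: eq_bigr => nu nu_d.
  by rewrite /W2 /F (sumn_parts mu_m) q4D -(q4_G nu_d); ring.
rewrite big_conj_part; congr (_ * _); rewrite /F.
under eq_bigr do rewrite mulr_suml; rewrite exchange_big /= big_parts_le.
transitivity (\sum_(b < m.+1) if (b <= d)%N then hsym_sqr (-1) (d - b) *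
  skew_sum b (conj_part mu) else 0).
  apply: eq_bigr => b _; rewrite big_seq.
  transitivity (\sum_(la <- parts b | la \in parts b) if (b <= d)%N then
    Wskew (conj_part mu) la * schur_neg la * hsym_sqr (-1) (d - b) else 0); last first.
    rewrite -big_seq; case: ifP => _; last by rewrite big1.
    by rewrite mulrC /skew_sum mulr_suml.
  apply: eq_bigr => la la_b; under eq_bigr do rewrite -mulrA; rewrite -mulr_sumr.
  case: leqP => [le_bd|lt_db]; last first.
    rewrite big_seq big1 ?mulr0 // => nu nu_d.
    by rewrite (Wskew_eq0 nu_d la_b) ?mul0r.
  rewrite -mulrA; congr (_ * _); rewrite -sum_GW mulr_sumr.
  transitivity (\sum_(nu <- parts d) \sum_(tau <- parts (d - b)) W1 tau *
    (qconst (LR nu la tau) * schur_neg nu)).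
    rewrite big_seq [RHS]big_seq; apply: eq_bigr => nu nu_d.
    rewrite (Wskew_parts nu_d la_b le_bd) mulr_suml; apply: eq_bigr => tau _.
    by rewrite -mulrA mulrCA.
  rewrite exchange_big /= big_seq [RHS]big_seq; apply: eq_bigr => tau tau_d.
  have := sum_G_LR la_b tau_d; rewrite (subnKC le_bd) -mulr_sumr => ->.
  by rewrite mulrC mulrA.
rewrite (sum_if_swap m d (fun b => hsym_sqr (-1) (d - b) * skew_sum b (conj_part mu))) /edge_coef.
apply: eq_bigr => b _; case: leqP => // lt_mb.
by rewrite (T_eq0 mu'_m lt_mb) mulr0.
Qed.

Opaque schur_neg edge_coef skew_sum kappa W1 W2 Wskew.

Lemma mul_shuffle (R : comPzRingType) (w w1 w2 x1 x2 k1 k2 g1 g2 g3 : R) :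
  g1 * g2 * g3 * (k1 * k2 * (x1 * x2 * (w1 * w2 * w))) =
  k1 * g2 * w * (w1 * (x1 * g1) * (w2 * (x2 * (k2 * g3)))).
Proof. by ring. Qed.

Definition two_leg_alph (c : qfun) (k : nat) : qfun := X k * alph v c k.

Lemma prod_weights m1 m2 m3 mu1 mu2 mu3 :
  mu1 \in parts m1 -> mu2 \in parts m2 -> mu3 \in parts m3 ->
  \prod_(mu <- [:: mu1; mu2; mu3]) ((-1) ^+ sumn mu * W1 (conj_part mu)) =
    schur_neg mu1 * schur_neg mu2 * schur_neg mu3.
Proof.
have W1c m mu : mu \in parts m -> (-1) ^+ sumn mu * W1 (conj_part mu) = schur_neg mu.
  by move=> mu_m; rewrite (W1_conj mu_m) (sumn_parts mu_m) mulrA -expr2 sqrr_sign mul1r.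
move=> mu1_m mu2_m mu3_m; rewrite !big_cons big_nil mulr1 mulrA.
by rewrite (W1c _ _ mu1_m) (W1c _ _ mu2_m) (W1c _ _ mu3_m).
Qed.

(** * The physical vertex summed over its three legs *)

Section PhysicalSide.

Variables d1 d2 : nat.

(** The contribution of $|\rho|=a$ and of skewing partitions of size [e] in the third leg;
    [phys_coef i] collects $a+e=i$ and is free of [d3]. *)
Definition phys_term (a e : nat) : qfun :=
  if (a <= d1)%N then
    hsym_sqr 1 a * \sum_(mu <- parts d2) (-1) ^+ d2 * edge_coef (d1 - a) mu *
      skew_sum e (conj_part mu)
  else 0.

Definition phys_coef (i : nat) : qfun := \sum_(a < i.+1) phys_term a (i - a).

Lemma phys_fixed d3 mu2 : mu2 \in parts d2 ->
  \sum_(mu1 <- parts d1) \sum_(mu3 <- parts d3)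
     physical_vertex mu1 mu2 mu3 * (schur_neg mu1 * schur_neg mu2 * schur_neg mu3) =
  (-1) ^+ d2 * \sum_(a < d3.+1) (if (a <= d1)%N then
     hsym_sqr 1 a * edge_coef (d1 - a) mu2 * edge_coef (d3 - a) (conj_part mu2) else 0).
Proof.
move=> mu2_d; have mu2'_d := conj_part_parts mu2_d.
pose f rho := W2 (conj_part mu2) rho; pose g rho := W2 mu2 rho.
pose LG (h : seq nat -> qfun) d rho :=
  \sum_(tau <- parts_le d) h tau * (\sum_(mu <- parts d) qconst (LR mu rho tau) * schur_neg mu).
(* The leg weight of [mu2], its power of $q$ and the denominator of the vertex collapse to a
   sign. *)
have G2E : q4 (2 * kappa mu2) * schur_neg mu2 / W1 mu2 = (-1) ^+ d2.
  have nz := W1_neq0 mu2_d; apply: (mulIf nz); rewrite divfK //.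
  by rewrite (W1_G mu2_d) [RHS]mulrA -expr2 sqrr_sign mul1r.
transitivity ((-1) ^+ d2 * \sum_(rho <- parts_le d1) LG f d1 rho * LG g d3 rho).
  transitivity (\sum_(mu1 <- parts d1) \sum_(mu3 <- parts d3) (-1) ^+ d2 *
     \sum_(rho <- parts_le d1)
       (\sum_(tau <- parts_le d1) f tau * (qconst (LR mu1 rho tau) * schur_neg mu1)) *
       (\sum_(tau <- parts_le d3) g tau * (qconst (LR (conj_part mu3) rho tau) *
         schur_neg (conj_part mu3)))).
    rewrite big_seq [RHS]big_seq; apply: eq_bigr => mu1 mu1_d.
    rewrite big_seq [RHS]big_seq; apply: eq_bigr => mu3 mu3_d.
    rewrite /physical_vertex (sumn_parts mu1_d) (sumn_parts mu3_d) q4D -G2E -(q4_G mu3_d).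
    move: (q4 (2 * kappa mu2)) (q4 (2 * kappa mu3)) => k2 k3.
    rewrite mulrC !mulr_sumr; apply: eq_bigr => rho _.
    rewrite mulr_suml !mulr_sumr; apply: eq_bigr => tau _.
    rewrite !mulr_sumr; apply: eq_bigr => tau3 _.
    by rewrite !qconstE rmorphM mul_shuffle.
  under eq_bigr do rewrite -mulr_sumr exchange_big; rewrite -mulr_sumr exchange_big /=.
  congr (_ * _); apply: eq_bigr => rho _; rewrite /LG.
  under eq_bigr do rewrite -mulr_sumr.
  rewrite -mulr_suml; congr (_ * _).
    by rewrite exchange_big; apply: eq_bigr => tau _; rewrite mulr_sumr.
  rewrite (big_conj_part d3 (fun mu =>
    \sum_(tau <- parts_le d3) g tau * (qconst (LR mu rho tau) * schur_neg mu))).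
  by rewrite exchange_big; apply: eq_bigr => tau _; rewrite mulr_sumr.
congr (_ * _); rewrite big_parts_le.
rewrite (sum_if_swap d3 d1 (fun a =>
  hsym_sqr 1 a * edge_coef (d1 - a) mu2 * edge_coef (d3 - a) (conj_part mu2))).
apply: eq_bigr => a _; have le_a1 : (a <= d1)%N by rewrite -ltnS.
case: leqP => [le_a3|lt_3a]; last first.
  by rewrite big_seq big1 // => rho rho_a; rewrite /LG (sum_LR_G g d3 rho_a) leqNgt lt_3a mulr0.
rewrite -mulrA -sum_GG mulr_suml big_seq [RHS]big_seq; apply: eq_bigr => rho rho_a.
rewrite /LG (sum_LR_G f d1 rho_a) le_a1 (sum_LR_G g d3 rho_a) le_a3.
rewrite (sum_W2 _ mu2'_d) (sum_W2 _ mu2_d) (conj_partK mu2_d) (kappa_conj mu2_d).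
have kk : q4 (2 * - kappa mu2) * q4 (2 * kappa mu2) = 1.
  by rewrite -q4D mulrN addNr q4E expr0z.
move: (q4 _) (q4 _) kk => k1 k2 kk;
  move: (schur_neg rho) (edge_coef _ _) (edge_coef _ _) => g' u1 u2.
by transitivity (k2 * k1 * (g' * g' * (u2 * u1))); [ring | rewrite kk mul1r].
Qed.

Lemma phys_total d3 :
  \sum_(mu1 <- parts d1) \sum_(mu2 <- parts d2) \sum_(mu3 <- parts d3)
     physical_vertex mu1 mu2 mu3 * (schur_neg mu1 * schur_neg mu2 * schur_neg mu3) =
  \sum_(i < d3.+1) hsym_sqr (-1) (d3 - i) * phys_coef i.
Proof.
rewrite exchange_big big_seq /=.
under eq_bigr => mu2 mu2_d do rewrite (phys_fixed d3 mu2_d) mulr_sumr.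
rewrite -big_seq exchange_big /=.
transitivity (\sum_(a < d3.+1) \sum_(e < (d3 - a).+1) hsym_sqr (-1) (d3 - (a +
  e)) * phys_term a e).
  apply: eq_bigr => a _; rewrite /phys_term; case: leqP => [le_a1|lt_1a]; last first.
    by rewrite big1 ?mulr0 ?big1 // => *; rewrite mulr0.
  move: (edge_coef (d1 - a)) => U1; under [RHS]eq_bigr do rewrite mulrCA !mulr_sumr.
  rewrite exchange_big /=; apply: eq_bigr => mu _; rewrite UE mulrA !mulr_sumr.
  by apply: eq_bigr => e _; rewrite subnDA; ring.
rewrite (triangle_diag d3 (fun a e => hsym_sqr (-1) (d3 - (a + e)) * phys_term a e)).
apply: eq_bigr => i _; rewrite /phys_coef mulr_sumr; apply: eq_bigr => a _.
by rewrite subnKC // -ltnS.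
Qed.

(** With the factor $c^{a+e}$, [sum_T] sums over [e] to a Schur function at $p(1-c)$; the range
    loses nothing because [e] is at most [d2]. *)
Lemma phys_coefE c :
  \sum_(i < (d1 + d2).+1) phys_coef i * c ^+ i =
  \sum_(a < d1.+1) c ^+ a * (hsym_sqr 1 a * \sum_(mu <- parts d2)
     (-1) ^+ d2 * edge_coef (d1 - a) mu * S (conj_part mu) (alph v^-1 c)).
Proof.
pose F a e := phys_term a e * c ^+ (a + e).
transitivity (\sum_(i < (d1 + d2).+1) \sum_(a < i.+1) F a (i - a)%N).
  apply: eq_bigr => i _; rewrite /phys_coef mulr_suml; apply: eq_bigr => a _.
  by rewrite /F subnKC // -ltnS.
rewrite -triangle_diag.
pose f a := c ^+ a * (hsym_sqr 1 a * \sum_(mu <- parts d2)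
     (-1) ^+ d2 * edge_coef (d1 - a) mu * S (conj_part mu) (alph v^-1 c)).
transitivity (\sum_(a < (d1 + d2).+1) if (a <= d1)%N then f a else 0); last first.
  rewrite (sum_if_swap _ _ f); apply: eq_bigr => a _.
  by rewrite (leq_trans _ (leq_addr d2 d1)) // -ltnS.
apply: eq_bigr => a _; rewrite /F /phys_term /f; case: leqP => [le_a1|lt_1a]; last first.
  by rewrite big1 // => e _; rewrite mul0r.
move: (edge_coef (d1 - a)) => U1; rewrite !mulr_sumr;
  under eq_bigr do rewrite mulr_sumr mulr_suml.
rewrite exchange_big big_seq [RHS]big_seq; apply: eq_bigr => mu mu_d /=.
have le_D : (d2 <= d1 + d2 - a)%N; first by move: le_a1; lia.
rewrite -(sum_T c (conj_part_parts mu_d) le_D) !mulr_sumr; apply: eq_bigr => e _.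
by rewrite exprD; ring.
Qed.

(** Both sides are the coefficient of $c_1^b$ in Cauchy's identity between $p(1-c_1)$ and $-p(1-c)$;
    a parameter independent of [c] separates the values of [b]. *)
Lemma sum_T_schurp b c :
  (-1) ^+ d2 * \sum_(mu <- parts d2) skew_sum b mu * S (conj_part mu) (alph v^-1 c) =
  if (b <= d2)%N then hsym (two_leg_alph c) (d2 - b) * hsym (fun k =>
    - two_leg_alph c k) b else 0.
Proof.
case: leqP => [le_bd|lt_db]; last first.
  rewrite big_seq big1 ?mulr0 // => mu mu_d; by rewrite (T_eq0 mu_d lt_db) mul0r.
pose B b := (-1) ^+ d2 * \sum_(mu <- parts d2) skew_sum b mu * S (conj_part mu) (alph v^-1 c).
pose B' b := hsym (two_leg_alph c) (d2 - b) * hsym (fun k => - two_leg_alph c k) b.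
apply: (@polyfun_coef _ (fun n => v ^+ n.*2) d2.+1 B B' (nonroot_dbl_inj nonroot_v) _ b) => // M.
move: (v ^+ M.*2) => c1.
transitivity (hsym (fun k => alph v^-1 c1 k * alph v c k) d2); last first.
  transitivity (hsym (fun k => c1 ^+ k * - two_leg_alph c k + two_leg_alph c k) d2).
    apply: eq_hsym => [|k]; first exact: nat_unit_qfun.
    rewrite /two_leg_alph -!alphN /alph expr0n /= mulr0n; move: (v ^+ _ - _)^-1 => d; ring.
  rewrite (hsym_add nat_unit_qfun); apply: eq_bigr => i _; rewrite (hsym_scale nat_unit_qfun) /B'.
  by ring.
rewrite -(cauchy_alph nat_unit_qfun qcst _ _ _ nonroot_vV nonroot_v).
under eq_bigr do rewrite /B mulr_sumr mulr_suml.
rewrite exchange_big big_seq [RHS]big_seq; apply: eq_bigr => mu mu_d /=.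
rewrite -(sum_T c1 mu_d (leqnn d2)) mulr_suml; apply: eq_bigr => i _.
rewrite (schurp_conj_alph c mu_d).
have sg : (-1) ^+ d2 * (-1) ^+ d2 = 1 :> qfun by rewrite -expr2 sqrr_sign.
move: (skew_sum _ _) (S _ _) (c1 ^+ i) => x y z.
by transitivity ((-1) ^+ d2 * (-1) ^+ d2 * (z * x * y)); [ring | rewrite sg mul1r].
Qed.

(** The sums over [a] and [b] separate: $\sum_ac^ah_a[p^2]h_{n-a}[-p^2]=h_n[-p^2(1-c)]$, and
    [sum_T_schurp] gives the other factor. *)
Lemma phys_generating c :
  \sum_(i < (d1 + d2).+1) phys_coef i * c ^+ i = two_leg (two_leg_alph c) d1 d2.
Proof.
rewrite phys_coefE two_legC /two_leg.
pose M b := if (b <= d2)%N then hsym (two_leg_alph c) (d2 - b) * hsym (fun k =>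
  - two_leg_alph c k) b else 0.
transitivity (\sum_(a < d1.+1) \sum_(b < (d1 - a).+1)
    c ^+ a * hsym_sqr 1 a * hsym_sqr (-1) (d1 - a - b) * M b).
  apply: eq_bigr => a _; rewrite mulrA.
  transitivity (c ^+ a * hsym_sqr 1 a * \sum_(b < (d1 - a).+1) hsym_sqr (-1) (d1 - a - b) * M b).
    congr (_ * _); under [RHS]eq_bigr do rewrite /M -sum_T_schurp !mulr_sumr.
    rewrite exchange_big; apply: eq_bigr => mu _ /=; rewrite UE mulr_sumr mulr_suml.
    by apply: eq_bigr => b _; ring.
  by rewrite mulr_sumr; apply: eq_bigr => b _; rewrite mulrA.
rewrite (triangle_swap d1 (fun a b => c ^+ a * hsym_sqr 1 a * hsym_sqr (-1) (d1 - a - b) * M b)).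
apply: eq_bigr => b _; rewrite -mulr_suml.
have -> : \sum_(a < (d1 - b).+1) c ^+ a * hsym_sqr 1 a * hsym_sqr (-1) (d1 - a - b) =
  hsym (two_leg_alph c) (d1 - b).
  transitivity (hsym (fun k => c ^+ k * (1 * (X k * X k)) + -1 * (X k * X k)) (d1 - b)).
    rewrite (hsym_add nat_unit_qfun); apply: eq_bigr => a _.
    by rewrite (hsym_scale nat_unit_qfun) /hsym_sqr subnAC.
  apply: eq_hsym => [|k]; first exact: nat_unit_qfun.
  rewrite /two_leg_alph -!alphN /alph expr0n /= mulr0n; move: (_ - _)^-1 => d; ring.
rewrite /M; case: ifP => _; last by rewrite mulr0.
by ring.
Qed.

End PhysicalSide.

(** * The mathematical vertex: cancellation of its terms and the remaining sum *)

Lemma big_parts_le_part (V : nmodType) n k (F : seq nat -> V) : (k <= n)%N ->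
  (forall mu, partn_seq mu -> sumn mu != k -> F mu = 0) ->
  \sum_(mu <- parts_le n) F mu = \sum_(mu <- parts k) F mu.
Proof.
move=> le_kn F0; pose F' mu := if partn_seq mu then F mu else 0.
transitivity (\sum_(mu <- parts_le n) F' mu).
  by rewrite big_seq [RHS]big_seq; apply: eq_bigr => mu; rewrite mem_parts_le /F' => /andP[->].
rewrite (big_parts_le_size le_kn) => [|mu ne_mu]; last by rewrite /F'; case: ifP => // /F0 ->.
by rewrite big_seq [RHS]big_seq; apply: eq_bigr => mu; rewrite mem_parts /F' => /andP[->].
Qed.

Lemma sym_charE m mu nu : mu \in parts m ->
  sym_char mu nu =
  if [pick s : 'S_m | cycle_type s == nu] is Some s then sym_irr m mu s else 0.
Proof. by rewrite mem_parts => /andP[_ /eqP <-]. Qed.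

Lemma sumn_cycle_type m (s : 'S_m) : sumn (cycle_type s) = m.
Proof.
rewrite -[RHS](sum_porbits s) /cycle_type (perm_sumn (permEl (perm_sort _ _))).
by rewrite sumnE big_map big_enum.
Qed.

Lemma sym_char_size m mu nu : mu \in parts m -> sumn nu != m -> sym_char mu nu = 0.
Proof.
move=> mu_m ne_nu; rewrite (sym_charE _ mu_m); case: pickP => // s /eqP s_nu.
by rewrite -s_nu sumn_cycle_type eqxx in ne_nu.
Qed.

Lemma sym_char_nil : sym_char [::] [::] = 1.
Proof.
have nil0 : [::] \in parts 0 by rewrite mem_parts.
rewrite (sym_charE _ nil0); case: pickP => [s _ | /(_ 1%g)]; last first.
  by move/eqP; case; apply: size0nil; apply/eqP;
    rewrite -leqn0 -[X in (_ <= X)%N](sumn_cycle_type (1%g : 'S_0))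
    size_leq_sumn // ; apply/allP => k; rewrite mem_sort => /mapP[A];
      rewrite mem_enum => /imsetP[[]].
have := pperm_altX_sym_irr (leqnn 0) s; rewrite parts0 big_seq1 /pperm big1 ?mul1r => [|A];
  last first.
  by move=> /imsetP[[]].
move=> E; have := @altX_stair_neq0 0 [::] isT; rewrite {1}E => nz.
apply/eqP; rewrite -subr_eq0; apply: contraTT nz => ne1.
have : (sym_irr 0 [::] s - 1) *: altX (stair 0 [::]) = 0 by rewrite scalerBl -E scale1r subrr.
by move/eqP; rewrite scaler_eq0 (negPf ne1) /= => /eqP->; rewrite scaler0 negbK eqxx.
Qed.

Lemma sumn_double sg : sumn (double_part sg) = (sumn sg).*2.
Proof. by elim: sg => //= a sg ->; rewrite doubleD. Qed.

(** All that involves the third partition and $\eta^3$, for fixed $\sigma$ and $\nu=(\nu^3)^t$;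
    $q^{\kappa/4}$ comes from the prefactor of the vertex. *)
Definition edge_sum (d : nat) (sg nu : seq nat) : qfun :=
  \sum_(mu <- parts d) q4 (kappa mu) * schur_neg mu *
    \sum_(eta <- parts_le d) qconst (LR mu eta nu * sym_char eta (double_part sg)).

(** Without a permutation of cycle type $2\sigma$ the characters are 0 by convention. Otherwise the
    first part of $\sigma$ gives a cycle of positive even length, and [sum_kappa_LR_eq0] applies. *)
Lemma edge_sum_eq0 d n l sg nu : (0 < n)%N -> sg \in parts n -> nu \in parts l ->
  edge_sum d sg nu = 0.
Proof.
move=> n_gt0 sg_n nu_l; rewrite /edge_sum.
have term0 mu eta : mu \in parts d -> partn_seq eta -> (sumn eta != n.*2) || (d != n.*2 + l)%N ->
    qconst (LR mu eta nu * sym_char eta (double_part sg)) = 0.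
  move=> mu_d eta_p; have [eta_n /= ne_d|ne_eta _] := eqVneq (sumn eta) n.*2.
    rewrite LR_size ?mul0r ?qconstE ?rmorph0 //.
    by rewrite (sumn_parts mu_d) eta_n (sumn_parts nu_l).
  rewrite (@sym_char_size (sumn eta)) ?mulr0 ?qconstE ?rmorph0 //.
    by rewrite mem_parts eta_p eqxx.
  by rewrite sumn_double (sumn_parts sg_n) eq_sym.
have [d_eq|ne_d] := eqVneq d (n.*2 + l)%N; last first.
  rewrite big_seq big1 // => mu mu_d; rewrite big_seq big1 ?mulr0 // => eta.
  rewrite mem_parts_le => /andP[eta_p _]; apply: term0 => //.
  by rewrite ne_d orbT.
subst d; set d := (n.*2 + l)%N in term0 *.
rewrite (eq_big_seq (fun mu => q4 (kappa mu) * schur_neg mu *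
    \sum_(eta <- parts n.*2) qconst (LR mu eta nu * sym_char eta (double_part sg)))); last first.
  move=> mu mu_d; congr (_ * _); apply: big_parts_le_part;
    rewrite ?leq_addr // => eta eta_p ne_eta.
  by apply: term0; rewrite ?ne_eta.
case Ew : [pick w : 'S_(n.*2) | cycle_type w == double_part sg] => [w|]; last first.
  rewrite big1 // => mu _; rewrite big_seq big1 ?mulr0 // => eta eta_n.
  by rewrite (sym_charE _ eta_n) Ew mulr0 qconstE rmorph0.
have w_sg : cycle_type w == double_part sg by move: Ew; case: pickP => // w' w'_sg [<-].
have [A0 A0_w A0_n] : exists2 A, A \in porbits w & exists2 k, (0 < k)%N & #|A| = k.*2.
  case: sg sg_n w_sg {term0 Ew} => [|h sg]; first by rewrite mem_parts => /andP[_ /eqP /= n0];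
    have := n_gt0; lia.
  move=> sg_n /eqP w_sg; have : h.*2 \in cycle_type w by rewrite w_sg mem_head.
  rewrite mem_sort => /mapP[A]; rewrite mem_enum => A_w A_h; exists A => //; exists h => //.
  by move: sg_n; rewrite mem_parts => /andP[/andP[_ /andP[]]].
have [k k_gt0 A0_k] := A0_n.
have E := sum_kappa_LR_eq0 qcst nonroot_u k_gt0 A0_w A0_k nu_l.
rewrite -[RHS]E; rewrite big_seq [RHS]big_seq; apply: eq_bigr => mu mu_d.
rewrite q4E mulrC; congr (_ * _).
rewrite rmorph_sum big_seq [RHS]big_seq; apply: eq_bigr => eta eta_n.
by rewrite (sym_charE _ eta_n) Ew [_ * LR _ _ _]mulrC.
Qed.

Opaque edge_sum.

Lemma sign_shuffle (R : comPzRingType) (e1 e2 k1 k2 s1 s2 g x : R) :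
  e1 * e1 = 1 -> e2 * e2 = 1 -> k2 * g = e2 * s2 ->
  k1 * (k2 * k2) * (e1 * s1 * g) * (e1 * e2 * x) = k1 * k2 * (s1 * s2) * x.
Proof.
move=> e11 e22 gE; transitivity ((e1 * e1) * (k1 * k2 * s1 * (e2 * (k2 * g))) * x); first by ring.
by rewrite e11 gE [e2 * _]mulrA e22; ring.
Qed.

Lemma mul3_shuffle (R : comPzRingType) (a b e y : R) : a * (b * (e * y)) = e * (a * (b * y)).
Proof. by ring. Qed.

Lemma zee_nil : zee [::] = 1%N.
Proof. by rewrite /zee big_geq. Qed.

Lemma weight_shuffle (R : comPzRingType) (p k g b : R) : p * k * b * g = p * (k * g * b).
Proof. by ring. Qed.

Lemma vertex_shuffle (R : comPzRingType) (k3 g3 a b l q x z c : R) :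
  k3 * g3 * (a * b * l * q * x * (z * c)) = a * b * (q * x) * z * (k3 * g3 * (l * c)).
Proof. by ring. Qed.

Lemma edge_sum_nil d l nu : nu \in parts l ->
  edge_sum d [::] nu = if l == d then q4 (kappa nu) * schur_neg nu else 0.
Proof.
move=> nu_l; have nu_p : partn_seq nu by move: nu_l; rewrite mem_parts => /andP[].
transitivity (\sum_(mu <- parts d) if mu == nu then q4 (kappa nu) * schur_neg nu else 0).
  apply: eq_bigr => mu _.
  rewrite (big_parts_le_part (k := 0)) // => [|eta eta_p ne_eta]; last first.
    rewrite (@sym_char_size (sumn eta)) ?mulr0 ?qconstE ?rmorph0 // 1?eq_sym //.
    by rewrite mem_parts eta_p eqxx.
  rewrite parts0 big_seq1 LR_nil // sym_char_nil mulr1.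
  by case: eqP => [->|_]; rewrite qconstE ?rmorph1 ?rmorph0 ?mulr1 ?mulr0.
case: eqP => [<-|ne_ld].
  rewrite (bigD1_seq nu nu_l (uniq_parts l)) /= eqxx big1 ?addr0 // => mu /negPf-> //.
rewrite big_seq big1 // => mu mu_d; case: eqP => // mu_nu; case: ne_ld.
by rewrite -(sumn_parts mu_d) mu_nu (sumn_parts nu_l).
Qed.

(** As $|\sigma|=|\eta^1|$, [edge_sum_eq0] removes every nonempty $\eta^1$. Then [LR_nil] forces
    $\nu^1=\mu^1$, and [edge_sum_nil] forces $\mu^3=(\nu^3)^t$. *)
Lemma math_fixed d1 d2 d3 mu1 mu2 : mu1 \in parts d1 -> mu2 \in parts d2 ->
  \sum_(mu3 <- parts d3) mathematical_vertex mu1 mu2 mu3 * schur_neg mu3 =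
  q4 (- (2 * kappa mu1) + 4 * kappa mu2) *
  \sum_(nup <- parts (d1 + d2)) qconst (LR nup (conj_part mu1) mu2) *
    (q4 (- 4 * kappa nup) * \sum_(nu3 <- parts d3) W2 nup nu3 * schur_neg nu3).
Proof.
move=> mu1_d mu2_d.
pose A nup nu1 := qconst (LR nup (conj_part nu1) mu2).
pose B eta1 nu1 := qconst (LR mu1 (conj_part eta1) nu1).
pose z eta1 sg := qconst ((zee sg)%:R^-1 * sym_char eta1 sg).
pose w nup nu3 := q4 (- 4 * kappa nup - kappa nu3) * W2 nup nu3.
pose P := q4 (- (2 * kappa mu1) + 4 * kappa mu2).
transitivity (P * \sum_(nup <- parts_le (d1 +
  d2)) \sum_(nu1 <- parts_le d1) \sum_(nu3 <- parts_le d3)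
   \sum_(eta1 <- parts_le d1) \sum_(sg <- parts (sumn eta1))
     A nup nu1 * B eta1 nu1 * w nup nu3 * z eta1 sg * edge_sum d3 sg (conj_part nu3)).
  transitivity (\sum_(mu3 <- parts d3) P * \sum_(nup <- parts_le (d1 +
    d2)) \sum_(nu1 <- parts_le d1)
     \sum_(nu3 <- parts_le d3) \sum_(eta1 <- parts_le d1) \sum_(sg <- parts (sumn eta1))
     A nup nu1 * B eta1 nu1 * w nup nu3 * z eta1 sg * (q4 (kappa mu3) * schur_neg mu3 *
     \sum_(eta3 <- parts_le d3) qconst (LR mu3 eta3 (conj_part nu3) *
       sym_char eta3 (double_part sg)))).
    rewrite big_seq [RHS]big_seq; apply: eq_bigr => mu3 mu3_d.
    rewrite /mathematical_vertex (sumn_parts mu1_d) (sumn_parts mu2_d) (sumn_parts mu3_d).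
    have -> : - (2 * kappa mu1 - 4 * kappa mu2 - kappa mu3) =
        (- (2 * kappa mu1) + 4 * kappa mu2) + kappa mu3 by ring.
    rewrite q4D -/P; move: P (q4 (kappa mu3)) (schur_neg mu3) => p k3 g3.
    rewrite weight_shuffle /w; congr (p * _); move: (kappa) => kap.
    rewrite !mulr_sumr; apply: eq_bigr => nup _.
    rewrite !mulr_sumr; apply: eq_bigr => nu1 _.
    rewrite !mulr_sumr; apply: eq_bigr => nu3 _.
    rewrite !mulr_sumr; apply: eq_bigr => eta1 _.
    transitivity (\sum_(eta3 <- parts_le d3) \sum_(sg <- parts (sumn eta1))
      A nup nu1 * B eta1 nu1 * (q4 (- 4 * kap nup - kap nu3) * W2 nup nu3) * z eta1 sg * (k3 *
        g3 *
      qconst (LR mu3 eta3 (conj_part nu3) * sym_char eta3 (double_part sg)))).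
      rewrite !mulr_sumr; apply: eq_bigr => eta3 _.
      rewrite !qconstE rmorph_sum !mulr_sumr; apply: eq_bigr => sg _.
      rewrite /A /B /z !qconstE !rmorphM.
      exact: vertex_shuffle.
    rewrite exchange_big; apply: eq_bigr => sg _ /=.
    by rewrite !mulr_sumr.
  rewrite -mulr_sumr; congr (_ * _).
  rewrite exchange_big; apply: eq_bigr => nup _ /=.
  rewrite exchange_big; apply: eq_bigr => nu1 _ /=.
  rewrite exchange_big; apply: eq_bigr => nu3 _ /=.
  rewrite exchange_big; apply: eq_bigr => eta1 _ /=.
  rewrite exchange_big; apply: eq_bigr => sg _ /=.
  by rewrite -mulr_sumr.
congr (_ * _).
transitivity (\sum_(nup <- parts_le (d1 + d2)) A nup mu1 *
   (q4 (- 4 * kappa nup) * \sum_(nu3 <- parts d3) W2 nup nu3 * schur_neg nu3)); last first.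
  rewrite (big_parts_le_part (leqnn _)) // => nup nup_p ne_nup.
  rewrite /A LR_size ?qconstE ?rmorph0 ?mul0r //.
  by rewrite (sumn_parts (conj_part_parts mu1_d)) (sumn_parts mu2_d).
apply: eq_bigr => nup _.
have mu1_p : partn_seq mu1 by move: mu1_d; rewrite mem_parts => /andP[].
transitivity (\sum_(nu1 <- parts_le d1) if nu1 == mu1 then A nup nu1 *
   (q4 (- 4 * kappa nup) * \sum_(nu3 <- parts d3) W2 nup nu3 * schur_neg nu3) else 0).
  rewrite big_seq [RHS]big_seq; apply: eq_bigr => nu1; rewrite mem_parts_le => /andP[nu1_p _].
  transitivity (\sum_(nu3 <- parts_le d3) A nup nu1 * B [::] nu1 * w nup nu3 *
      edge_sum d3 [::] (conj_part nu3)).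
    rewrite big_seq [RHS]big_seq; apply: eq_bigr => nu3; rewrite mem_parts_le => /andP[nu3_p _].
    have nu3'_l : conj_part nu3 \in parts (sumn nu3) by apply: conj_part_parts;
      rewrite mem_parts nu3_p eqxx.
    rewrite (big_parts_le_part (k := 0)) // => [|eta1 eta1_p ne_eta1].
      by rewrite parts0 !big_seq1 /= parts0 big_seq1 /z sym_char_nil zee_nil invr1 mulr1 qconstE
        rmorph1 mulr1.
    rewrite big_seq big1 // => sg sg_n.
    by rewrite (edge_sum_eq0 d3 _ sg_n nu3'_l) ?mulr0 // lt0n.
  rewrite /B LR_nil // eq_sym; case: eqP => [->|_]; last first.
    by rewrite big1 // => nu3 _; rewrite qconstE rmorph0 mulr0 !mul0r.
  rewrite qconstE rmorph1 mulr1.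
  rewrite (big_parts_le_part (leqnn d3)) => [|nu3 nu3_p ne_nu3]; last first.
    rewrite (edge_sum_nil d3 (l := sumn nu3)) ?(negPf ne_nu3) ?mulr0 //.
    by apply: conj_part_parts; rewrite mem_parts nu3_p eqxx.
  rewrite [RHS]mulrA [RHS]mulr_sumr big_seq [RHS]big_seq; apply: eq_bigr => nu3 nu3_d.
  rewrite -mulrA -[RHS]mulrA; congr (_ * _);
    rewrite (edge_sum_nil d3 (conj_part_parts nu3_d)) eqxx.
  rewrite /w (kappa_conj nu3_d) -(q4_G nu3_d) !q4D.
  (* Two powers $q^{-\kappa/4}$, from the vertex and from [edge_sum_nil] after transposition,
     against the $q^{\kappa/2}$ of [q4_G]. *)
  have kk : q4 (- kappa nu3) * q4 (- kappa nu3) * q4 (2 * kappa nu3) = 1.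
    by rewrite -!q4D (_ : _ + _ = 0) ?q4E ?expr0z //; ring.
  move: (q4 (- kappa nu3)) (q4 (2 * _)) (q4 (- 4 * _)) kk => k1 k2 k3 kk.
  move: (W2 _ _) (schur_neg _) => x g.
  by transitivity (k1 * k1 * k2 * (k3 * (x * g))); [ring | rewrite kk mul1r].
rewrite (big_parts_le_part (leqnn d1)) => [|nu1 nu1_p ne_nu1]; last first.
  by case: eqP => // nu1_mu1; rewrite nu1_mu1 (sumn_parts mu1_d) eqxx in ne_nu1.
by rewrite (bigD1_seq mu1 mu1_d (uniq_parts d1)) /= eqxx [X in _ + X]big1 ?addr0 // =>
  nu1 /negPf->.
Qed.

Section MathematicalSide.

Variables d1 d2 : nat.

Definition math_coef (i : nat) : qfun :=
  \sum_(mu1 <- parts d1) \sum_(mu2 <- parts d2)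
    q4 (- (2 * kappa mu1) + 4 * kappa mu2) * (schur_neg mu1 * schur_neg mu2) *
    \sum_(nup <- parts (d1 + d2)) qconst (LR nup (conj_part mu1) mu2) *
      (q4 (- (2 * kappa nup)) * skew_sum i (conj_part nup)).

Lemma math_total d3 :
  \sum_(mu1 <- parts d1) \sum_(mu2 <- parts d2) \sum_(mu3 <- parts d3)
     mathematical_vertex mu1 mu2 mu3 * (schur_neg mu1 * schur_neg mu2 * schur_neg mu3) =
  \sum_(i < d3.+1) hsym_sqr (-1) (d3 - i) * math_coef i.
Proof.
under [RHS]eq_bigr do rewrite mulr_sumr; rewrite [RHS]exchange_big /=.
rewrite big_seq [RHS]big_seq; apply: eq_bigr => mu1 mu1_d.
under [RHS]eq_bigr do rewrite mulr_sumr; rewrite [RHS]exchange_big /=.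
rewrite big_seq [RHS]big_seq; apply: eq_bigr => mu2 mu2_d.
transitivity (schur_neg mu1 * schur_neg mu2 *
  \sum_(mu3 <- parts d3) mathematical_vertex mu1 mu2 mu3 * schur_neg mu3).
  by rewrite [RHS]mulr_sumr; apply: eq_bigr => mu3 _; rewrite mulrCA.
rewrite (math_fixed d3 mu1_d mu2_d).
transitivity (q4 (- (2 * kappa mu1) + 4 * kappa mu2) * (schur_neg mu1 * schur_neg mu2) *
  \sum_(i < d3.+1) \sum_(nup <- parts (d1 + d2)) hsym_sqr (-1) (d3 - i) *
   (qconst (LR nup (conj_part mu1) mu2) * (q4 (- (2 * kappa nup)) *
     skew_sum i (conj_part nup)))); last first.
  rewrite [LHS]mulr_sumr; apply: eq_bigr => i _; rewrite [RHS]mulrCA; congr (_ * _).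
  by rewrite [RHS]mulr_sumr.
rewrite exchange_big mulrCA mulrA; congr (_ * _).
rewrite big_seq [RHS]big_seq; apply: eq_bigr => nup nup_d /=.
rewrite (sum_W2 d3 nup_d) UE [q4 (- 4 * _) * _]mulrA -q4D.
have -> : - 4 * kappa nup + 2 * kappa nup = - (2 * kappa nup) by ring.
rewrite [LHS]mulrA [LHS]mulr_sumr; apply: eq_bigr => i _.
by move: (qconst _) (q4 _) (hsym_sqr _ _) (skew_sum _ _) => a b c d; ring.
Qed.

Lemma eq_two_leg (Y Y' : nat -> qfun) e1 e2 : (forall k, Y k.+1 = Y' k.+1) ->
  two_leg Y e1 e2 = two_leg Y' e1 e2.
Proof.
move=> eqY; apply: eq_bigr => i _; case: ifP => // _.
rewrite !(eq_hsym nat_unit_qfun eqY); congr (_ * _).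
by apply: eq_hsym => [|k]; [exact: nat_unit_qfun | rewrite eqY].
Qed.

(** Restricted to $c=v^{2N}$, since [two_leg_sum] needs actual letters, and at least $d_1+d_2$ of
    them. *)
Lemma math_generating N : (d1 + d2 <= N)%N ->
  \sum_(i < (d1 + d2).+1) math_coef i * (v ^+ N.*2) ^+ i =
    two_leg (two_leg_alph (v ^+ N.*2)) d1 d2.
Proof.
move=> le_N; set c := v ^+ N.*2.
rewrite -(@eq_two_leg (fun k => X k * psum (geom v (N := N)) k)); last first.
  by move=> k; rewrite /two_leg_alph psum_geom //; exact: nonroot_v.
rewrite -(two_leg_sum nat_unit_qfun qcst nonroot_v le_N).
pose H al be := v ^ (kappa al + kappa be) * (S al X * S be X) *
    (\sum_(nu <- parts (d1 + d2)) qcst (LR nu al be) * (v ^ (- kappa nu) *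
      S nu (psum (geom v (N := N))))).
(* The vertex carries the transpose of [mu1] in its [LR], which is the [al] of the two-leg sum. *)
rewrite -(big_conj_part d1 (fun al => \sum_(be <- parts d2) H al be)).
under eq_bigr do rewrite mulr_suml; rewrite exchange_big big_seq [RHS]big_seq.
apply: eq_bigr => mu1 mu1_d /=; under eq_bigr do rewrite mulr_suml.
rewrite exchange_big big_seq [RHS]big_seq; apply: eq_bigr => mu2 mu2_d /=.
have mu1'_d := conj_part_parts mu1_d.
have G1 : schur_neg mu1 = (-1) ^+ d1 * S (conj_part mu1) X.
  by rewrite -(W1E mu1'_d) (W1_conj mu1_d) mulrA -expr2 sqrr_sign mul1r.
have G2 : q4 (2 * kappa mu2) * schur_neg mu2 = (-1) ^+ d2 * S mu2 X.
  by rewrite -(W1E mu2_d) (W1_G mu2_d) [RHS]mulrA -expr2 sqrr_sign mul1r.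
transitivity (q4 (- (2 * kappa mu1) + 4 * kappa mu2) * (schur_neg mu1 * schur_neg mu2) *
   \sum_(nup <- parts (d1 + d2)) qconst (LR nup (conj_part mu1) mu2) *
     (q4 (- (2 * kappa nup)) * ((-1) ^+ (d1 + d2) * S nup (alph v c)))).
  under eq_bigr do rewrite -mulrA; rewrite -mulr_sumr; congr (_ * _).
  under eq_bigr do rewrite mulr_suml; rewrite exchange_big big_seq [RHS]big_seq.
  apply: eq_bigr => nup nup_d /=.
  rewrite -(schurp_conj_alph c nup_d) -(sum_T c (conj_part_parts nup_d) (leqnn _)).
  rewrite !mulr_sumr; apply: eq_bigr => i _.
  by move: (qconst _) (q4 _) (c ^+ i) (skew_sum _ _) => a b e d; ring.
have -> : 4 * kappa mu2 = 2 * kappa mu2 + 2 * kappa mu2 by ring.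
have v0 := proj1 nonroot_v; rewrite q4_v in G2.
rewrite !q4D G1 /H (kappa_conj mu1_d).
rewrite (_ : - (2 * kappa mu1) = 2 * - kappa mu1) ?q4_v; last by rewrite mulrN.
rewrite expfzDr //.
set x := \sum_(nu <- _) _ * (_ * S nu (psum _)).
have -> : \sum_(nup <- parts (d1 + d2)) qconst (LR nup (conj_part mu1) mu2) *
    (q4 (- (2 * kappa nup)) * ((-1) ^+ (d1 + d2) * S nup (alph v c))) = (-1) ^+ (d1 + d2) * x.
  rewrite /x mulr_sumr; apply: eq_bigr => nup _.
  rewrite (_ : - (2 * kappa nup) = 2 * - kappa nup) ?q4_v; last by rewrite mulrN.
  have -> : S nup (alph v c) = S nup (psum (geom v (N := N))).
    by apply: eq_schurp => k; rewrite (psum_geom N k nonroot_v).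
  rewrite qconstE; move: (qcst _) (v ^ _) ((-1) ^+ _) (S _ _) => a b e y; exact: mul3_shuffle.
rewrite exprD; have sg n : (-1) ^+ n * (-1) ^+ n = 1 :> qfun by rewrite -expr2 sqrr_sign.
exact: sign_shuffle (sg d1) (sg d2) G2.
Qed.

End MathematicalSide.

Lemma phys_coef_eq0 d1 d2 i : (d1 + d2 < i)%N -> phys_coef d1 d2 i = 0.
Proof.
move=> lt_i; apply: big1 => a _; rewrite /phys_term; case: leqP => // le_a.
rewrite big_seq big1 ?mulr0 // => mu mu_d.
by rewrite (T_eq0 (conj_part_parts mu_d)) ?mulr0 //; lia.
Qed.

Lemma math_coef_eq0 d1 d2 i : (d1 + d2 < i)%N -> math_coef d1 d2 i = 0.
Proof.
move=> lt_i; apply: big1 => mu1 _; apply: big1 => mu2 _.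
rewrite big_seq big1 ?mulr0 // => nup nup_d.
by rewrite (T_eq0 (conj_part_parts nup_d)) ?mulr0.
Qed.

(** The generating polynomials agree at $c=v^{2(N+d_1+d_2)}$ for every [N], the shift providing
    enough letters. Indices above $d_1+d_2$, outside these polynomials, are settled by vanishing. *)
Lemma phys_coef_math_coef d1 d2 i : phys_coef d1 d2 i = math_coef d1 d2 i.
Proof.
have [lt_i|le_i] := ltnP (d1 + d2) i; first by rewrite phys_coef_eq0 // math_coef_eq0.
pose a N := (qroot4 ^+ 2) ^+ (N + (d1 + d2)).*2.
apply: (@polyfun_coef _ a (d1 + d2).+1) => //.
  by move=> N M /(nonroot_dbl_inj nonroot_v) /addIn.
by move=> N; rewrite phys_generating math_generating ?leq_addl.
Qed.

Theorem theorem3 :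
  partition_series (fun mu1 mu2 mu3 : seq nat =>
    physical_vertex mu1 mu2 mu3 *
    \prod_(mu <- [:: mu1; mu2; mu3]) ((-1) ^+ sumn mu * W1 (conj_part mu))) =
  partition_series (fun mu1 mu2 mu3 : seq nat =>
    mathematical_vertex mu1 mu2 mu3 *
    \prod_(mu <- [:: mu1; mu2; mu3]) ((-1) ^+ sumn mu * W1 (conj_part mu))).
Proof.
have weights vertex d1 d2 d3 :
    partition_series (fun mu1 mu2 mu3 : seq nat => vertex mu1 mu2 mu3 *
      \prod_(mu <- [:: mu1; mu2; mu3]) ((-1) ^+ sumn mu * W1 (conj_part mu))) d1 d2 d3 =
    \sum_(mu1 <- parts d1) \sum_(mu2 <- parts d2) \sum_(mu3 <- parts d3)
      vertex mu1 mu2 mu3 * (schur_neg mu1 * schur_neg mu2 * schur_neg mu3).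
  rewrite /partition_series big_seq [RHS]big_seq; apply: eq_bigr => mu1 mu1_d.
  rewrite big_seq [RHS]big_seq; apply: eq_bigr => mu2 mu2_d.
  rewrite big_seq [RHS]big_seq; apply: eq_bigr => mu3 mu3_d.
  by rewrite (prod_weights mu1_d mu2_d mu3_d).
do 3!apply: functional_extensionality => ?; rewrite !weights phys_total math_total.
by apply: eq_bigr => i _; rewrite phys_coef_math_coef.
Qed.
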